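(* Let $\mathbb{H}$ be a separable Hilbert space with orthonormal basis $\{\phi_j,\ j\ge 1\}$, and let $Y=\{Y_t,\ t\in\mathbb{Z}\}$ be a centered AR$\mathbb{H}$(1) process, $Y_t=\Gamma_0(Y_{t-1})+\varepsilon_t$, $t\in\mathbb{Z}$, satisfying Assumptions A1 and A2 (given in the context). For $x\in\mathbb{H}$ let $$V_n(x)=\frac{1}{\sqrt n}\sum_{i=1}^n\bigl(Y_i-\Gamma_0(Y_{i-1})\bigr)\,\mathbf{1}_{\{Y_{i-1}\in E(x)\}},\qquad E(x)=\{u\in\mathbb{H}:\ \langle u,\phi_j\rangle_{\mathbb{H}}\le\langle x,\phi_j\rangle_{\mathbb{H}},\ j\ge 1\}.$$ Then, for each $x\in\mathbb{H}$, as $n\to\infty$, $$V_n(x)\to_D V_\infty(x)\sim\mathcal{N}(0,C_x),$$ where $V_\infty(x)$ is a zero-mean $\mathbb{H}$-valued Gaussian random variable whose autocovariance operator is $C_x=P_{Y_0}(E(x))\,C_0^{\varepsilon}$. Thus, as $\langle x,\phi_j\rangle_{\mathbb{H}}\to\infty$, $j\ge1$, one has $$V_n(x)\to_D\mathcal{Z}\sim\mathcal{N}(0,C_0^{\varepsilon}),\qquad n\to\infty.$$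
   Context: All random variables are defined on a probability space $(\Omega,\mathcal{A},P)$, and $\to_D$ denotes convergence in distribution. Setting. $Y$ is a zero-mean AR$\mathbb{H}$(1) process: the unique stationary solution of $Y_t=\Gamma_0(Y_{t-1})+\varepsilon_t$, $t\in\mathbb{Z}$, where $\Gamma_0$ is a (known) bounded linear operator on $\mathbb{H}$ with operator norm $\|\Gamma_0\|_{\mathcal{L}(\mathbb{H})}<1$. The innovation process $\varepsilon=\{\varepsilon_t\}$ is $\mathbb{H}$-valued strong white noise ($\mathbb{H}$-SWN): the $\varepsilon_t$ are i.i.d. zero-mean $\mathbb{H}$-valued random variables with $E\|\varepsilon_t\|_{\mathbb{H}}^2=\sigma_\varepsilon^2<\infty$. The marginals of $Y$ satisfy $E\|Y_t\|^2_{\mathbb{H}}<\infty$. $C_0^{\varepsilon}=E[\varepsilon_0\otimes\varepsilon_0]$ is the (trace class) autocovariance operator of $\varepsilon$. $P_{Y_0}$ and $P_{\varepsilon_1}$ are the marginal laws on $\mathbb{H}$ of $Y$ and $\varepsilon$. Assumption A1. $Y$ is a strictly stationary AR$\mathbb{H}$(1) process with $\mathbb{H}$-SWN innovation $\varepsilon$ such that $E\|\varepsilon_1\|_{\mathbb{H}}^4<\infty$, and both $\mu=P_{Y_0}$ and $\mu=P_{\varepsilon_1}$ satisfy the Carleman condition: $m_n:=\int_{\mathbb{H}}\|x\|_{\mathbb{H}}^n\,d\mu(x)<\infty$ for all $n\ge1$, and $\sum_{n\ge1}m_n^{-1/n}=\infty$. Assumption A2. $Y_0$ is independent of $\varepsilon_i$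 for all $i\ge1$.
   Formalization: In the last sentence, the limit as ⟨x,φ_j⟩→∞ is proved under the added condition P_{Y_0}(E(x))→1 (without it the claim can fail, as P_{Y_0}(E(x)) may be 0 for all x in H), and also for formal thresholds tending to infinity uniformly in j. *)

(* Defs.v *)
From HB Require Import structures.
From mathcomp Require Import all_boot all_order all_algebra.
From mathcomp Require Import all_classical all_reals all_analysis.

Set Implicit Arguments.
Unset Strict Implicit.
Unset Printing Implicit Defensive.

Import Order.TTheory GRing.Theory Num.Theory.
Import numFieldNormedType.Exports.

Local Open Scope classical_set_scope.
Local Open Scope ring_scope.

Definition borel (T : topologicalType) := g_sigma_algebraType (@open T).

Definition separable (T : topologicalType) :=
  exists2 D : set T, countable D & dense D.

(* A real Hilbert space is a complete normed module whose norm is induced by a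
   symmetric positive definite bilinear form. *)
Definition inner_product (R : realType) (H : completeNormedModType R)
    (ip : {dot H for idfun}) :=
  forall u : H, ip u u = `|u| ^+ 2.

Definition orthonormal_basis (R : realType) (H : completeNormedModType R)
    (ip : {dot H for idfun}) (phi : nat -> H) :=
  (forall i j, ip (phi i) (phi j) = (i == j)%:R) /\
  (forall x : H, series (fun j => ip x (phi j) *: phi j) @ \oo --> x).

(* +oo when f is unbounded *)
Definition opnorm (R : realType) (H : completeNormedModType R) (f : H -> H) :
    \bar R :=
  ereal_sup [set `|f u|%:E | u in [set u : H | `|u| <= 1]].

Section random_elements.
Context d (Omega : measurableType d) (R : realType) (P : probability Omega R).

Definition independent2 d1 d2 (T1 : measurableType d1) (T2 : measurableType d2)
    (X : Omega -> T1) (Y : Omega -> T2) :=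
  forall (A : set T1) (B : set T2), measurable A -> measurable B ->
    P (X @^-1` A `&` Y @^-1` B) = (P (X @^-1` A) * P (Y @^-1` B))%E.

Definition mutually_independent (I : choiceType) d1 (T : measurableType d1)
    (X : I -> Omega -> T) :=
  forall (s : seq I) (A : I -> set T), uniq s ->
    (forall i, measurable (A i)) ->
    P (\bigcap_(i in [set` s]) X i @^-1` A i) =
    (\prod_(i <- s) P (X i @^-1` A i))%E.

Definition identically_distributed (I : Type) d1 (T : measurableType d1)
    (X : I -> Omega -> T) :=
  forall (i j : I) (A : set T), measurable A ->
    P (X i @^-1` A) = P (X j @^-1` A).

(* Shift invariance of the finite-dimensional distributions, tested on
   measurable rectangles. *)
Definition strictly_stationary d1 (T : measurableType d1)
    (X : int -> Omega -> T) :=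
  forall (h : int) (s : seq int) (A : int -> set T),
    (forall t, measurable (A t)) ->
    P (\bigcap_(t in [set` s]) X (t + h) @^-1` A t) =
    P (\bigcap_(t in [set` s]) X t @^-1` A t).

Context (H : completeNormedModType R) (ip : {dot H for idfun}).

(* E[X] = m for an H-valued X, in the weak sense (the equation forces the
   scalar expectations to be finite). *)
Definition has_expectation (X : Omega -> H) (m : H) :=
  forall h : H, ('E_P[fun w => ip (X w) h] = (ip m h)%:E)%E.

Definition hexpectation (X : Omega -> H) : H :=
  xget 0 [set m | has_expectation X m].

(* (X (x) X) h = <X, h> X *)
Definition has_autocov (X : Omega -> H) (C : H -> H) :=
  forall h : H, has_expectation (fun w => ip (X w) h *: X w) (C h).

Definition autocov (X : Omega -> H) : H -> H :=
  fun h => hexpectation (fun w => ip (X w) h *: X w).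

Definition strong_white_noise (eps : int -> {RV P >-> borel H}) :=
  [/\ mutually_independent eps,
      identically_distributed eps,
      forall t, has_expectation (eps t) 0 &
      forall t, ('E_P[(fun w => `|(eps t w : H)| ^+ 2)%R] < +oo)%E].

End random_elements.

Section laws.
Context (R : realType) (H : completeNormedModType R) (ip : {dot H for idfun}).

Definition moment (mu : probability (borel H) R) (n : nat) : \bar R :=
  (\int[mu]_x (`|(x : H)| ^+ n)%:E)%E.

(* The inverse is taken in [0, +oo], so the law concentrated at 0 (m_n = 0)
   satisfies the condition. *)
Definition carleman (mu : probability (borel H) R) :=
  (forall n, (1 <= n)%N -> (moment mu n < +oo)%E) /\
  (\sum_(1 <= n <oo) (poweR (moment mu n) n%:R^-1)^-1 = +oo)%E.

(* N(m, s^2); the library's normal_prob m 0 is not the point mass at m. *)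
Definition normal_law (m s : R) : set R -> \bar R :=
  if s == 0 then dirac m else normal_prob m s.

Definition gaussian_law (nu : probability (borel H) R) :=
  forall h : H, exists m s : R, forall A : set R, measurable A ->
    nu [set x : borel H | A (ip x h)] = normal_law m s A.

Definition centered_gaussian (nu : probability (borel H) R) (C : H -> H) :=
  [/\ gaussian_law nu,
      has_expectation nu ip (fun x : borel H => x : H) 0 &
      has_autocov nu ip (fun x : borel H => x : H) C].

(* X_i ->_D nu along the filter F on the index set. *)
Definition cvg_in_law (I : Type) (F : set_system I) d
    (Omega : measurableType d) (P : probability Omega R)
    (X : I -> Omega -> H) (nu : probability (borel H) R) :=
  forall f : H -> R, continuous f -> bounded_fun f ->
    (\int[P]_w (f (X i w))%:E)%E @[i --> F] -->
    (\int[nu]_x (f (x : H))%:E)%E.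

End laws.

Section process.
Context (R : realType) (H : completeNormedModType R) (ip : {dot H for idfun})
  (phi : nat -> H) d (Omega : measurableType d) (P : probability Omega R)
  (Gamma : {linear H -> H}) (eps Y : int -> {RV P >-> borel H}).

Definition arh1 :=
  [/\ continuous Gamma /\ (opnorm Gamma < 1)%E,
      strong_white_noise ip eps,
      forall t, {ae P, forall w, (Y t w : H) = Gamma (Y (t - 1) w) + eps t w},
      strictly_stationary P Y &
      forall t, has_expectation P ip (Y t) 0 /\
                ('E_P[(fun w => `|(Y t w : H)| ^+ 2)%R] < +oo)%E].

Definition assumption_A1 :=
  [/\ arh1,
      ('E_P[(fun w => `|(eps 1 w : H)| ^+ 4)%R] < +oo)%E,
      carleman (distribution P (Y 0)) &
      carleman (distribution P (eps 1))].

Definition assumption_A2 :=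
  forall i : nat, (1 <= i)%N -> independent2 P (Y 0) (eps i%:Z).

Definition below (x : H) : set (borel H) :=
  [set u | forall j, ip u (phi j) <= ip x (phi j)].

(* below x for a formal x whose coordinates c_j are prescribed in [-oo, +oo]:
   along elements of H, whose coordinates are square summable, <x, phi_j>
   cannot tend to +oo uniformly in j. *)
Definition below_coord (c : nat -> \bar R) : set (borel H) :=
  [set u | forall j, ((ip u (phi j))%:E <= c j)%E].

(* V_n(x) is empirical n E for E = below x. *)
Definition empirical (n : nat) (E : set (borel H)) (w : Omega) : H :=
  (Num.sqrt n%:R)^-1 *:
    \sum_(1 <= i < n.+1)
      \1_E (Y (i%:Z - 1) w) *: ((Y i%:Z w : H) - Gamma (Y (i%:Z - 1) w)).

End process.

(* Main.v *)
Require Import Defs.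
From HB Require Import structures.
From mathcomp Require Import all_boot all_order all_algebra.
From mathcomp Require Import all_classical all_reals all_analysis.
From mathcomp Require Import measurable_realfun zify ring lra.
Import Order.TTheory GRing.Theory Num.Theory.
Import numFieldNormedType.Exports.
Set Implicit Arguments.
Unset Strict Implicit.
Unset Printing Implicit Defensive.
Local Open Scope classical_set_scope.
Local Open Scope ring_scope.

(**
Almost surely, V_n(x) is a normalised sum of terms 1_E(Y_(i-1)) eps_i, where the
indicator depends on the past of the innovation that it multiplies. Hence every
scalar projection of the sum is a martingale, and the proof is a martingale central
limit theorem carried out with characteristic functions.

Iterating the recursion, Y_t differs from a finite sum of innovations by
Gamma^m Y_(t-m), which tends to zero because Gamma is a contraction. So Y_t is
measurable for the completed sigma-algebra of the innovations up to time t
([Y_gen]), and disjoint sets of times give independent sigma-algebras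
([gen_by_indep]). The same expansion shows that Lipschitz functions of Y_i and Y_(i+m)
have a covariance of geometric order in m ([decorrelation]); this gives a mean-square
law of large numbers, first for Lipschitz functions and then, through Lipschitz
envelopes, for the indicator of a closed set ([closed_lln]). The orthants E(x) are
closed.

Fix a vector u and write s2 for the variance of <u, eps_0>. Multiplying
cos(<u, S_k> + a) by the exponential of s2 / (2n) times the number of indices selected
so far compensates the conditional variance of each term: the expectation then moves
by O(n^(-3/2)) per step, by Taylor's formula and the fourth moment
([compensated_step]). The frequency of selected indices converges to P(Y_0 in E), so
the compensator becomes deterministic and the cosine has the Gaussian limit
([transform_cf_cvg]).

Convergence of these expectations for all u and a is turned into convergence in law by
[cvg_in_law_trig]. A bounded continuous function is an increasing limit of Lipschitz
ones; a Lipschitz function of a vector is close in mean to a function of finitely many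
coordinates, because the second moments along the basis are dominated by the summable
diagonal of the covariance; and such a function is close in mean to a combination of
cosines, by Bernstein polynomials in the sines of the coordinates ([trig_approx]).

The limit law has to be constructed ([gaussian_exists]). The binary digits of a uniform
number are split into rows that spell independent uniform numbers, quantiles turn them
into independent normals, and Gram-Schmidt for the covariance form combines them into
coordinates that are almost surely square summable. That all projections are normal
follows from their characteristic functions, by the approximation argument above on the
line ([cf_unique]). The operator defined through weak expectations is identified with
the covariance form by the Riesz representation ([ip_autocov]).

When E varies and its mass tends to one, replacing E by the whole space costs in mean
square at most the trace of the covariance times the mass of the complement, uniformly
in n, which gives the joint limits ([varying_clt]). For formal orthants with bounds
tending to infinity uniformly, the mass tends to one because they contain large balls
([pr_below_coord]).
*)

(** * Expectations of real random variables *)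

Notation intg P f := (P.-integrable [set: _] (EFin \o f)).

Section expectation.
Context d (T : measurableType d) (R : realType) (P : probability T R).
Implicit Types f g : T -> R.

Lemma intg_meas f : intg P f -> measurable_fun setT f.
Proof. by move=> /integrableP[/measurable_EFinP]. Qed.

Lemma intg_cst c : intg P (fun=> c : R).
Proof. exact: (finite_measure_integrable_cst P c). Qed.

Lemma intg_le f g : measurable_fun setT f -> intg P g ->
  (forall x, `|f x| <= g x) -> intg P f.
Proof.
move=> mf ig fg; apply: (le_integrable _ _ _ ig) => //.
  exact/measurable_EFinP.
move=> x _ /=; rewrite lee_fin; apply: le_trans (fg x) _; exact: ler_norm.
Qed.

Lemma intg_bnd f B : measurable_fun setT f -> (forall x, `|f x| <= B) ->
  intg P f.
Proof. by move=> mf fB; apply: intg_le (intg_cst B) _. Qed.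

Lemma intgD f g : intg P f -> intg P g -> intg P (fun x => f x + g x).
Proof. by move=> i1 i2; have := integrableD measurableT i1 i2. Qed.

Lemma intgZ c f : intg P f -> intg P (fun x => c * f x).
Proof. by move=> i1; have := integrableZl measurableT c i1. Qed.

Lemma intgN f : intg P f -> intg P (fun x => - f x).
Proof.
move=> i1; rewrite (_ : (fun x => - f x) = (fun x => -1 * f x)); first exact: intgZ.
by apply/funext => x; rewrite mulN1r.
Qed.

Lemma intgB f g : intg P f -> intg P g -> intg P (fun x => f x - g x).
Proof. by move=> i1 i2; apply: intgD => //; exact: intgN. Qed.

Lemma intg_sum (I : Type) (s : seq I) (f : I -> T -> R) :
  (forall i, intg P (f i)) -> intg P (fun x => \sum_(i <- s) f i x).
Proof.
move=> fi; elim: s => [|a s IH].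
  by under eq_fun do rewrite big_nil; exact: intg_cst.
by under eq_fun do rewrite big_cons; exact: intgD.
Qed.

Lemma intg_norm f : intg P f -> intg P (fun x => `|f x|).
Proof.
move=> fi; apply: intg_le (_ : intg P (fun x => `|f x|)) _ => //.
- by apply: measurableT_comp => //; exact: intg_meas fi.
- by have := integrable_norm fi.
- by move=> x; rewrite normr_id.
Qed.

Lemma intgM f g : measurable_fun setT f -> measurable_fun setT g ->
  intg P (fun x => f x ^+ 2) -> intg P (fun x => g x ^+ 2) ->
  intg P (fun x => f x * g x).
Proof.
move=> mf mg f2 g2; apply: intg_le (intgD f2 g2) _.
  exact: measurable_funM.
move=> x; rewrite ler_norml; apply/andP; split; nra.
Qed.

Lemma intg_sq1 f : measurable_fun setT f -> intg P (fun x => f x ^+ 2) ->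
  intg P f.
Proof.
move=> mf f2; apply: intg_le (intgD (intg_cst 1) f2) _ => // x.
rewrite ler_norml; apply/andP; split; nra.
Qed.

Lemma intg_bndl B f g : measurable_fun setT f -> (forall x, `|f x| <= B) ->
  intg P g -> intg P (fun x => f x * g x).
Proof.
move=> mf fB ig; apply: intg_le (intgZ B (intg_norm ig)) _.
  by apply: measurable_funM => //; exact: intg_meas ig.
by move=> x; rewrite normrM ler_wpM2r.
Qed.

Lemma EFin_Ex f : intg P f -> (\int[P]_x (f x)%:E)%E = (\int[P]_x f x)%:E.
Proof. by move=> fi; rewrite /Rintegral fineK//; exact: integrable_fin_num. Qed.

Lemma ExD f g : intg P f -> intg P g ->
  \int[P]_x (f x + g x) = \int[P]_x f x + \int[P]_x g x.
Proof. exact: RintegralD. Qed.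

Lemma ExB f g : intg P f -> intg P g ->
  \int[P]_x (f x - g x) = \int[P]_x f x - \int[P]_x g x.
Proof. exact: RintegralB. Qed.

Lemma ExZ c f : intg P f -> \int[P]_x (c * f x) = c * \int[P]_x f x.
Proof. exact: RintegralZl. Qed.

Lemma ExN f : intg P f -> \int[P]_x (- f x) = - \int[P]_x f x.
Proof.
by move=> fi; under eq_Rintegral do rewrite -mulN1r; rewrite ExZ// mulN1r.
Qed.

Lemma Ex_cst (c : R) : \int[P]_x c = c.
Proof.
rewrite Rintegral_cst//; transitivity (c * fine 1%E); last by rewrite /= mulr1.
by apply: (congr1 (fun z => c * fine z)); exact: probability_setT.
Qed.

Lemma Ex_sum (I : Type) (s : seq I) (f : I -> T -> R) :
  (forall i, intg P (f i)) ->
  \int[P]_x (\sum_(i <- s) f i x) = \sum_(i <- s) \int[P]_x f i x.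
Proof.
move=> fi; elim: s => [|a s IH].
  by rewrite big_nil; under eq_Rintegral do rewrite big_nil; rewrite Ex_cst.
rewrite big_cons -IH -ExD//; last exact: intg_sum.
by apply: eq_Rintegral => x _; rewrite big_cons.
Qed.

Lemma Ex_le f g : intg P f -> intg P g -> (forall x, f x <= g x) ->
  \int[P]_x f x <= \int[P]_x g x.
Proof. by move=> fi gi fg; apply: le_Rintegral. Qed.

Lemma Ex_norm f : intg P f -> `|\int[P]_x f x| <= \int[P]_x `|f x|.
Proof. exact: le_normr_Rintegral. Qed.

Lemma Ex_norm_le f g : intg P f -> intg P g -> (forall x, `|f x| <= g x) ->
  `|\int[P]_x f x| <= \int[P]_x g x.
Proof.
move=> fi gi fg; apply: le_trans (Ex_norm fi) _; apply: Ex_le => //.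
exact: intg_norm.
Qed.

Lemma Ex_dist_le f g h : intg P f -> intg P g -> intg P h ->
  (forall x, `|f x - g x| <= h x) ->
  `|\int[P]_x f x - \int[P]_x g x| <= \int[P]_x h x.
Proof.
by move=> fi gi hi fg; rewrite -ExB//; apply: Ex_norm_le => //; exact: intgB.
Qed.

Lemma Ex_ae_eq f g : measurable_fun setT f -> measurable_fun setT g ->
  {ae P, forall x, f x = g x} -> \int[P]_x f x = \int[P]_x g x.
Proof.
move=> mf mg fg; congr fine; apply: ae_eq_integral => //.
- exact/measurable_EFinP.
- exact/measurable_EFinP.
- by apply: filterS fg => x -> .
Qed.

Lemma intg_ae_eq f g : measurable_fun setT g ->
  {ae P, forall x, f x = g x} -> intg P f -> intg P g.
Proof.
move=> mg fg fi; apply/integrableP; split; first exact/measurable_EFinP.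
case/integrableP : fi => mf; apply: le_lt_trans; rewrite le_eqVlt; apply/orP; left.
apply/eqP; apply: ae_eq_integral => //.
- exact/measurableT_comp/measurable_EFinP.
- exact: measurableT_comp.
- by apply: filterS fg => x /= -> .
Qed.

Lemma Ex_dct (f_ : nat -> T -> R) f g : (forall n, measurable_fun setT (f_ n)) ->
  (forall x, f_ n x @[n --> \oo] --> f x) -> intg P g ->
  (forall n x, `|f_ n x| <= g x) ->
  \int[P]_x f_ n x @[n --> \oo] --> \int[P]_x f x.
Proof.
move=> mf ff gi fg.
have fin n : intg P (f_ n) by apply: intg_le (gi) _.
have mf' : measurable_fun setT f.
  by apply: (measurable_fun_cvg mf) => x _; exact: ff.
have fi : intg P f.
  apply: intg_le gi _ => // x.
  apply: (ler_cvg_to (cvg_norm (ff x)) (cvg_cst (g x))).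
  by apply: nearW => n; exact: fg.
rewrite /Rintegral; apply: fine_cvg; rewrite fineK; last exact: integrable_fin_num.
apply: (@dominated_cvg _ _ _ P setT _ (fun n x => (f_ n x)%:E) (EFin \o f) (EFin \o g)) => //.
- by move=> n; exact/measurable_EFinP.
- by move=> x _; apply: cvg_EFin; [exact: nearW|exact: ff].
- by move=> n x _; rewrite lee_fin.
Qed.

Lemma intg_law d' (T' : measurableType d') (X : {RV P >-> T'}) (f : T' -> R) :
  measurable_fun setT f -> intg P (f \o X) -> intg (distribution P X) f.
Proof.
move=> mf /integrableP[_ fi]; apply/integrableP; split; first exact/measurable_EFinP.
rewrite ge0_integral_distribution//.
exact/measurableT_comp/measurable_EFinP.
Qed.

Lemma Ex_law d' (T' : measurableType d') (X : {RV P >-> T'}) (f : T' -> R) :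
  measurable_fun setT f -> intg P (f \o X) ->
  \int[distribution P X]_y f y = \int[P]_x f (X x).
Proof.
move=> mf fi; rewrite /Rintegral integral_distribution//.
exact/measurable_EFinP.
Qed.

Lemma Ex_indic (A : set T) : measurable A -> \int[P]_x \1_A x = fine (P A).
Proof. by move=> mA; rewrite /Rintegral integral_indic// setIT. Qed.

Lemma measurable_cosf f : measurable_fun setT f -> measurable_fun setT (fun x => cos (f x)).
Proof.
by apply: measurableT_comp; apply: continuous_measurable_fun; exact: continuous_cos.
Qed.

Lemma intg_cos f : measurable_fun setT f -> intg P (fun x => cos (f x)).
Proof.
move=> mf; apply: (@intg_bnd _ 1); first exact: measurable_cosf.
by move=> x; rewrite ler_norml cos_geN1 cos_le1.
Qed.

Lemma intg_indic (A : set T) : measurable A -> intg P (\1_A : T -> R).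
Proof.
move=> mA; apply: (@intg_bnd _ 1); first exact: measurable_indic.
by move=> x; rewrite indicE; case: (_ \in _); rewrite ?normr1 ?normr0.
Qed.

End expectation.

Section independence.
Context d (T : measurableType d) (R : realType) (P : probability T R).

(** Under independence the joint law is the product of the marginal laws, so Fubini
both proves integrability of the product and splits its integral. *)
Lemma Ex_indep (X Y : T -> R) : measurable_fun setT X -> measurable_fun setT Y ->
  (forall A B, measurable A -> measurable B ->
    P (X @^-1` A `&` Y @^-1` B) = (P (X @^-1` A) * P (Y @^-1` B))%E) ->
  intg P X -> intg P Y ->
  intg P (fun w => X w * Y w) /\
  \int[P]_w (X w * Y w) = \int[P]_w X w * \int[P]_w Y w.
Proof.
move=> mX mY XY iX iY.
pose rX : {mfun T >-> R} := mfun_Sub (mem_set mX).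
pose rY : {mfun T >-> R} := mfun_Sub (mem_set mY).
pose muX := distribution P rX; pose muY := distribution P rY.
have mXY : measurable_fun setT (fun w => (X w, Y w)) by exact: measurable_fun_pair.
pose rXY : {mfun T >-> (R * R)%type} := mfun_Sub (mem_set mXY).
have jl A : measurable A -> (muX \x muY)%E A = distribution P rXY A.
  by move=> mA; apply: product_measure_unique mA => A' B' mA' mB'; exact: XY.
have mmul : measurable_fun setT (fun z : R * R => z.1 * z.2).
  by apply: measurable_funM.
have iX' : intg muX (fun x : R => x) by apply: (intg_law (X := rX)).
have iY' : intg muY (fun x : R => x) by apply: (intg_law (X := rY)).
have ipr : (muX \x muY)%E.-integrable setT (fun z : R * R => (z.1 * z.2)%:E).
  apply/integrable12ltyP; first exact/measurable_EFinP.
  have -> : (\int[muX]_x \int[muY]_y `|(x * y)%:E|)%E =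
     (\int[muX]_x (`|x| * \int[muY]_y `|y|)%:E)%E.
    apply: eq_integral => x _.
    rewrite EFinM -(EFin_Ex (intg_norm iY')) -ge0_integralZl//.
    - by apply: eq_integral => y _; rewrite /= normrM EFinM.
    - by apply/measurable_EFinP; exact: normr_measurable.
  rewrite EFin_Ex ?ltry//.
  rewrite (_ : (fun x => _) = (fun x => \int[muY]_y `|y| * `|x|)).
    exact/intgZ/intg_norm.
  by apply/funext => x; rewrite mulrC.
have key : \int[distribution P rXY]_z (z.1 * z.2) = \int[muX]_x x * \int[muY]_y y.
  rewrite {1}/Rintegral.
  rewrite (eq_measure_integral (muX \x muY)%E); last by move=> A mA _; exact/esym/jl.
  rewrite -integral12_prod_meas1//.
  have -> : (\int[muX]_x fubini_F muY (fun z : R * R => (z.1 * z.2)%:E) x)%E =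
     (\int[muX]_x (x * \int[muY]_y y)%:E)%E.
    apply: eq_integral => x _; rewrite /fubini_F/=.
    by rewrite (EFin_Ex (intgZ x iY')) ExZ.
  by rewrite EFin_Ex ?RintegralZr// (_ : (fun x => _) = (fun x => \int[muY]_y y * x));
    [exact: intgZ|apply/funext => x; rewrite mulrC].
have iXY : intg P (fun w => X w * Y w).
  apply/integrableP; split; first exact/measurable_EFinP/measurable_funM.
  have /integrableP[_] := ipr.
  rewrite (eq_measure_integral (distribution P rXY)); last by move=> A mA _; exact: jl.
  rewrite ge0_integral_distribution//.
  by apply: measurableT_comp => //; exact/measurable_EFinP.
split=> //; move: key; rewrite (Ex_law (X := rXY))//.
by rewrite (Ex_law (X := rX))// (Ex_law (X := rY)).
Qed.
End independence.

(** * Taylor bounds and trigonometric approximation *)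

Section trig_bounds.
Context (R : realType).
Implicit Types x : R.

(** The Taylor bounds below follow one from another by integration, starting from
[cos x <= 1]: each derivative is the function bounded one step before. *)
Lemma ge0_of_is_derive (f df : R -> R) : (forall x, is_derive x 1 f (df x)) ->
  f 0 = 0 -> (forall x, 0 <= x -> 0 <= df x) -> forall x, 0 <= x -> 0 <= f x.
Proof.
move=> fdf f0 df0 x; rewrite le_eqVlt => /predU1P[<-|x0]; first by rewrite f0.
have cf : {within `[0, x], continuous f}.
  apply: continuous_subspaceT => y.
  by apply/differentiable_continuous/derivable1_diffP; have [] := fdf y.
have [c] := MVT x0 (fun y _ => fdf y) cf.
rewrite in_itv/= => /andP[c0 _]; rewrite f0 !subr0 => ->.
by rewrite mulr_ge0 ?df0 ?ltW.
Qed.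

Lemma sin_le x : 0 <= x -> sin x <= x.
Proof.
move=> x0; rewrite -subr_ge0; move: x x0.
have D x : is_derive x 1 (fun x : R => x - sin x) (1 - cos x).
  by apply: is_derive_eq.
apply: (ge0_of_is_derive D).
- by rewrite sin0 subrr.
- by move=> x _; rewrite subr_ge0 cos_le1.
Qed.

Lemma cos_ge2 x : 0 <= x -> 0 <= cos x - 1 + x ^+ 2 / 2.
Proof.
move: x.
have D x : is_derive x 1 (fun x : R => cos x - 1 + x ^+ 2 / 2) (x - sin x).
  by apply: is_derive_eq; rewrite /GRing.scale/=; field.
apply: (ge0_of_is_derive D).
- by rewrite cos0 expr0n mul0r addr0 subrr.
- by move=> x x0; rewrite subr_ge0 sin_le.
Qed.

Lemma sin_ge3 x : 0 <= x -> 0 <= sin x - x + x ^+ 3 / 6.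
Proof.
move: x.
have D x : is_derive x 1 (fun x : R => sin x - x + x ^+ 3 / 6) (cos x - 1 + x ^+ 2 / 2).
  by apply: is_derive_eq; rewrite /GRing.scale/=; field.
apply: (ge0_of_is_derive D).
- by rewrite sin0 expr0n mul0r addr0 subrr.
- by move=> x x0; rewrite cos_ge2.
Qed.

Lemma cos_le4 x : 0 <= x -> 0 <= x ^+ 4 / 24 - (cos x - 1 + x ^+ 2 / 2).
Proof.
move: x.
have D x : is_derive x 1 (fun x : R => x ^+ 4 / 24 - (cos x - 1 + x ^+ 2 / 2)) (sin x - x + x ^+ 3 / 6).
  by apply: is_derive_eq; rewrite /GRing.scale/=; field.
apply: (ge0_of_is_derive D).
- by rewrite cos0 !expr0n !mul0r addr0 !subrr.
- by move=> x x0; rewrite sin_ge3.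
Qed.

Lemma sin_taylor3 x : `|sin x - x| <= `|x| ^+ 3 / 6.
Proof.
wlog x0 : x / 0 <= x => [H|].
  have [/H//|x0] := leP 0 x.
  by have := H (- x); rewrite sinN -opprD !normrN; apply; rewrite oppr_ge0 ltW.
have := sin_le x0; have := sin_ge3 x0.
by rewrite (ger0_norm x0) ler_norml => *; apply/andP; split; lra.
Qed.

Lemma cos_taylor4 x : `|cos x - 1 + x ^+ 2 / 2| <= x ^+ 4 / 24.
Proof.
wlog x0 : x / 0 <= x => [H|].
  have [/H//|x0] := leP 0 x.
  have := H (- x); rewrite cosN sqrrN (_ : (- x) ^+ 4 = x ^+ 4); last by ring.
  by apply; rewrite oppr_ge0 ltW.
have := cos_ge2 x0; have := cos_le4 x0.
by rewrite ler_norml => *; apply/andP; split; lra.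
Qed.

(** A bound valid on the whole line and quadratic, so that the error of replacing [x]
by its sine is controlled by a second moment. *)
Lemma dist_sin_le x : `|sin x - x| <= x ^+ 2.
Proof.
rewrite -(real_normK (num_real x)).
have [x6|x6] := leP `|x| 6.
  by apply: le_trans (sin_taylor3 x) _; have := normr_ge0 x; nra.
apply: le_trans (ler_normB _ _) _.
have /ler_normlP[? ?] : `|sin x| <= 1 by rewrite sin_max.
have : `|sin x| <= 1 by rewrite sin_max.
by nra.
Qed.

End trig_bounds.

Section trig_functions.
Context (R : realType) (X : Type) (V : lmodType R) (b : X -> V -> R).
Hypothesis bD : forall x u v, b x (u + v) = b x u + b x v.
Hypothesis bZ : forall x c u, b x (c *: u) = c * b x u.

(** Products of cosines are sums of cosines, so these functions form an algebra, and
their means are determined by the characteristic function. *)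
Inductive trig : (X -> R) -> Prop :=
| trig_cos u a : trig (fun x => cos (b x u + a))
| trig_lin c f g : trig f -> trig g -> trig (fun x => c * f x + g x).

Let b0 x : b x 0 = 0.
Proof. by rewrite -(scale0r 0) bZ mul0r. Qed.

Let bN x u : b x (- u) = - b x u.
Proof. by rewrite -scaleN1r bZ mulN1r. Qed.

Lemma trig_eq f g : f =1 g -> trig f -> trig g.
Proof. by move=> /funext ->. Qed.

Lemma trig_cst c : trig (fun=> c).
Proof.
apply: trig_eq (trig_lin (c - 1) (trig_cos 0 0) (trig_cos 0 0)) => x.
by rewrite b0 addr0 cos0; ring.
Qed.

Lemma trig_add f g : trig f -> trig g -> trig (fun x => f x + g x).
Proof. by move=> tf tg; apply: trig_eq (trig_lin 1 tf tg) => x; rewrite mul1r. Qed.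

Lemma trig_scale c f : trig f -> trig (fun x => c * f x).
Proof.
by move=> tf; apply: trig_eq (trig_lin c tf (trig_cst 0)) => x; rewrite addr0.
Qed.

Lemma trig_mul f g : trig f -> trig g -> trig (fun x => f x * g x).
Proof.
move=> + tg; elim=> [u a|c f1 f2 _ t1 _ t2]; last first.
  by apply: trig_eq (trig_lin c t1 t2) => x; ring.
elim: tg => [v a'|c f1 f2 _ t1 _ t2]; last first.
  by apply: trig_eq (trig_lin c t1 t2) => x; ring.
apply: trig_eq (trig_scale 2^-1 (trig_add (trig_cos (u + v) (a + a'))
                                        (trig_cos (u - v) (a - a')))) => x.
rewrite !bD bN.
have -> : b x u + b x v + (a + a') = (b x u + a) + (b x v + a') by ring.
have -> : b x u - b x v + (a - a') = (b x u + a) - (b x v + a') by ring.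
by rewrite cosB cosD; field.
Qed.

Lemma trig_sin u : trig (fun x => sin (b x u)).
Proof. by apply: trig_eq (trig_cos u (- (pi / 2))) => x; rewrite cosBpihalf. Qed.

(** The Bernstein operator as the expectation of [g] at a sum of [m]
independent Bernoulli variables, computed by conditioning on the first one. *)
Fixpoint bern (m : nat) (g : nat -> R) (s : R) : R :=
  if m is m'.+1 then s * bern m' (g \o succn) s + (1 - s) * bern m' g s
  else g 0.

Lemma trig_bern m (g : nat -> X -> R) (s : X -> R) :
  (forall k, trig (g k)) -> trig s -> trig (fun x => bern m (g ^~ x) (s x)).
Proof.
move=> + ts; elim: m g => [g tg|m IH g tg]/=; first exact: (tg 0).
apply: trig_add; apply: trig_mul => //.
- exact: (IH (fun k => g k.+1)).
- by apply: trig_add (trig_cst 1) _; apply: trig_eq (trig_scale (-1) ts) => x; ring.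
- exact: IH.
Qed.

End trig_functions.

Section bernstein.
Context (R : realType).
Implicit Types (g h : nat -> R) (s : R).

Lemma bernZD m c g h s :
  bern m (fun k => c * g k + h k) s = c * bern m g s + bern m h s.
Proof.
elim: m g h => [//|m IH] g h /=.
by rewrite (IH (g \o succn) (h \o succn)) IH; ring.
Qed.

Lemma bern_cst m c s : bern m (fun=> c) s = c.
Proof. by elim: m => [//|m IH] /=; rewrite [X in s * X]IH IH; ring. Qed.

Lemma bern_le m g h s : 0 <= s <= 1 -> (forall k, g k <= h k) ->
  bern m g s <= bern m h s.
Proof.
move=> /andP[s0 s1]; elim: m g h => [//|m IH] g h gh /=; first exact: gh.
apply: lerD; apply: ler_wpM2l; rewrite ?subr_ge0//; last exact: IH.
by apply: IH => k; exact: gh.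
Qed.

(** The second moment of the number of successes about an arbitrary centre; the
induction moves the centre. *)
Lemma bern_var m c s :
  bern m (fun k => (k%:R - c) ^+ 2) s = m%:R * (s * (1 - s)) + (m%:R * s - c) ^+ 2.
Proof.
elim: m c => [c|m IH c]; first by rewrite /= mul0r mul0r !add0r.
rewrite /= IH.
rewrite (_ : _ \o _ = fun k : nat => (k%:R - (c - 1)) ^+ 2); last first.
  by apply/funext => k /=; rewrite -natr1; ring.
by rewrite IH -natr1; ring.
Qed.

Lemma bern_dist m g h s e : 0 <= s <= 1 -> (forall k, `|g k - h k| <= e k) ->
  `|bern m g s - bern m h s| <= bern m e s.
Proof.
move=> s01 gh.
have ge k := gh k; move: gh => _.
have H1 : bern m (fun k => 1 * g k + - h k) s <= bern m e s.
  by apply: bern_le => // k; have := ge k; rewrite ler_norml mul1r => /andP[].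
have H2 : bern m (fun k => 1 * h k + - g k) s <= bern m e s.
  by apply: bern_le => // k; have := ge k; rewrite ler_norml mul1r => /andP[]; lra.
have N f : bern m (fun k => - f k) s = - bern m f s.
  have := bernZD m (-1) f (fun=> 0) s; rewrite bern_cst => e1.
  by rewrite (_ : (fun k => - f k) = (fun k => -1 * f k + 0)) ?e1;
     [ring|apply/funext => k; ring].
move: H1 H2; rewrite !bernZD !N !mul1r ler_norml => ? ?.
by apply/andP; split; lra.
Qed.

(** Chebyshev's form of the Bernstein estimate: [|z| <= z ^+ 2 / del + del] replaces
the first absolute moment by the variance, of order [1 / m]. *)
Lemma bern_lip m (L : R) (h : R -> R) s (del : R) : (0 < m)%N -> 0 <= s <= 1 -> 0 < del -> 0 <= L ->
  (forall y z, `|h y - h z| <= L * `|y - z|) ->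
  `|bern m (fun k => h (k%:R / m%:R)) s - h s| <= L * (del + (m%:R * del)^-1).
Proof.
move=> m0 s01 del0 L0 hL.
have m0' : 0 < m%:R :> R by rewrite ltr0n.
rewrite -[X in _ - X](bern_cst m (h s) s).
apply: le_trans (_ : _ <= bern m (fun k => (L / (m%:R ^+ 2 * del)) * (k%:R - m%:R * s) ^+ 2 + L * del) s) _.
  apply: bern_dist => // k; apply: le_trans (hL _ _) _.
  have -> : L / (m%:R ^+ 2 * del) * (k%:R - m%:R * s) ^+ 2 + L * del =
     L * ((k%:R / m%:R - s) ^+ 2 / del + del).
    by field; rewrite !gt_eqF.
  apply: ler_wpM2l => //; set z := k%:R / m%:R - s.
  have -> : z ^+ 2 / del + del = (z ^+ 2 + del ^+ 2) / del by field; rewrite gt_eqF.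
  by rewrite ler_pdivlMr// -[z ^+ 2]real_normK ?num_real//; have := normr_ge0 z; nra.
rewrite bernZD bern_var bern_cst subrr expr0n addr0.
have -> : L / (m%:R ^+ 2 * del) * (m%:R * (s * (1 - s))) + L * del =
   L * (del + (s * (1 - s)) * (m%:R * del)^-1).
  by field; rewrite !gt_eqF.
apply: ler_wpM2l => //; rewrite lerD2l.
rewrite -[leRHS]mul1r; apply: ler_wpM2r; last by case/andP: s01 => *; nra.
by rewrite invr_ge0 mulr_ge0 ?ltW.
Qed.

End bernstein.

Section trig_approximation.
Context (R : realType) (X : Type) (V : lmodType R) (b : X -> V -> R).
Hypothesis bD : forall x u v, b x (u + v) = b x u + b x v.
Hypothesis bZ : forall x c u, b x (c *: u) = c * b x u.
Local Notation trig := (trig b).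

(** One coordinate is eliminated at a time: the last one is approximated by a
Bernstein operator in [(1 + sin) / 2], whose coefficients are functions of the
remaining coordinates. *)
Lemma trig_approx_sin (e : nat -> V) N (g : (nat -> R) -> R) (L : R) : 0 <= L ->
  (forall t t', `|g t - g t'| <= L * \sum_(j < N) `|t j - t' j|) ->
  forall del : R, 0 < del ->
  exists2 p, trig p & forall x, `|g (fun j => sin (b x (e j))) - p x| <= del.
Proof.
move=> L0; elim: N g => [|N IH] g gL del del0.
  exists (fun=> g (fun=> 0)); first exact: trig_cst.
  by move=> x; apply: le_trans (gL _ _) _; rewrite big_ord0 mulr0 ltW.
(* 2 * s - 1 ranges over [-1, 1] when s ranges over [0, 1]. *)
pose G (s : R) (t : nat -> R) := g (fun j => if j == N then 2 * s - 1 else t j).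
have GL s t t' : `|G s t - G s t'| <= L * \sum_(j < N) `|t j - t' j|.
  apply: le_trans (gL _ _) _; apply: ler_wpM2l => //.
  rewrite big_ord_recr/= eqxx subrr normr0 addr0.
  by apply: ler_sum => j _; rewrite ltn_eqF.
have del2 : 0 < del / 2 by rewrite divr_gt0.
pose eta : R := del / (8 * (L + 1)).
have eta0 : 0 < eta by rewrite divr_gt0// mulr_gt0// ltr_wpDl.
pose m := (Num.truncn (eta ^+ 2)^-1).+1.
have m0 : 0 < m%:R :> R by rewrite ltr0n.
have metal : (m%:R * eta)^-1 <= eta.
  have : (eta ^+ 2)^-1 < m%:R by exact: truncnS_gt.
  rewrite -[ltLHS]mul1r ltr_pdivrMr ?exprn_gt0// => h.
  rewrite -[leLHS]mul1r ler_pdivrMr ?(mulr_gt0 m0 eta0)//.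
  by rewrite (_ : eta * (m%:R * eta) = m%:R * eta ^+ 2) ?ltW//; ring.
have /choice[p pP] : forall k : nat, exists p, trig p /\
    forall x, `|G (k%:R / m%:R) (fun j => sin (b x (e j))) - p x| <= del / 2.
  by move=> k; have [p] := IH (G (k%:R / m%:R)) (GL _) _ del2; exists p.
pose s x := (1 + sin (b x (e N))) / 2.
have s01 x : 0 <= s x <= 1.
  have := sin_max (b x (e N)); rewrite ler_norml => /andP[? ?].
  by rewrite /s; apply/andP; split; lra.
exists (fun x => bern m (p ^~ x) (s x)).
  apply: trig_bern => //; first by move=> k; have [] := pP k.
  apply: trig_eq (trig_scale bZ 2^-1 (trig_add (trig_cst bZ 1) (trig_sin b (e N)))).
  by move=> x; rewrite /s mulrC.
move=> x; set t := fun j => sin (b x (e j)).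
have gG : g t = G (s x) t.
  by congr g; apply/funext => j; rewrite /t /s; case: eqP => [->|//]; lra.
rewrite gG distrC.
have H1 : `|bern m (fun k => G (k%:R / m%:R) t) (s x) - G (s x) t| <= 2 * L * (eta + (m%:R * eta)^-1).
  apply: (@bern_lip _ m (2 * L) (G ^~ t)) => //; first by rewrite mulr_ge0.
  move=> y z; apply: le_trans (gL _ _) _.
  rewrite big_ord_recr/= eqxx big1 ?add0r; last first.
    by move=> j _; rewrite ltn_eqF// subrr normr0.
  have -> : 2 * y - 1 - (2 * z - 1) = 2 * (y - z) by ring.
  by rewrite normrM ger0_norm// mulrCA mulrA.
have H2 : `|bern m (p ^~ x) (s x) - bern m (fun k => G (k%:R / m%:R) t) (s x)| <= del / 2.
  apply: le_trans (bern_dist (e := fun=> del / 2) _ (s01 x) _) _; last by rewrite bern_cst.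
  by move=> k; rewrite distrC; have [_] := pP k; apply.
have H3 : 2 * L * (eta + (m%:R * eta)^-1) <= del / 2.
  apply: (@le_trans _ _ (2 * L * (2 * eta))); first by apply: ler_wpM2l; lra.
  have -> : 2 * L * (2 * eta) = del / 2 * (L / (L + 1)).
    by rewrite /eta; field; rewrite gt_eqF//; lra.
  by rewrite ger_pMr// ler_pdivrMr; lra.
rewrite -(subrKA (bern m (fun k => G (k%:R / m%:R) t) (s x))).
apply: le_trans (ler_normD _ _) _.
lra.
Qed.

(** Replacing [t] by [lam * sin (t / lam)] changes it by at most [t ^+ 2 / lam]
and makes it a trigonometric function with values in a bounded interval, on
which polynomials approximate uniformly. *)
Lemma trig_approx (e : nat -> V) N (g : (nat -> R) -> R) (L : R) : 0 <= L ->
  (forall t t', `|g t - g t'| <= L * \sum_(j < N) `|t j - t' j|) ->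
  forall del : R, 0 < del ->
  exists2 p, trig p & forall x,
   `|g (fun j => b x (e j)) - p x| <= del * (1 + \sum_(j < N) b x (e j) ^+ 2).
Proof.
move=> L0 gL del del0.
(* The clipping error is L * y ^+ 2 / lam, at most del * y ^+ 2. *)
pose lam : R := L / del + 1.
have lam0 : 0 < lam by rewrite ltr_wpDl// divr_ge0// ltW.
have gL' t t' : `|g (fun j => lam * t j) - g (fun j => lam * t' j)| <=
    (L * lam) * \sum_(j < N) `|t j - t' j|.
  apply: le_trans (gL _ _) _; rewrite -mulrA; apply: ler_wpM2l => //.
  rewrite mulr_sumr; apply: ler_sum => j _.
  by rewrite -mulrBr normrM gtr0_norm.
have [p tp pg] := trig_approx_sin (fun j => lam^-1 *: e j)
  (mulr_ge0 L0 (ltW lam0)) gL' del0.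
exists p => // x.
have H1 := pg x; set q := g _ in H1.
have H2 : `|g (fun j => b x (e j)) - q| <= del * \sum_(j < N) b x (e j) ^+ 2.
  apply: le_trans (gL _ _) _; rewrite !mulr_sumr; apply: ler_sum => j _.
  rewrite bZ; set y := b x (e j).
  have -> : `|y - lam * sin (lam^-1 * y)| = lam * `|sin (lam^-1 * y) - lam^-1 * y|.
    rewrite distrC; transitivity (`|lam * (sin (lam^-1 * y) - lam^-1 * y)|).
      by congr (Num.norm _); field; rewrite gt_eqF.
    by rewrite normrM gtr0_norm.
  apply: (@le_trans _ _ (L * (lam * (lam^-1 * y) ^+ 2))).
    by do 2 (apply: ler_wpM2l; first lra); exact: dist_sin_le.
  have -> : L * (lam * (lam^-1 * y) ^+ 2) = (L / lam) * y ^+ 2.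
    by field; rewrite gt_eqF.
  apply: ler_wpM2r; first exact: sqr_ge0.
  rewrite ler_pdivrMr// /lam mulrDr mulrCA divff ?gt_eqF//; lra.
rewrite mulrDr mulr1 -(subrKA q).
by apply: le_trans (ler_normD _ _) _; lra.
Qed.

End trig_approximation.

(** * Hilbert space geometry *)

Section hilbert.
Context (R : realType) (H : completeNormedModType R) (ip : {dot H for idfun}).
Hypothesis hip : inner_product ip.
Implicit Types u v w : H.

Lemma ipC u v : ip u v = ip v u.
Proof. by have := @hermC _ _ _ _ ip u v; rewrite /= expr0 mul1r. Qed.

Lemma ipDl u v w : ip (u + v) w = ip u w + ip v w.
Proof. exact: linearDl. Qed.

Lemma ipZl c u w : ip (c *: u) w = c * ip u w.
Proof. exact: linearZl_LR. Qed.

Lemma ipDr u v w : ip w (u + v) = ip w u + ip w v.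
Proof. by rewrite ipC ipDl !(ipC w). Qed.

Lemma ipZr c u w : ip w (c *: u) = c * ip w u.
Proof. by rewrite ipC ipZl (ipC w). Qed.

Lemma ip0l w : ip 0 w = 0.
Proof. by rewrite -(scale0r 0) ipZl mul0r. Qed.

Lemma ipNl u w : ip (- u) w = - ip u w.
Proof. by rewrite -scaleN1r ipZl mulN1r. Qed.

Lemma ipBl u v w : ip (u - v) w = ip u w - ip v w.
Proof. by rewrite ipDl ipNl. Qed.

Lemma ipBr u v w : ip w (u - v) = ip w u - ip w v.
Proof. by rewrite ipC ipBl !(ipC w). Qed.

Lemma ip_suml (I : Type) (s : seq I) (f : I -> H) w :
  ip (\sum_(i <- s) f i) w = \sum_(i <- s) ip (f i) w.
Proof. by elim: s => [|a s IH]; rewrite ?big_nil ?ip0l// !big_cons ipDl IH. Qed.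

Lemma ip_sumr (I : Type) (s : seq I) (f : I -> H) w :
  ip w (\sum_(i <- s) f i) = \sum_(i <- s) ip w (f i).
Proof. by rewrite ipC ip_suml; apply: eq_bigr => i _; rewrite ipC. Qed.

(** Cauchy-Schwarz, from the square of the component of [u] orthogonal to [v]. *)
Lemma ip_norm u v : `|ip u v| <= `|u| * `|v|.
Proof.
have [->|v0] := eqVneq v 0; first by rewrite ipC ip0l !normr0 mulr0.
have nv : 0 < `|v| by rewrite normr_gt0.
pose c := ip u v / `|v| ^+ 2.
have := sqr_ge0 `|u - c *: v|; rewrite -hip.
rewrite ipBl !ipBr !ipZl !ipZr (ipC v u) !hip => h.
have e : c * `|v| ^+ 2 = ip u v by rewrite divfK// expf_neq0// gt_eqF.
rewrite -(@ler_pXn2r _ 2)// ?nnegrE ?mulr_ge0// real_normK ?num_real// exprMn.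
rewrite e subrr subr0 subr_ge0 in h.
have := ler_wpM2r (sqr_ge0 `|v|) h.
by rewrite mulrAC e -expr2.
Qed.

Lemma ip_continuous v : continuous (ip ^~ v).
Proof.
move=> u; apply/cvgrPdist_le => e e0.
have d0 : 0 < e / (`|v| + 1) by rewrite divr_gt0// ltr_wpDl.
near=> w; rewrite -ipBl; apply: le_trans (ip_norm _ _) _.
apply: (@le_trans _ _ (e / (`|v| + 1) * `|v|)).
  by apply: ler_wpM2r => //; near: w; exact: cvgr_dist_le.
by rewrite mulrAC ler_pdivrMr ?ltr_wpDl// ler_pM2l// lerDl.
Unshelve. all: by end_near. Qed.

Section basis.
Variable phi : nat -> H.
Hypothesis hphi : orthonormal_basis ip phi.

Let phi_ortho i j : ip (phi i) (phi j) = (i == j)%:R. Proof. exact: hphi.1. Qed.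

Lemma phi_norm i : `|phi i| = 1.
Proof.
have := phi_ortho i i; rewrite eqxx hip => /eqP.
by rewrite sqrf_eq1 => /orP[/eqP//|/eqP h]; have := normr_ge0 (phi i); rewrite h; lra.
Qed.

Lemma ip_phi_le u i : `|ip u (phi i)| <= `|u|.
Proof. by have := ip_norm u (phi i); rewrite phi_norm mulr1. Qed.

Definition bproj n u : H := \sum_(0 <= j < n) ip u (phi j) *: phi j.

Lemma bproj_cvg u : bproj n u @[n --> \oo] --> u.
Proof. exact: hphi.2. Qed.

Lemma ip_phi_sum (c : nat -> R) m n k :
  ip (\sum_(m <= j < n) c j *: phi j) (phi k) = if (m <= k < n)%N then c k else 0.
Proof.
rewrite ip_suml; under eq_bigr do rewrite ipZl phi_ortho.
case: ifP => [mkn|/negP mkn].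
  rewrite (bigD1_seq k) ?mem_index_iota ?iota_uniq//= eqxx mulr1 big1 ?addr0//.
  by move=> j /negbTE ->; rewrite mulr0.
rewrite big_seq big1// => j; rewrite mem_index_iota => mj.
by case: eqP => [jk|]; [case: mkn; rewrite -jk|rewrite mulr0].
Qed.

Lemma norm_phi_sum (c : nat -> R) m n :
  `|\sum_(m <= j < n) c j *: phi j| ^+ 2 = \sum_(m <= j < n) c j ^+ 2.
Proof.
rewrite -hip ip_sumr big_seq [RHS]big_seq; apply: eq_bigr => k.
by rewrite mem_index_iota => mk; rewrite ipZr ip_phi_sum mk expr2.
Qed.

Lemma ip_bproj n u k : ip (bproj n u) (phi k) = if (k < n)%N then ip u (phi k) else 0.
Proof. by rewrite /bproj ip_phi_sum. Qed.

Lemma norm_sub_bproj n u : `|u - bproj n u| ^+ 2 =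
  `|u| ^+ 2 - \sum_(0 <= j < n) ip u (phi j) ^+ 2.
Proof.
rewrite -!hip ipBl !ipBr (ipC u (bproj n u)).
have -> : ip (bproj n u) (bproj n u) = \sum_(0 <= j < n) ip u (phi j) ^+ 2.
  by rewrite hip norm_phi_sum.
have -> : ip (bproj n u) u = \sum_(0 <= j < n) ip u (phi j) ^+ 2.
  by rewrite ip_suml; apply: eq_bigr => j _; rewrite ipZl ipC expr2.
by ring.
Qed.

Lemma bessel n u : \sum_(0 <= j < n) ip u (phi j) ^+ 2 <= `|u| ^+ 2.
Proof. by rewrite -subr_ge0 -norm_sub_bproj sqr_ge0. Qed.

Lemma parseval u : series (fun j => ip u (phi j) ^+ 2) @ \oo --> `|u| ^+ 2.
Proof.
have h : `|u - bproj n u| ^+ 2 @[n --> \oo] --> `|u - u| ^+ 2.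
  have cn : `|u - bproj n u| @[n --> \oo] --> `|u - u|.
    by apply: cvg_norm; apply: cvgB; [exact: cvg_cst|exact: bproj_cvg].
  exact: (cvgM cn cn).
rewrite subrr normr0 expr0n/= in h.
rewrite (_ : series _ = fun n => `|u| ^+ 2 - `|u - bproj n u| ^+ 2); last first.
  by apply/funext => n; rewrite norm_sub_bproj /series/=; ring.
by rewrite -[X in _ --> X]subr0; apply: cvgB => //; exact: cvg_cst.
Qed.

(** By Pythagoras, square summability of the coefficients is the Cauchy criterion for
the vector series. *)
Lemma riesz_fischer (c : nat -> R) M :
  (forall n, \sum_(0 <= j < n) c j ^+ 2 <= M) ->
  exists2 m, series (fun j => c j *: phi j) @ \oo --> m &
             forall j, ip m (phi j) = c j.
Proof.
move=> cM.
have cvc : cvgn (series (fun j => c j ^+ 2)).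
  apply: nondecreasing_is_cvgn.
    by apply: nondecreasing_series => i _ _; exact: sqr_ge0.
  by exists M => _ [n _ <-]; exact: cM.
have cvm : cvgn (series (fun j => c j *: phi j)).
  apply/cauchy_cvgP/cauchy_seriesP => e e0.
  have e2 : 0 < e ^+ 2 by rewrite exprn_gt0.
  have /cauchy_cvgP/cauchy_seriesP/(_ _ e2) := cvc.
  apply: filterS => -[m n] /=; rewrite -norm_phi_sum.
  rewrite ger0_norm ?sqr_ge0// ltr_pXn2r// ?nnegrE//.
  exact: ltW.
exists (limn (series (fun j => c j *: phi j))) => // j.
have h := cvg_comp _ _ cvm (@ip_continuous (phi j) _).
apply: (cvg_unique (@norm_hausdorff _ _) h); apply: cvg_near_cst.
near=> n; rewrite /= /series/= ip_phi_sum leq0n/= ifT//.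
by near: n; exact: nbhs_infty_gt.
Unshelve. all: by end_near. Qed.

(** Applied to the partial sum of [l (phi j) *: phi j], the bound on [l] shows that
the coefficients [l (phi j)] are square summable. *)
Lemma riesz_representation (l : H -> R) M : 0 <= M ->
  (forall c u v, l (c *: u + v) = c * l u + l v) ->
  (forall u, `|l u| <= M * `|u|) -> exists m, forall u, ip m u = l u.
Proof.
move=> M0 lin lM.
have l0 : l 0 = 0 by have := lM 0; rewrite normr0 mulr0 normr_le0 => /eqP.
have lsum n (c : nat -> R) : l (\sum_(0 <= j < n) c j *: phi j) =
    \sum_(0 <= j < n) c j * l (phi j).
  elim: n => [|n IH]; first by rewrite !big_geq.
  by rewrite !big_nat_recr//= addrC lin IH addrC.
have [n|m _ mphi] := @riesz_fischer (l \o phi) (M ^+ 2).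
  set S := \sum_(0 <= j < n) _.
  have S0 : 0 <= S by apply: sumr_ge0 => j _; exact: sqr_ge0.
  have SE : l (\sum_(0 <= j < n) l (phi j) *: phi j) = S.
    by rewrite lsum; apply: eq_bigr => j _; rewrite /= expr2.
  have NE : `|\sum_(0 <= j < n) l (phi j) *: phi j| ^+ 2 = S by exact: norm_phi_sum.
  have := lM (\sum_(0 <= j < n) l (phi j) *: phi j); rewrite SE ger0_norm// -NE.
  by have := normr_ge0 (\sum_(0 <= j < n) l (phi j) *: phi j); set N := `| _ |; nra.
exists m => u.
have cl : l (bproj n u) @[n --> \oo] --> l u.
  apply/subr_cvg0; apply: (@squeeze_cvgr _ _ _ _ (fun n => - (M * `|bproj n u - u|))
     (fun n => M * `|bproj n u - u|)).
  - apply: nearW => n; rewrite -ler_norml.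
    have -> : l (bproj n u) - l u = l (bproj n u - u).
      rewrite (_ : bproj n u - u = (-1) *: u + bproj n u).
        by rewrite lin; ring.
      by rewrite scaleN1r addrC.
    exact: lM.
  - rewrite -oppr0; apply: cvgN; rewrite -(mulr0 M) -(normr0 H) -(subrr u).
    by apply: cvgMl_tmp; apply: cvg_norm; apply: cvgB; [exact: bproj_cvg|exact: cvg_cst].
  - rewrite -(mulr0 M) -(normr0 H) -(subrr u).
    by apply: cvgMl_tmp; apply: cvg_norm; apply: cvgB; [exact: bproj_cvg|exact: cvg_cst].
apply: (cvg_unique (@norm_hausdorff _ _) _ cl).
rewrite ipC (_ : (fun n => l (bproj n u)) = fun n => ip (bproj n u) m).
  exact: (cvg_comp _ _ (@bproj_cvg u) (@ip_continuous m u)).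
apply/funext => n; rewrite lsum ip_suml; apply: eq_bigr => j _.
by rewrite ipZl (ipC (phi j)) mphi.
Qed.

End basis.
End hilbert.

(** * Borel measurability in a separable Hilbert space *)

Section measurability.
Context (R : realType) (H : completeNormedModType R).
Hypothesis hsep : separable H.

(** In a separable space an open set is a countable union of balls centred in a
countable dense set; [n] enumerates the centres and [k] the radii. *)
Lemma measurable_dist d (T : measurableType d) (X : T -> H) :
  (forall c, measurable_fun setT (fun w => `|X w - c| ^+ 2)) ->
  measurable_fun setT (X : T -> borel H).
Proof.
move=> mX; apply: (@measurability _ _ T (borel H) setT X (@open H)) => // _ [U oU <-].
rewrite setTI.
have [D cD dD] := hsep; have /countable_injP[f finj] := cD.
pose B n k := [set x : H | exists2 c, D c /\ f c = n & `|x - c| < k.+1%:R^-1 /\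
   forall y, `|y - c| < k.+1%:R^-1 -> U y].
have -> : X @^-1` U = \bigcup_n \bigcup_k (X @^-1` B n k).
  apply/seteqP; split => w /=; last by move=> [n _ [k _ [c _ [? hU]]]]; exact: hU.
  move=> Uw.
  have /nbhs_ballP[e /= e0 eU] : nbhs (X w) U by exact: open_nbhs_nbhs.
  pose k := Num.truncn (2 / e).
  have ke : 2 * k.+1%:R^-1 < e.
    by rewrite ltr_pdivrMr// mulrC -ltr_pdivrMr//; exact: truncnS_gt.
  have k0 : 0 < k.+1%:R^-1 :> R by rewrite invr_gt0.
  have [] := dD (ball (X w) k.+1%:R^-1).
  - by exists (X w); exact: ballxx.
  - exact: ball_open.
  move=> c [cX Dc]; exists (f c) => //; exists k => //; exists c => //; split.
    by move: cX; rewrite -ball_normE.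
  move=> y yc; apply: eU; rewrite -ball_normE /ball_/=.
  move: cX; rewrite -ball_normE /ball_/= => cX.
  rewrite -(subrKA c); apply: le_lt_trans (ler_normD _ _) _.
  by move: cX yc ke; rewrite (distrC c y); move: (k.+1%:R^-1) => t ? ? ?; lra.
apply: bigcupT_measurable => n; apply: bigcupT_measurable => k.
have [[c [[Dc fc] hU]]|no] := pselect (exists c, (D c /\ f c = n) /\
    forall y, `|y - c| < k.+1%:R^-1 -> U y).
  rewrite (_ : _ @^-1` _ = [set w | `|X w - c| < k.+1%:R^-1]).
    rewrite -[X in measurable X]setTI.
    have := mX c measurableT `]-oo, k.+1%:R^-1 ^+ 2[%classic (measurable_itv _).
    congr (measurable (_ `&` _)); apply/seteqP; split => w /=;
      by rewrite in_itv/= ltr_pXn2r ?nnegrE.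
  apply/seteqP; split => w /=; last by move=> h; exists c.
  move=> [c' [Dc' fc'] [h _]]; rewrite (finj c c')// ?inE//; congruence.
rewrite (_ : _ @^-1` _ = set0); first exact: measurable0.
by apply/seteqP; split => w //= [c ? [_ h]]; apply: no; exists c.
Qed.

Lemma measurable_continuous d (T : measurableType d) (X : T -> borel H) (f : H -> R) :
  measurable_fun setT X -> continuous f -> measurable_fun setT (fun w => f (X w)).
Proof.
move=> mX /continuousP cf; apply: (measurability _ (RGenOpens.measurableE R)) => _ [U [a [b ->]] <-].
rewrite setTI -[X in measurable X]setTI; apply: (mX measurableT (f @^-1` `]a, b[%classic)).
by apply: sub_sigma_algebra; apply: cf; exact: interval_open.
Qed.

Variable ip : {dot H for idfun}.
Hypothesis hip : inner_product ip.
Variable phi : nat -> H.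
Hypothesis hphi : orthonormal_basis ip phi.

Lemma measurable_ip d (T : measurableType d) (X : T -> borel H) h :
  measurable_fun setT X -> measurable_fun setT (fun w => ip (X w) h).
Proof. by move=> mX; apply: (@measurable_continuous _ _ X (ip ^~ h) mX) => u; exact: (ip_continuous hip). Qed.

(** By Parseval, distances are limits of polynomials in the coordinates. *)
Lemma measurable_coord d (T : measurableType d) (X : T -> H) :
  (forall j, measurable_fun setT (fun w => ip (X w) (phi j))) ->
  measurable_fun setT (X : T -> borel H).
Proof.
move=> mX; apply: measurable_dist => c.
apply: (@measurable_fun_cvg _ _ _ _ (fun n w => \sum_(0 <= j < n) (ip (X w - c) (phi j)) ^+ 2)).
  move=> n; apply: measurable_sum => j; apply: measurable_funX.
  by under eq_fun do rewrite (ipBl ip); exact: measurable_funB.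
by move=> w _; exact: (parseval hip hphi).
Qed.

End measurability.

(** * Approximation in mean under second moment bounds *)

Section second_moment.
Context d (T : measurableType d) (R : realType) (P : probability T R).

Lemma Ex_fatou (f_ : nat -> T -> R) (f : T -> R) C :
  (forall n, intg P (f_ n)) -> (forall n x, 0 <= f_ n x) ->
  (forall x, f_ n x @[n --> \oo] --> f x) ->
  (forall n, \int[P]_x f_ n x <= C) ->
  intg P f /\ \int[P]_x f x <= C.
Proof.
move=> i_ f0 ff fC.
have mf : measurable_fun setT f.
  by apply: (measurable_fun_cvg (fun n => intg_meas (i_ n))) => x _; exact: ff.
have f_ge0 x : 0 <= f x.
  by apply: (ler_cvg_to (cvg_cst 0) (ff x)); apply: nearW => n; exact: f0.
have le : (\int[P]_x (f x)%:E <= C%:E)%E.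
  have e x : limn_einf (fun n => (f_ n x)%:E) = (f x)%:E.
    by apply: (cvg_limn_einf_sup _).1; apply: cvg_EFin; [exact: nearW|exact: ff].
  have := @fatou _ _ _ P setT measurableT (fun n x => (f_ n x)%:E)
    (fun n => measurableT_comp (@measurable_realfun.EFin_measurable _ _) (intg_meas (i_ n))) _.
  move=> /(_ (fun n x _ => f0 n x)).
  under eq_integral => x _ do rewrite e.
  move=> h; apply: le_trans h _.
  rewrite limn_einf_lim; apply: lime_le; first exact: is_cvg_einfs.
  apply: nearW => n; apply: ge_ereal_inf.
  by exists (\int[P]_x (f_ n x)%:E)%E; [exists n => /=|rewrite EFin_Ex// lee_fin].
have fi : intg P f.
  apply/integrableP; split; first exact/measurable_EFinP.
  under eq_integral => x _ do rewrite /= ger0_norm//.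
  exact: le_lt_trans le (ltry _).
by split=> //; rewrite -lee_fin -EFin_Ex.
Qed.

Context (H : completeNormedModType R) (ip : {dot H for idfun}) (phi : nat -> H).
Hypothesis hip : inner_product ip.
Hypothesis hphi : orthonormal_basis ip phi.

(** Parseval's identity integrated term by term. *)
Lemma second_moment_le (X : T -> H) (c : nat -> R) C :
  (forall k, intg P (fun w => ip (X w) (phi k) ^+ 2)) ->
  (forall k, \int[P]_w (ip (X w) (phi k) ^+ 2) <= c k) ->
  (forall n, \sum_(0 <= k < n) c k <= C) ->
  intg P (fun w => `|X w| ^+ 2) /\ \int[P]_w (`|X w| ^+ 2) <= C.
Proof.
move=> ik ck cC.
apply: (@Ex_fatou (fun n w => \sum_(0 <= k < n) ip (X w) (phi k) ^+ 2)).
- by move=> n; apply: intg_sum.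
- by move=> n w; apply: sumr_ge0 => k _; exact: sqr_ge0.
- by move=> w; exact: (parseval hip hphi).
- by move=> n; rewrite Ex_sum//; apply: le_trans (cC n); apply: ler_sum => k _.
Qed.

End second_moment.

(** The tail is written as a full sum with a cut-off because the coordinates of
[x - bproj N x] vanish below [N]. *)
Lemma series_tail (R : realType) (s : nat -> R) : (forall k, 0 <= s k) ->
  cvgn (series s) -> forall e, 0 < e ->
  exists N, forall n, \sum_(0 <= k < n) (if (k < N)%N then 0 else s k) <= e.
Proof.
move=> s0 cs e e0.
have ms m n : (m <= n)%N -> series s m <= series s n.
  by apply: nondecreasing_series => i _ _; exact: s0.
have les n : series s n <= limn (series s).
  by apply: nondecreasing_cvgn_le => //; move=> m k; exact: ms.
have [N _ NP] := (@cvgrPdist_le _ _ _ _ _ _ _).1 cs e e0.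
exists N => n.
have hN : limn (series s) - series s N <= e.
  by apply: le_trans (ler_norm _) _; exact: (NP N (leqnn N)).
have -> : \sum_(0 <= k < n) (if (k < N)%N then 0 else s k) = series s (maxn n N) - series s N.
  elim: n => [|n IH]; first by rewrite big_geq// max0n subrr.
  rewrite big_nat_recr//= IH; case: ltnP => nN.
    by rewrite !(maxn_idPr _) ?addr0// ltnW.
  by rewrite !(maxn_idPl _)// ?(leq_trans nN)// /series/= big_nat_recr//=; ring.
by apply: le_trans hN; rewrite lerB.
Qed.

Lemma lip_continuous (R : realType) (H : completeNormedModType R) (f : H -> R) (L : R) : 0 <= L ->
  (forall x y, `|f x - f y| <= L * `|x - y|) -> continuous f.
Proof.
move=> L0 fL x; apply/cvgrPdist_le => e' e'0.
have d0 : 0 < e' / (L + 1) by rewrite divr_gt0// ltr_wpDl.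
near=> y; apply: le_trans (fL _ _) _.
apply: (@le_trans _ _ (L * (e' / (L + 1)))).
  by apply: ler_wpM2l => //; near: y; exact: cvgr_dist_le.
by rewrite mulrCA ger_pMr// ler_pdivrMr ?ltr_wpDl//; lra.
Unshelve. all: by end_near. Qed.

Section lipschitz_test_functions.
Context (R : realType) (H : completeNormedModType R) (ip : {dot H for idfun}).
Variable phi : nat -> H.
Hypothesis hip : inner_product ip.
Hypothesis hphi : orthonormal_basis ip phi.
Local Notation trigH := (trig (fun x u : H => ip x u)).

Lemma trig_bounded p : trigH p -> exists B, forall x, `|p x| <= B.
Proof.
elim=> [u a|c f g _ [B1 h1] _ [B2 h2]].
  by exists 1 => x; rewrite ler_norml cos_geN1 cos_le1.
exists (`|c| * B1 + B2) => x; apply: le_trans (ler_normD _ _) _.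
by rewrite normrM lerD// ler_wpM2l.
Qed.

Lemma trig_measurable d (T : measurableType d) (X : T -> borel H) p :
  measurable_fun setT X -> trigH p -> measurable_fun setT (fun w => p (X w)).
Proof.
move=> mX; elim=> [u a|c f g _ h1 _ h2].
  apply: measurable_cosf.
  by apply: measurable_funD => //; exact: (measurable_ip hip).
by apply: measurable_funD => //; apply: measurable_funM.
Qed.

(** A summable [s] makes a family of laws tight: the energy carried by the
coordinates beyond [N] is uniformly small. *)
Definition moments_le d (T : measurableType d) (P : probability T R) (X : T -> H)
    (s : nat -> R) :=
  forall k, intg P (fun w => ip (X w) (phi k) ^+ 2) /\
            \int[P]_w (ip (X w) (phi k) ^+ 2) <= s k.

(** The same trigonometric function serves all laws with the given moment bounds:
projecting on [N] coordinates costs a tail of [s], and a Lipschitz function of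
finitely many coordinates is trigonometric up to a second moment. *)
Lemma trig_approx_mean (f : H -> R) L B (s : nat -> R) : 0 <= L ->
  (forall x, `|f x| <= B) -> (forall x y, `|f x - f y| <= L * `|x - y|) ->
  (forall k, 0 <= s k) -> cvgn (series s) -> forall e, 0 < e ->
  exists2 p, trigH p & forall d (T : measurableType d) (P : probability T R)
    (X : T -> borel H), measurable_fun setT X -> moments_le P X s ->
    `|\int[P]_w f (X w) - \int[P]_w p (X w)| <= e.
Proof.
move=> L0 fB fL s0 cs e e0.
pose eta : R := e / (4 * (L + 1)).
have eta0 : 0 < eta by rewrite divr_gt0// mulr_gt0// ltr_wpDl.
have [N NP] := series_tail s0 cs (exprn_gt0 2 eta0).
pose S := limn (series s).
have S0 : 0 <= S.
  by apply: limr_ge => //; apply: nearW => n; apply: sumr_ge0.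
have SP n : \sum_(0 <= k < n) s k <= S.
  by apply: nondecreasing_cvgn_le => //; apply: nondecreasing_series => i _ _; exact: s0.
pose del : R := e / (4 * (S + 1)).
have del0 : 0 < del by rewrite divr_gt0// mulr_gt0// ltr_wpDl.
pose g (t : nat -> R) := f (\sum_(0 <= j < N) t j *: phi j).
have gL t t' : `|g t - g t'| <= L * \sum_(j < N) `|t j - t' j|.
  apply: le_trans (fL _ _) _; apply: ler_wpM2l => //.
  rewrite -sumrB -(big_mkord xpredT (fun j => `|t j - t' j|)).
  apply: le_trans (ler_norm_sum _ _ _) _; apply: ler_sum => j _.
  by rewrite -scalerBl normrZ (phi_norm hip hphi) mulr1.
have [p tp pg] := @trig_approx R H H (fun x u => ip x u)
  (fun x u v => ipDr ip u v x) (fun x c u => ipZr ip c u x) phi N g L L0 gL del del0.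
exists p => // d T P X mX mom.
have mY k : measurable_fun setT (fun w => ip (X w) (phi k)) by exact: (measurable_ip hip).
have [iX2 EX2] : intg P (fun w => `|(X w : H) - bproj ip phi N (X w)| ^+ 2) /\
    \int[P]_w (`|(X w : H) - bproj ip phi N (X w)| ^+ 2) <= eta ^+ 2.
  have cE w k : ip ((X w : H) - bproj ip phi N (X w)) (phi k) ^+ 2 =
      if (k < N)%N then 0 else ip (X w) (phi k) ^+ 2.
    by rewrite ipBl (ip_bproj hphi); case: ifP; rewrite ?subrr ?expr0n ?subr0.
  apply: (second_moment_le hip hphi (c := fun k => if (k < N)%N then 0 else s k)) => // k.
    under eq_fun do rewrite cE.
    by case: (k < N)%N; [exact: intg_cst|exact: (mom k).1].
  under eq_Rintegral do rewrite cE.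
  by case: (k < N)%N; [rewrite Ex_cst|exact: (mom k).2].
pose h (w : T) := L / eta * `|(X w : H) - bproj ip phi N (X w)| ^+ 2 + L * eta +
  del * (1 + \sum_(0 <= j < N) ip (X w) (phi j) ^+ 2).
have iS : intg P (fun w => \sum_(0 <= j < N) ip (X w) (phi j) ^+ 2).
  by apply: intg_sum => j; exact: (mom j).1.
have ih1 : intg P (fun w => L / eta * `|(X w : H) - bproj ip phi N (X w)| ^+ 2 + L * eta).
  by apply: intgD; [exact: intgZ|exact: intg_cst].
have ih2 : intg P (fun w => 1 + \sum_(0 <= j < N) ip (X w) (phi j) ^+ 2).
  by apply: intgD => //; exact: intg_cst.
have ih : intg P h by apply: intgD => //; exact: intgZ.
have cf : continuous f := lip_continuous L0 fL.
have mf : measurable_fun setT (fun w => f (X w)) by exact: measurable_continuous.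
have ifX : intg P (fun w => f (X w)) by apply: (@intg_bnd _ _ _ _ _ B).
have [Bp pB] := trig_bounded tp.
have ipX : intg P (fun w => p (X w)).
  by apply: (@intg_bnd _ _ _ _ _ Bp) => //; exact: trig_measurable.
apply: (@le_trans _ _ (\int[P]_w h w)).
  apply: Ex_dist_le => // w.
  rewrite -(subrKA (f (bproj ip phi N (X w)))).
  apply: le_trans (ler_normD _ _) _; apply: lerD; last first.
    by have := pg (X w); rewrite -(big_mkord xpredT (fun j => ip (X w) (phi j) ^+ 2)).
  apply: le_trans (fL _ _) _; set z := `| _ |.
  have -> : L / eta * z ^+ 2 + L * eta = L * ((z ^+ 2 + eta ^+ 2) / eta).
    by field; rewrite gt_eqF.
  apply: ler_wpM2l => //; rewrite ler_pdivlMr//.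
  have z0 : 0 <= z by exact: normr_ge0.
  by move: (eta) eta0 (z) z0 => y y0 {}z z0; nra.
rewrite /h (ExD ih1 (intgZ del ih2)) (ExD (intgZ _ iX2) (intg_cst P _)).
rewrite (ExZ _ iX2) (ExZ _ ih2) (ExD (intg_cst P 1) iS) !Ex_cst.
rewrite Ex_sum; last by move=> j; exact: (mom j).1.
have H1 : L / eta * \int[P]_w (`|(X w : H) - bproj ip phi N (X w)| ^+ 2) <= L * eta.
  apply: (@le_trans _ _ (L / eta * eta ^+ 2)).
    by apply: ler_wpM2l => //; rewrite divr_ge0// ltW.
  by rewrite expr2 mulrA divfK ?gt_eqF.
have H2 : \sum_(0 <= j < N) \int[P]_w (ip (X w) (phi j) ^+ 2) <= S.
  by apply: le_trans (SP N); apply: ler_sum => j _; exact: (mom j).2.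
have H3 : L * eta <= e / 4.
  have -> : L * eta = e / 4 * (L / (L + 1)).
    by rewrite /eta; field; rewrite gt_eqF// ltr_wpDl.
  by rewrite ger_pMr ?divr_gt0// ler_pdivrMr ?ltr_wpDl//; lra.
have H4 : del * (1 + S) = e / 4.
  by rewrite /del; field; rewrite gt_eqF// ltr_wpDl.
have H5 : del * (1 + \sum_(0 <= j < N) \int[P]_w (ip (X w) (phi j) ^+ 2)) <= e / 4.
  by rewrite -H4 ler_pM2l// lerD2l.
lra.
Qed.

End lipschitz_test_functions.

(** * Criteria for convergence in law *)

Section inf_convolution.
Context (R : realType) (H : completeNormedModType R).
Variables (f : H -> R) (B : R).
Hypothesis fB : forall x, `|f x| <= B.

(** Pasch-Hausdorff envelope: the largest [k]-Lipschitz function below [f]. *)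
Definition lip_env (k : nat) (x : H) : R := inf [set f y + k%:R * `|x - y| | y in setT].

Let fge y : - B <= f y. Proof. by have := fB y; rewrite ler_norml => /andP[]. Qed.

Let lb k x : lbound [set f y + k%:R * `|x - y| | y in setT] (- B).
Proof. by move=> _ [y _ <-]; apply: le_trans (fge y) _; rewrite lerDl mulr_ge0. Qed.

Let hasinf k x : has_inf [set f y + k%:R * `|x - y| | y in setT].
Proof. by split; [exists (f x + k%:R * `|x - x|); exists x|exists (- B); exact: lb]. Qed.

Lemma lip_env_le k x y : lip_env k x <= f y + k%:R * `|x - y|.
Proof. by apply: inf_lbound; [exact: (hasinf k x).2|exists y]. Qed.

Lemma lip_env_le_self k x : lip_env k x <= f x.
Proof. by apply: le_trans (lip_env_le k x x) _; rewrite subrr normr0 mulr0 addr0. Qed.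

Lemma lip_env_ge k x c : (forall y, c <= f y + k%:R * `|x - y|) -> c <= lip_env k x.
Proof.
by move=> h; apply: lb_le_inf; [exact: (hasinf k x).1|move=> _ [y _ <-]].
Qed.

Lemma lip_env_bounded k x : `|lip_env k x| <= B.
Proof.
rewrite ler_norml; apply/andP; split.
  by apply: lip_env_ge => y; apply: (@lb k x); exists y.
apply: le_trans (lip_env_le_self k x) _.
by have := fB x; rewrite ler_norml => /andP[].
Qed.

Lemma lip_env_lipschitz k x y : `|lip_env k x - lip_env k y| <= k%:R * `|x - y|.
Proof.
wlog suff H1 : x y / lip_env k x - lip_env k y <= k%:R * `|x - y|.
  by rewrite ler_norml H1 andbT lerNl opprB distrC H1.
rewrite lerBlDr addrC -lerBlDr; apply: lip_env_ge => z.
rewrite lerBlDr; apply: le_trans (lip_env_le k x z) _.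
rewrite -addrA lerD2l -mulrDr ler_wpM2l// [leRHS]addrC.
by have := ler_normD (x - y) (y - z); rewrite subrKA.
Qed.

(** Near [x] continuity bounds the infimum from below; away from [x] the penalty
exceeds the oscillation of [f]. *)
Lemma lip_env_cvg x : {for x, continuous f} -> lip_env k x @[k --> \oo] --> f x.
Proof.
move=> cf; apply/cvgrPdist_le => e e0.
have /nbhs_ballP[del /= del0 hdel] : nbhs x [set y | `|f x - f y| <= e].
  by move/cvgrPdist_le : cf; apply.
near=> k.
rewrite ger0_norm ?subr_ge0 ?lip_env_le_self// lerBlDl -lerBlDr.
apply: lip_env_ge => y.
have [xy|xy] := ltP `|x - y| del.
  have : `|f x - f y| <= e by apply: hdel; rewrite -ball_normE.
  have : 0 <= k%:R * `|x - y| by rewrite mulr_ge0.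
  by rewrite ler_norml => ? /andP[_ ?]; lra.
have kB : 2 * B <= k%:R * del.
  rewrite -ler_pdivrMr//; near: k; exact: nbhs_infty_ger.
have : k%:R * del <= k%:R * `|x - y| by apply: ler_wpM2l.
have := fge y; have := fB x; rewrite ler_norml => /andP[_ ?] ? ?; lra.
Unshelve. all: by end_near. Qed.

End inf_convolution.

Section convergence_in_law.
Context (R : realType) (H : completeNormedModType R).
Context (I : Type) (F : set_system I) {FF : Filter F}.
Context d (Omega : measurableType d) (P : probability Omega R).
Variables (X : I -> Omega -> H) (nu : probability (borel H) R).
Hypothesis mX : forall i, measurable_fun setT (X i : Omega -> borel H).

Lemma measurable_id_borel (f : H -> R) : continuous f ->
  measurable_fun [set: borel H] (f : borel H -> R).
Proof. by move=> cf; exact: (measurable_continuous (X := id)). Qed.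

(** A bounded continuous function is the increasing limit of its Lipschitz envelopes. *)
Lemma cvg_in_law_lipschitz :
  (forall (f : H -> R) L B, 0 <= L -> (forall x, `|f x| <= B) ->
     (forall x y, `|f x - f y| <= L * `|x - y|) ->
     \int[P]_w f (X i w) @[i --> F] --> \int[nu]_x f x) ->
  cvg_in_law F P X nu.
Proof.
move=> hL f cf [M [Mreal hM]].
pose B := `|M| + 1.
have fB x : `|f x| <= B.
  by apply: (hM B) => //; rewrite /B (le_lt_trans (ler_norm M))// ltrDl.
have iX g : continuous g -> (forall x, `|g x| <= B) -> forall i, intg P (fun w => g (X i w)).
  by move=> cg gB i; apply: (@intg_bnd _ _ _ _ _ B) => //; exact: measurable_continuous.
have inu g : continuous g -> (forall x, `|g x| <= B) -> intg nu (g : borel H -> R).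
  by move=> cg gB; apply: (@intg_bnd _ _ _ _ _ B) => //; exact: measurable_id_borel.
(* Applied to f and to - f, this one-sided bound gives the limit. *)
have lower g : continuous g -> (forall x, `|g x| <= B) -> forall e, 0 < e ->
    \forall i \near F, \int[nu]_x g x - e <= \int[P]_w g (X i w).
  move=> cg gB e e0.
  have ck k : continuous (lip_env g k).
    by apply: (@lip_continuous _ _ _ k%:R) => //; exact: lip_env_lipschitz.
  have kB k x : `|lip_env g k x| <= B by exact: lip_env_bounded.
  have e2 : 0 < e / 2 by rewrite divr_gt0.
  have : \int[nu]_x lip_env g k x @[k --> \oo] --> \int[nu]_x g x.
    apply: (@Ex_dct _ _ _ _ _ _ (fun=> B)) => //.
    - by move=> k; exact: measurable_id_borel.
    - by move=> x; exact: lip_env_cvg (cg x).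
    - exact: intg_cst.
  move=> /cvgrPdist_le/(_ _ e2)[k _ /(_ k (leqnn k)) hk].
  have /cvgrPdist_le/(_ _ e2) := hL _ _ _ (ler0n R k) (kB k) (lip_env_lipschitz gB k).
  apply: filterS => i hi.
  have : \int[P]_w lip_env g k (X i w) <= \int[P]_w g (X i w).
    by apply: Ex_le => [||w]; [exact: iX|exact: iX|exact: lip_env_le_self].
  by move: hk hi; rewrite !ler_norml => /andP[? ?] /andP[? ?] ?; lra.
rewrite EFin_Ex; last exact: inu.
apply: cvg_EFin; first by apply: nearW => i; rewrite EFin_Ex//; exact: iX.
apply/cvgrPdist_le => e e0.
have cNf : continuous (fun x => - f x) by move=> x; apply: cvgN; exact: cf.
have NfB x : `|- f x| <= B by rewrite normrN.
near=> i.
have h1 : \int[nu]_x f x - e <= \int[P]_w f (X i w) by near: i; exact: lower.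
have h2 : \int[nu]_x - f x - e <= \int[P]_w - f (X i w).
  by near: i; exact: (lower (fun x => - f x)).
move: h2; rewrite !ExN ?ler_norml; [|exact: iX|exact: inu] => h2.
by rewrite /= -/(Rintegral _ _ _); apply/andP; split; lra.
Unshelve. all: by end_near. Qed.

Variable ip : {dot H for idfun}.
Hypothesis hip : inner_product ip.
Variable phi : nat -> H.
Hypothesis hphi : orthonormal_basis ip phi.

(** The common moment bound plays the part of tightness: one trigonometric function
replaces a given Lipschitz function in mean under all the laws at once. *)
Lemma cvg_in_law_trig (s : nat -> R) : cvgn (series s) -> (forall k, 0 <= s k) ->
  (forall i, moments_le ip phi P (X i) s) ->
  moments_le ip phi nu (fun x : borel H => x : H) s ->
  (forall u a, \int[P]_w cos (ip (X i w) u + a) @[i --> F] -->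
               \int[nu]_x cos (ip (x : H) u + a)) ->
  cvg_in_law F P X nu.
Proof.
move=> cs s0 momX momnu htrig; apply: cvg_in_law_lipschitz => f L B L0 fB fL.
have trigcvg p : trig (fun x u : H => ip x u) p ->
    \int[P]_w p (X i w) @[i --> F] --> \int[nu]_x p x.
  elim=> [u a|c g1 g2 t1 h1 t2 h2]; first exact: htrig.
  have im g : trig (fun x u : H => ip x u) g -> intg nu (g : borel H -> R) /\
      forall i, intg P (fun w => g (X i w)).
    move=> tg; have [Bg gB] := trig_bounded tg; split => [|i].
      apply: (@intg_bnd _ _ _ _ _ Bg) => //.
      exact: (trig_measurable hip (X := id)).
    by apply: (@intg_bnd _ _ _ _ _ Bg) => //; exact: (trig_measurable hip).
  rewrite (ExD (intgZ c (im _ t1).1) (im _ t2).1) (ExZ c (im _ t1).1).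
  rewrite (_ : (fun i => _) = fun i => c * \int[P]_w g1 (X i w) + \int[P]_w g2 (X i w)).
    by apply: cvgD => //; apply: cvgMl_tmp.
  apply/funext => i.
  by rewrite (ExD (intgZ c ((im _ t1).2 i)) ((im _ t2).2 i)) (ExZ c ((im _ t1).2 i)).
apply/cvgrPdist_le => e e0.
have e3 : 0 < e / 3 by rewrite divr_gt0.
have [p tp pP] := trig_approx_mean hip hphi L0 fB fL s0 cs e3.
have /cvgrPdist_le/(_ _ e3) := trigcvg p tp.
apply: filterS => i hi.
have h1 := pP _ _ P (X i) (mX i) (momX i).
have h2 := pP _ _ nu id (@measurable_id _ _ _) momnu.
by move: hi h1 h2; rewrite !ler_norml => /andP[? ?] /andP[? ?] /andP[? ?];
  apply/andP; split; lra.
Qed.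

End convergence_in_law.

(** * Uniqueness of laws on the line *)

Lemma measure_ray_unique (R : realType) (m1 m2 : {measure set R -> \bar R}) :
  (forall c, m1 `]-oo, c[%classic = m2 `]-oo, c[%classic) ->
  (forall c, (m1 `]-oo, c[%classic < +oo)%E) ->
  forall A : set R, measurable A -> m1 A = m2 A.
Proof.
move=> m12 fin; apply: (@measure_unique _ R R (@RGenInftyO.G R) (fun n => `]-oo, n%:R[%classic)).
- exact: RGenInftyO.measurableE.
- move=> _ _ [x ->] [y ->]; exists (Num.min x y).
  by apply/seteqP; split => z /=; rewrite !in_itv/= lt_min => /andP.
- by move=> n; exists n%:R.
- apply/seteqP; split => // x _; exists (Num.truncn x).+1 => //=.
  by rewrite in_itv/=; exact: truncnS_gt.
- by move=> _ [c ->].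
- by move=> k.
Qed.

Section cf_uniqueness.
Context (R : realType) (mu nu : probability R R).
Hypothesis mu2 : intg mu (fun x : R => x ^+ 2).
Hypothesis nu2 : intg nu (fun x : R => x ^+ 2).
Hypothesis munu : forall t a,
  \int[mu]_x cos (x * t + a) = \int[nu]_x cos (x * t + a).

Let trigR := @trig R R R^o (fun x u => x * (u : R)).

Let trig_int p : trigR p -> [/\ intg mu p, intg nu p & \int[mu]_x p x = \int[nu]_x p x].
Proof.
have icos (m : probability R R) t a : intg m (fun x => cos (x * t + a)).
  by apply: intg_cos; apply: measurable_funD => //; apply: measurable_funM.
elim=> [u a|c f g _ [f1 f2 f3] _ [g1 g2 g3]]; first by split => //; exact: munu.
split; [by apply: intgD => //; exact: intgZ|by apply: intgD => //; exact: intgZ|].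
by rewrite !ExD ?ExZ ?f3 ?g3//; exact: intgZ.
Qed.

Let eq_lip (f : R -> R) L B : 0 <= L -> (forall x, `|f x| <= B) ->
  (forall x y, `|f x - f y| <= L * `|x - y|) ->
  \int[mu]_x f x = \int[nu]_x f x.
Proof.
move=> L0 fB fL; apply/eqP; rewrite -subr_eq0 -normr_le0; apply/ler_addgt0Pr => e e0.
rewrite add0r.
pose K := 2 + \int[mu]_x (x ^+ 2) + \int[nu]_x (x ^+ 2).
have K0 : 0 < K.
  by rewrite /K -addrA ltr_wpDr// addr_ge0//; apply: Rintegral_ge0 => x _; exact: sqr_ge0.
pose del : R := e / K.
have del0 : 0 < del by rewrite divr_gt0.
have fL' (t t' : nat -> R) : `|f (t 0%N) - f (t' 0%N)| <= L * \sum_(j < 1) `|t j - t' j|.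
  by rewrite big_ord1.
have [p tp pg] := @trig_approx R R R^o (fun x u => x * (u : R))
  (fun x u v => mulrDr x u v) (fun x c u => mulrCA x c u) (fun=> 1) 1
  (fun t => f (t 0%N)) L L0 fL' del del0.
have {}pg x : `|f x - p x| <= del + del * x ^+ 2.
  by have := pg x; rewrite big_ord1 mulr1 mulrDr mulr1.
have mf : measurable_fun setT f.
  by apply: continuous_measurable_fun; exact: (@lip_continuous R R^o f L L0 fL).
have iF (m : probability R R) : intg m f by exact: (@intg_bnd _ _ _ _ _ B).
have [pmu pnu pE] := trig_int tp.
have h1 := Ex_dist_le (iF mu) pmu (intgD (intg_cst mu del) (intgZ del mu2)) pg.
have h2 := Ex_dist_le (iF nu) pnu (intgD (intg_cst nu del) (intgZ del nu2)) pg.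
rewrite (ExD (intg_cst mu del) (intgZ del mu2)) Ex_cst (ExZ del mu2) pE in h1.
rewrite (ExD (intg_cst nu del) (intgZ del nu2)) Ex_cst (ExZ del nu2) in h2.
have eE : e = del * K by rewrite /del divfK// gt_eqF.
rewrite eE -(subrKA (\int[nu]_x p x)); apply: le_trans (ler_normD _ _) _.
rewrite [X in _ + X]distrC; apply: le_trans (lerD h1 h2) _.
by rewrite /K; lra.
Qed.

(** Trigonometric functions approximate bounded Lipschitz functions in mean for both
laws at once, and ramps decrease to indicators of open rays. *)
Lemma cf_unique (A : set R) : measurable A -> mu A = nu A.
Proof.
apply: measure_ray_unique => c; last by rewrite ltey_eq fin_num_measure.
  pose f k x : R := Num.min 1 (Num.max 0 (k%:R * (c - x))).
  have f01 k x : 0 <= f k x <= 1 by rewrite /f ge_min lexx le_min le_max lexx ler01.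
  have fE k : \int[mu]_x f k x = \int[nu]_x f k x.
    apply: (@eq_lip _ k%:R 1) => //.
      by move=> x; have /andP[? ?] := f01 k x; rewrite ger0_norm.
    move=> x y; rewrite /f.
    have k0 : 0 <= k%:R :> R by [].
    have -> : k%:R * `|x - y| = `|k%:R * (c - x) - k%:R * (c - y)|.
      by rewrite -mulrBr normrM (ger0_norm k0) distrC; congr (_ * Num.norm _); ring.
    move: (k%:R * (c - x)) (k%:R * (c - y)) => s t.
    by rewrite /Num.min /Num.max; case: ifPn; case: ifPn; case: ifPn; case: ifPn;
      rewrite -?leNgt => *; have /ler_normlP[? ?] := lexx `|s - t|;
      rewrite ler_norml; apply/andP; split; lra.
  have fcvg (m : probability R R) :
      \int[m]_x f k x @[k --> \oo] --> \int[m]_x \1_(`]-oo, c[%classic) x.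
    apply: (@Ex_dct _ _ _ _ _ _ (fun=> 1)).
    + move=> k; apply: measurable_minr => //; apply: measurable_maxr => //.
      by apply: measurable_funM => //; apply: measurable_funB.
    + move=> x; rewrite indicE; have [xc|xc] := ltP x c.
        rewrite mem_set/= ?in_itv//=; apply: cvg_near_cst.
        near=> k; rewrite /f; apply/min_idPl; rewrite le_max; apply/orP; right.
        rewrite -ler_pdivrMr ?subr_gt0//; near: k; exact: nbhs_infty_ger.
      rewrite memNset/= ?in_itv/=; last by apply/negP; rewrite -leNgt.
      apply: cvg_near_cst; apply: nearW => k; rewrite /f max_l ?min_r//.
      by rewrite mulr_ge0_le0// subr_le0.
    + exact: intg_cst.
    + by move=> k x; have /andP[? ?] := f01 k x; rewrite ger0_norm.
  have h1 := fcvg mu; have h2 := fcvg nu.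
  rewrite (_ : (fun k => _) = (fun k => \int[nu]_x f k x)) in h1; last exact/funext.
  have := cvg_unique (@Rhausdorff R) h1 h2; rewrite !Ex_indic// => h.
  have fin (m : probability R R) : m `]-oo, c[%classic \is a fin_num.
    by apply: fin_num_measure.
  transitivity (fine (mu `]-oo, c[%classic))%:E; first by rewrite fineK ?fin.
  transitivity (fine (nu `]-oo, c[%classic))%:E; last by rewrite fineK ?fin.
  by apply: (congr1 EFin); exact: h.
Unshelve. all: by end_near. Qed.

End cf_uniqueness.

(** * The normal law on the line *)

Lemma cvg_invn (R : realType) : (n%:R : R)^-1 @[n --> \oo] --> (0 : R).
Proof. by rewrite -(cvg_shiftS (fun n => (n%:R : R)^-1)); exact: cvg_harmonic. Qed.

Section normal_moments.
Context (R : realType) (s : R).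
Hypothesis s0 : s != 0.
Local Notation mu := (@lebesgue_measure R).
Local Notation N := (@normal_prob R 0 s).
Local Notation pdf := (@normal_pdf R 0 s).

(** The density is a version of the Radon-Nikodym derivative. *)
Lemma integral_normal_prob U (f : R -> \bar R) : measurable U ->
  N.-integrable U f ->
  (\int[N]_(x in U) f x = \int[mu]_(x in U) (f x * (pdf x)%:E))%E.
Proof.
move=> mU fi; have Nmu := @normal_prob_dominates R 0 s.
rewrite -(Radon_Nikodym_change_of_variables Nmu)//.
apply: ae_eq_integral => //.
- apply: emeasurable_funM; first exact: measurable_int fi.
  apply: (measurable_int mu).
  by apply: (integrableS _ _ (@subsetT _ _)) => //; exact: Radon_Nikodym_integrable.
- apply: emeasurable_funM; first exact: measurable_int fi.
  by apply/measurable_EFinP/measurable_funTS; exact: measurable_normal_pdf.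
- apply: ae_eqe_mul2l; rewrite Radon_NikodymE; case: cid => /= h [h1 h2 h3].
  apply: integral_ae_eq => //.
  + exact: integrableS h2.
  + by apply/measurable_EFinP/measurable_funTS; exact: measurable_normal_pdf.
  + by move=> E _ mE; rewrite -h3.
Qed.

Lemma is_derive_pdf (x : R) : is_derive x (1 : R) pdf (- (x / s ^+ 2) * pdf x).
Proof.
rewrite normal_pdfE//; apply: is_derive_eq.
rewrite /GRing.scale/= /normal_fun subr0 !mulr2n; field.
by rewrite s0 -mulr2n mulrn_eq0 expf_neq0.
Qed.

Lemma normal_truncated (phi G : R -> R) : continuous phi ->
  (forall x : R, is_derive x (1 : R) G (phi x * pdf x)) -> forall n : nat, (0 < n)%N ->
  \int[N]_x (phi x * \1_`[- n%:R, n%:R] x) = G n%:R - G (- n%:R).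
Proof.
move=> cphi dG n n0.
have nn : - n%:R < n%:R :> R by rewrite gtrN ?ltr0n.
have cpdf := @continuous_normal_pdf R 0 s s0.
have cG : continuous G.
  by move=> x; apply/differentiable_continuous/derivable1_diffP; have [] := dG x.
rewrite /Rintegral (_ : (fun x => _) = (fun x => (phi x)%:E) \_ `[- n%:R, n%:R]); last first.
  apply/funext => x; rewrite patchE indicE; case: ifP => _; by rewrite ?mulr1 ?mulr0.
rewrite -integral_mkcond integral_normal_prob//; last first.
  apply: measurable_bounded_integrable => //.
  - by rewrite ltey_eq fin_num_measure.
  - by apply: measurable_funTS; exact: continuous_measurable_fun.
  - have : compact (phi @` `[- n%:R, n%:R]).
      apply: continuous_compact; last exact: segment_compact.
      exact: continuous_subspaceT.
    move=> /compact_bounded[M [Mr hM]]; exists M; split => // y My x xi.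
    by apply: (hM y My); exists x.
under eq_integral do rewrite -EFinM.
rewrite (continuous_FTC2 (F := G) nn)//.
- apply: continuous_subspaceT => x; apply: cvgM; [exact: cphi|exact: cpdf].
- split.
  + by move=> x _; have [] := dG x.
  + by apply: cvg_at_right_filter; exact: cG.
  + by apply: cvg_at_left_filter; exact: cG.
- by move=> x _; rewrite derive1E; have [_ ->] := dG x.
Qed.

Lemma pdf_even x : pdf (- x) = pdf x.
Proof. by rewrite normal_pdfE// /normal_fun !subr0 sqrrN. Qed.

Lemma cvg_mul_pdf : n%:R * pdf n%:R @[n --> \oo] --> (0 : R).
Proof.
pose c := s ^+ 2 *+ 2; have c0 : 0 < c by rewrite pmulrn_lgt0// exprn_even_gt0.
apply: (@squeeze_cvgr _ _ _ _ (fun=> 0) (fun n => normal_peak s * c * n%:R^-1)).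
- apply: nearW => -[|n]; first by rewrite mul0r invr0 mulr0 lexx.
  rewrite mulr_ge0 ?normal_pdf_ge0//= normal_pdfE// mulrCA -!mulrA.
  rewrite ler_wpM2l ?normal_peak_ge0// /normal_fun subr0 -/c.
  rewrite ler_pdivlMr ?ltr0n// mulrAC -expr2 mulNr expRN.
  rewrite ler_pdivrMr ?expR_gt0// mulrC -ler_pdivrMr//.
  by apply: le_trans (expR_ge1Dx _); rewrite lerDr.
- exact: cvg_cst.
- rewrite -[X in _ --> X](mulr0 (normal_peak s * c)); apply: cvgMl_tmp.
  exact: cvg_invn.
Qed.

Lemma cvg_pdf : pdf n%:R @[n --> \oo] --> (0 : R).
Proof.
apply: (@squeeze_cvgr _ _ _ _ (fun=> 0) (fun n => n%:R * pdf n%:R)); last 2 first.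
- exact: cvg_cst.
- exact: cvg_mul_pdf.
near=> n; rewrite normal_pdf_ge0/= ler_peMl ?normal_pdf_ge0// ler1n.
by near: n; exact: nbhs_infty_gt.
Unshelve. all: by end_near. Qed.

Let indic_cvg (f : R -> R) x : f x * \1_`[- n%:R, n%:R] x @[n --> \oo] --> f x.
Proof.
apply: cvg_near_cst; near=> n.
rewrite indicE mem_set ?mulr1//= in_itv/= -ler_norml.
by near: n; exact: nbhs_infty_ger.
Unshelve. all: by end_near. Qed.

Let indic_le (f : R -> R) n x : `|f x * \1_`[- n%:R, n%:R] x| <= `|f x|.
Proof. by rewrite indicE normrM; case: (_ \in _); rewrite /= ?normr1 ?normr0 ?mulr1 ?mulr0. Qed.

Let meas_indic (f : R -> R) n : measurable_fun setT f ->
  measurable_fun setT (fun x => f x * \1_`[- n%:R, n%:R] x).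
Proof. by move=> mf; apply: measurable_funM => //; exact: measurable_indic. Qed.

(** The boundary terms of the fundamental theorem of calculus are at most the density
at [n] and [- n], which tends to zero. *)
Lemma normal_deriv0 (phi G : R -> R) : continuous phi -> intg N phi ->
  (forall x : R, is_derive x (1 : R) G (phi x * pdf x)) ->
  (forall x, `|G x| <= pdf x) -> \int[N]_x phi x = 0.
Proof.
move=> cphi iphi dG Gle.
have mphi := intg_meas iphi.
have h1 : \int[N]_x (phi x * \1_`[- n%:R, n%:R] x) @[n --> \oo] --> \int[N]_x phi x.
  apply: (@Ex_dct _ _ _ N (fun n x => phi x * \1_`[- n%:R, n%:R] x) phi (fun x => `|phi x|)) => //.
  - by move=> n; exact: meas_indic.
  - exact: intg_norm.
apply: (cvg_unique (@Rhausdorff R) h1).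
have h2 : pdf n%:R + pdf n%:R @[n --> \oo] --> (0 : R).
  by rewrite -[X in _ --> X]addr0; apply: cvgD; exact: cvg_pdf.
apply/norm_cvg0P; apply: (@squeeze_cvgr _ _ _ _ (fun=> 0) (fun n => pdf n%:R + pdf n%:R)) => //.
- near=> n; rewrite normr_ge0 (normal_truncated cphi dG); last first.
    by near: n; exact: nbhs_infty_gt.
  apply: le_trans (ler_normB _ _) _; rewrite -[X in _ <= _ + X]pdf_even.
  exact: lerD.
- exact: cvg_cst.
Unshelve. all: by end_near. Qed.

Let msqr : measurable_fun [set: R] (fun x : R => x ^+ 2).
Proof. by apply: measurable_funX. Qed.

Let s2 : 0 < s ^+ 2. Proof. by rewrite exprn_even_gt0. Qed.

Let second_truncated n : (0 < n)%N -> \int[N]_x (x ^+ 2 * \1_`[- n%:R, n%:R] x) =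
  s ^+ 2 * (fine (N `[- n%:R, n%:R]%classic) - 2 * (n%:R * pdf n%:R)).
Proof.
move=> n0.
have c1 : continuous (fun x : R => 1 - x ^+ 2 / s ^+ 2).
  move=> x; apply: cvgB; first exact: cvg_cst.
  by apply: cvgM; [exact: exprn_continuous|exact: cvg_cst].
have dG (x : R) : is_derive x (1 : R) (fun x => x * pdf x) ((1 - x ^+ 2 / s ^+ 2) * pdf x).
  have d := is_derive_pdf x.
  by apply: is_derive_eq; rewrite /GRing.scale/=; field.
have := normal_truncated c1 dG n0; rewrite pdf_even.
have -> : (fun x : R => (1 - x ^+ 2 / s ^+ 2) * \1_`[- n%:R, n%:R] x) =
   (fun x => \1_`[- n%:R, n%:R] x - (s ^+ 2)^-1 * (x ^+ 2 * \1_`[- n%:R, n%:R] x)).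
  by apply/funext => x; ring.
have ii : intg N (\1_`[- n%:R, n%:R] : R -> R) by exact: intg_indic.
have i2 : intg N (fun x : R => x ^+ 2 * \1_`[- n%:R, n%:R] x).
  apply: (@intg_bnd _ _ _ _ _ (n%:R ^+ 2)); first exact: meas_indic.
  move=> x; rewrite indicE; have [xn|xn] := boolP (x \in `[- n%:R, n%:R]%classic).
    rewrite mulr1 ger0_norm ?sqr_ge0// -real_normK ?num_real//.
    by rewrite ler_pXn2r ?nnegrE//; move: xn; rewrite inE/= in_itv/= -ler_norml.
  by rewrite mulr0 normr0 sqr_ge0.
rewrite ExB//; last exact: intgZ.
rewrite ExZ// Ex_indic//.
set A := fine _; set B := \int[N]_x _ => h.
have -> : B = s ^+ 2 * (A - (A - (s ^+ 2)^-1 * B)) by field.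
by rewrite h; ring.
Qed.

Lemma normal_second_moment : intg N (fun x : R => x ^+ 2) /\ \int[N]_x (x ^+ 2) = s ^+ 2.
Proof.
have i2 (n : nat) : intg N (fun x : R => x ^+ 2 * \1_`[- n%:R, n%:R] x).
  apply: (@intg_bnd _ _ _ _ _ (n%:R ^+ 2)); first exact: meas_indic.
  move=> x; rewrite indicE; have [xn|xn] := boolP (x \in `[- n%:R, n%:R]%classic).
    rewrite mulr1 ger0_norm ?sqr_ge0// -real_normK ?num_real//.
    by rewrite ler_pXn2r ?nnegrE//; move: xn; rewrite inE/= in_itv/= -ler_norml.
  by rewrite mulr0 normr0 sqr_ge0.
have [ii _] : intg N (fun x : R => x ^+ 2) /\ \int[N]_x (x ^+ 2) <= s ^+ 2.
  apply: (@Ex_fatou _ _ _ N (fun n x => x ^+ 2 * \1_`[- n.+1%:R, n.+1%:R] x)).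
  - by move=> n; exact: i2.
  - by move=> n x; rewrite mulr_ge0 ?sqr_ge0// indicE.
  - by move=> x; have := @indic_cvg (fun x => x ^+ 2) x; rewrite -(cvg_shiftS _).
  - move=> n; rewrite second_truncated// ger_pMr//.
    apply: (@le_trans _ _ (fine (N `[- n.+1%:R, n.+1%:R]%classic))).
      by rewrite gerBl mulr_ge0// mulr_ge0// normal_pdf_ge0.
    rewrite -lee_fin fineK ?fin_num_measure//; exact: probability_le1.
split=> //.
have h1 : \int[N]_x (x ^+ 2 * \1_`[- n%:R, n%:R] x) @[n --> \oo] --> \int[N]_x (x ^+ 2).
  apply: (@Ex_dct _ _ _ N (fun n x => x ^+ 2 * \1_`[- n%:R, n%:R] x) (fun x : R => x ^+ 2) (fun x => `|x ^+ 2|)) => //.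
  - by move=> n; exact: meas_indic.
  - by move=> x; exact: (@indic_cvg (fun x => x ^+ 2)).
  - exact: intg_norm.
  - by move=> n x; exact: (@indic_le (fun x => x ^+ 2)).
have hP : fine (N `[- n%:R, n%:R]%classic) @[n --> \oo] --> (1 : R).
  rewrite -[X in _ --> X](Ex_cst N).
  rewrite (_ : (fun n => _) = fun n : nat => \int[N]_x (1 * \1_`[- n%:R, n%:R] x)).
    apply: (@Ex_dct _ _ _ N (fun n x => 1 * \1_`[- n%:R, n%:R] x) (fun=> 1) (fun=> 1)) => //.
    - by move=> n; exact: meas_indic.
    - by move=> x; exact: (@indic_cvg (fun=> 1)).
    - exact: intg_cst.
    - by move=> n x; apply: le_trans (@indic_le (fun=> 1) n x) _; rewrite normr1.
  by apply/funext => n; under [RHS]eq_Rintegral do rewrite mul1r; rewrite Ex_indic.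
have h2 : s ^+ 2 * (fine (N `[- n%:R, n%:R]%classic) - 2 * (n%:R * pdf n%:R))
    @[n --> \oo] --> s ^+ 2 * (1 - 2 * 0).
  by apply: cvgMl_tmp; apply: cvgB => //; apply: cvgMl_tmp; exact: cvg_mul_pdf.
rewrite mulr0 subr0 mulr1 in h2.
have h3 : \int[N]_x (x ^+ 2 * \1_`[- n%:R, n%:R] x) @[n --> \oo] --> s ^+ 2.
  apply: cvg_trans h2; apply: near_eq_cvg; near=> n; rewrite second_truncated//.
  by near: n; exact: nbhs_infty_gt.
exact: (cvg_unique (@Rhausdorff R) h1 h3).
Unshelve. all: by end_near. Qed.

Lemma normal_intg1 : intg N (fun x : R => x).
Proof. by apply: intg_sq1 => //; exact: normal_second_moment.1. Qed.

Lemma normal_mean : \int[N]_x x = 0.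
Proof.
have h : \int[N]_x ((- (s ^+ 2)^-1) * x) = 0.
  apply: (@normal_deriv0 _ pdf).
  - by move=> x; apply: cvgMl_tmp; exact: cvg_id.
  - exact: (intgZ _ normal_intg1).
  - move=> x; have d := is_derive_pdf x; apply: is_derive_eq; ring.
  - by move=> x; rewrite ger0_norm ?normal_pdf_ge0.
move: h; rewrite (ExZ _ normal_intg1) => /eqP; rewrite mulf_eq0 oppr_eq0 invr_eq0 gt_eqF//=.
by move/eqP.
Qed.

Let ccos a t : continuous (fun x : R => cos (t * x + a)).
Proof.
move=> x; apply: (continuous_comp (f := fun x => t * x + a)); last exact: continuous_cos.
by apply: cvgD; [apply: cvgMl_tmp; exact: cvg_id|exact: cvg_cst].
Qed.

Let csin a t : continuous (fun x : R => sin (t * x + a)).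
Proof.
move=> x; apply: (continuous_comp (f := fun x => t * x + a)); last exact: continuous_sin.
by apply: cvgD; [apply: cvgMl_tmp; exact: cvg_id|exact: cvg_cst].
Qed.

Let icos a t : intg N (fun x : R => cos (t * x + a)).
Proof.
apply: (@intg_bnd _ _ _ _ _ 1); first exact: continuous_measurable_fun.
by move=> x; rewrite ler_norml cos_geN1 cos_le1.
Qed.

Let ixsin a t : intg N (fun x : R => x * sin (t * x + a)).
Proof.
apply: (intg_le _ (intg_norm normal_intg1)).
  by apply: measurable_funM => //; exact: continuous_measurable_fun.
by move=> x; rewrite normrM ler_piMr// sin_max.
Qed.

(** Stein's identity, obtained by integrating the derivative of
[pdf x * sin (t * x + a)]. *)
Lemma normal_stein a t :
  \int[N]_x (x * sin (t * x + a)) = s ^+ 2 * t * \int[N]_x cos (t * x + a).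
Proof.
have h : \int[N]_x (t * cos (t * x + a) + (- (s ^+ 2)^-1) * (x * sin (t * x + a))) = 0.
  apply: (@normal_deriv0 _ (fun x => pdf x * sin (t * x + a))).
  - move=> x; apply: cvgD; first by apply: cvgMl_tmp; exact: ccos.
    by apply: cvgMl_tmp; apply: cvgM; [exact: cvg_id|exact: csin].
  - by apply: intgD; exact: intgZ.
  - move=> x; have d := is_derive_pdf x; apply: is_derive_eq.
    by rewrite /GRing.scale/=; field.
  - by move=> x; rewrite normrM ger0_norm ?normal_pdf_ge0// ler_piMr ?normal_pdf_ge0// sin_max.
move: h; rewrite ExD ?ExZ//; [|exact: intgZ|exact: intgZ].
set A := Rintegral _ _ _; set B := Rintegral _ _ _ => h.
have -> : B = s ^+ 2 * t * A - s ^+ 2 * (t * A + - (s ^+ 2)^-1 * B) by field.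
by rewrite h; ring.
Qed.

(** By Stein's identity the characteristic function solves [psi' t = - s ^+ 2 * t * psi t],
so that its product with [expR (s ^+ 2 * t ^+ 2 / 2)] is constant. *)
Lemma normal_cf a t :
  \int[N]_x cos (t * x + a) = expR (- (s ^+ 2 * t ^+ 2 / 2)) * cos a.
Proof.
pose psi t := \int[N]_x cos (t * x + a).
have dpsi (u : R) : is_derive u (1 : R) psi (- (s ^+ 2 * u * psi u)).
  have dcos (z y : R) : is_derive z (1 : R) (fun t : R => cos (t * y + a))
      (- (y * sin (z * y + a))).
    by apply: is_derive_eq; rewrite /GRing.scale/=; ring.
  have dv (z y : R) : derivable (fun t : R => cos (t * y + a)) z (1 : R).
    by have [] := dcos z y.
  have p1 (v y : R) : partial1of2 (fun t x : R => cos (t * x + a)) v y = - (y * sin (v * y + a)).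
    by rewrite partial1of2E; have [_ ->] := dcos v y.
  have uI : `]u - 1, u + 1[%classic u by rewrite /= in_itv/=; apply/andP; split; lra.
  have Gle (v y : R) : `|partial1of2 (fun t x : R => cos (t * x + a)) v y| <= `|y|.
    by rewrite p1 normrN normrM ler_piMr// sin_max.
  split.
    exact: (@derivable_under_integral _ _ _ N (fun t x : R => cos (t * x + a)) setT measurableT
     u _ _ uI (fun v _ => icos a v) (fun v y _ _ => dv v y) (fun y => `|y|)
     (fun y => normr_ge0 y) (intg_norm normal_intg1) (fun v y _ _ => Gle v y)).
  rewrite -derive1E (@differentiation_under_integral _ _ _ N (fun t x : R => cos (t * x + a)) setT measurableT
     u _ _ uI (fun v _ => icos a v) (fun v y _ _ => dv v y) (fun y => `|y|)
     (fun y => normr_ge0 y) (intg_norm normal_intg1) (fun v y _ _ => Gle v y)).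
  under eq_Rintegral do rewrite p1.
  by rewrite ExN ?normal_stein//; exact: ixsin.
have d0 (x : R) : is_derive x (1 : R) (fun t => psi t * expR (s ^+ 2 / 2 * t ^+ 2)) 0.
  by have d := dpsi x; apply: is_derive_eq; rewrite /GRing.scale/=; field.
have := is_derive_0_is_cst t 0 d0.
rewrite expr0n mulr0 expR0 mulr1.
have -> : psi 0 = cos a by rewrite /psi; under eq_Rintegral do rewrite mul0r add0r; rewrite Ex_cst.
by move=> <-; rewrite mulrCA (_ : s ^+ 2 * t ^+ 2 / 2 = s ^+ 2 / 2 * t ^+ 2) ?expRN ?mulVf ?mulr1 ?gt_eqF ?expR_gt0//; field.
Qed.

End normal_moments.

(** * Sigma-algebras generated by an independent family *)

Section family_sigma_algebra.
Context d (Omega : measurableType d) (R : realType) (P : probability Omega R).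
Context (I : choiceType) d1 (T : measurableType d1) (X : I -> {RV P >-> T}).
Hypothesis Xindep : mutually_independent P X.

Definition cylinder (s : seq I) (B : I -> set T) : set Omega :=
  \bigcap_(i in [set` s]) X i @^-1` B i.

(** Including the events that are cylinders up to a null set makes the generated
sigma-algebra complete, while the class stays closed under intersection. *)
Definition ae_cylinder (S : set I) : set (set Omega) := [set A | measurable A /\
  exists s B N, [/\ uniq s /\ [set` s] `<=` S, (forall i, measurable (B i)),
     measurable N /\ P N = 0%E & A `\` N = cylinder s B `\` N]].

Definition gen_by (S : set I) := g_sigma_algebraType (ae_cylinder S).

Lemma measurable_cylinder s B : (forall i, measurable (B i)) -> measurable (cylinder s B).
Proof.
move=> mB; apply: fin_bigcap_measurable; first exact: finite_seq.
by move=> i _; rewrite -[X in measurable X]setTI; exact: measurable_funP.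
Qed.

Lemma null_setD (A N : set Omega) : measurable A -> measurable N -> P N = 0%E ->
  P (A `\` N) = P A.
Proof.
move=> mA mN N0.
have PAN : P (A `&` N) = 0%E.
  by apply: measure_negligible; [exact: measurableI|exists N; split => // x []].
transitivity (P (A `\` N) + P (A `&` N))%E; first by rewrite PAN adde0.
exact/esym/measureDI.
Qed.

Lemma null_eq (A B N : set Omega) : measurable A -> measurable B ->
  measurable N -> P N = 0%E -> A `\` N = B `\` N -> P A = P B.
Proof. by move=> mA mB mN N0 AB; rewrite -(null_setD mA mN N0) AB null_setD. Qed.

Lemma ae_cylinder_measurable S : ae_cylinder S `<=` measurable.
Proof. by move=> A []. Qed.

Lemma cylinderI s1 s2 B1 B2 : cylinder s1 B1 `&` cylinder s2 B2 =
  cylinder (undup (s1 ++ s2)) (fun i => (if i \in s1 then B1 i else setT) `&`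
                                        (if i \in s2 then B2 i else setT)).
Proof.
apply/seteqP; split => w /=.
  move=> [h1 h2] i /=; rewrite mem_undup mem_cat => _; split.
    by case: ifP => // is1; exact: h1.
  by case: ifP => // is2; exact: h2.
move=> h; split => i /= si.
  by have [] := h i; rewrite /= ?mem_undup ?mem_cat ?si.
by have [] := h i; rewrite /= ?mem_undup ?mem_cat ?si ?orbT.
Qed.

Let mif (s : seq I) (B : I -> set T) i : (forall i, measurable (B i)) ->
  measurable (if i \in s then B i else setT).
Proof. by move=> mB; case: ifP. Qed.

Lemma ae_cylinder_setI S : setI_closed (ae_cylinder S).
Proof.
move=> A1 A2 [mA1 [s1 [B1 [N1 [[u1 S1] mB1 [mN1 N10] E1]]]]].
move=> [mA2 [s2 [B2 [N2 [[u2 S2] mB2 [mN2 N20] E2]]]]].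
split; first exact: measurableI.
exists (undup (s1 ++ s2)), (fun i => (if i \in s1 then B1 i else setT) `&`
                                        (if i \in s2 then B2 i else setT)), (N1 `|` N2).
split.
- split; first exact: undup_uniq.
  by move=> i /=; rewrite mem_undup mem_cat => /orP[]; [exact: S1|exact: S2].
- by move=> i; apply: measurableI; exact: mif.
- split; first exact: measurableU.
  by have := null_set_setU mN1 mN2 N10 N20.
- rewrite -cylinderI; apply/seteqP; split => w [[w1 w2] wN].
    have h1 : (A1 `\` N1) w by split => // h; apply: wN; left.
    have h2 : (A2 `\` N2) w by split => // h; apply: wN; right.
    by rewrite E1 in h1; rewrite E2 in h2; split => //; split; [case: h1|case: h2].
  have h1 : (cylinder s1 B1 `\` N1) w by split => // h; apply: wN; left.
  have h2 : (cylinder s2 B2 `\` N2) w by split => // h; apply: wN; right.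
  by rewrite -E1 in h1; rewrite -E2 in h2; split => //; split; [case: h1|case: h2].
Qed.

Lemma cylinder_indep s1 s2 B1 B2 : uniq s1 -> uniq s2 ->
  (forall i, i \in s1 -> i \notin s2) ->
  (forall i, measurable (B1 i)) -> (forall i, measurable (B2 i)) ->
  P (cylinder s1 B1 `&` cylinder s2 B2) = (P (cylinder s1 B1) * P (cylinder s2 B2))%E.
Proof.
move=> u1 u2 dis mB1 mB2.
have u12 : uniq (s1 ++ s2).
  by rewrite cat_uniq u1 u2 andbT; apply/hasPn => i i2; apply/negP => /dis; rewrite i2.
rewrite cylinderI undup_id// /cylinder Xindep//; last first.
  by move=> i; apply: measurableI; exact: mif.
rewrite big_cat/= !Xindep//; congr (_ * _)%E.
  rewrite big_seq [RHS]big_seq; apply: eq_bigr => i i1.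
  by rewrite i1 (negbTE (dis _ i1)) setIT.
rewrite big_seq [RHS]big_seq; apply: eq_bigr => i i2.
rewrite i2 ifF ?setTI//; apply/negP => /dis; by rewrite i2.
Qed.

Lemma ae_cylinder_indep S1 S2 A1 A2 : S1 `&` S2 = set0 ->
  ae_cylinder S1 A1 -> ae_cylinder S2 A2 -> P (A1 `&` A2) = (P A1 * P A2)%E.
Proof.
move=> S12 A1S A2S; have mA12 : measurable (A1 `&` A2).
  by apply: measurableI; [case: A1S|case: A2S].
case: A1S => [mA1 [s1 [B1 [N1 [[u1 S1s] mB1 [mN1 N10] E1]]]]].
case: A2S => [mA2 [s2 [B2 [N2 [[u2 S2s] mB2 [mN2 N20] E2]]]]].
have mc1 := measurable_cylinder s1 mB1; have mc2 := measurable_cylinder s2 mB2.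
rewrite (null_eq mA1 mc1 mN1 N10 E1) (null_eq mA2 mc2 mN2 N20 E2) -cylinder_indep//.
- apply: (@null_eq _ _ (N1 `|` N2)) => //.
  + exact: measurableI.
  + exact: measurableU.
  + exact: (null_set_setU mN1 mN2 N10 N20).
  + apply/seteqP; split => w [[w1 w2] wN].
      have h1 : (A1 `\` N1) w by split => // h; apply: wN; left.
      have h2 : (A2 `\` N2) w by split => // h; apply: wN; right.
      by rewrite E1 in h1; rewrite E2 in h2; split => //; split; [case: h1|case: h2].
    have h1 : (cylinder s1 B1 `\` N1) w by split => // h; apply: wN; left.
    have h2 : (cylinder s2 B2 `\` N2) w by split => // h; apply: wN; right.
    by rewrite -E1 in h1; rewrite -E2 in h2; split => //; split; [case: h1|case: h2].
- move=> i i1; apply/negP => i2.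
  have : (S1 `&` S2) i by split; [exact: S1s|exact: S2s].
  by rewrite S12.
Qed.

Lemma cylinder_nil B : cylinder [::] B = setT.
Proof. by apply/seteqP; split. Qed.

Lemma ae_cylinderT S : ae_cylinder S setT.
Proof. by split => //; exists [::], (fun=> setT), set0; rewrite cylinder_nil. Qed.

Lemma gen_by_measurable S A : <<s ae_cylinder S >> A -> measurable A.
Proof. by apply: smallest_sub; [exact: sigma_algebra_measurable|exact: ae_cylinder_measurable]. Qed.

Let ae_cylinder_gen_indep S1 S2 A1 A2 : S1 `&` S2 = set0 ->
  <<s ae_cylinder S1 >> A1 -> ae_cylinder S2 A2 -> P (A1 `&` A2) = (P A1 * P A2)%E.
Proof.
move=> S12 gA1 A2S; have mA2 := ae_cylinder_measurable A2S.
have r0 : 0 <= fine (P A2) by apply: fine_ge0.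
have scE A : mscale (NngNum r0) P A = (P A2 * P A)%E.
  transitivity ((fine (P A2))%:E * P A)%E; first by [].
  by rewrite (@fineK _ (P A2)) ?fin_num_measure.
have key := @g_sigma_algebra_measure_unique _ R Omega (ae_cylinder S1)
  (@ae_cylinder_measurable S1) (fun=> setT) (fun=> ae_cylinderT S1) _
  (mrestr P mA2) (mscale (NngNum r0) P) (@ae_cylinder_setI S1) _ _ A1 gA1.
apply: (eq_trans (key _ _ _)); last first.
- by apply: (eq_trans (scE _)); rewrite muleC.
- move=> k; rewrite /= /mrestr setTI.
  exact: le_lt_trans (probability_le1 P mA2) (ltry _).
- move=> A AS; apply: (eq_trans _ (esym (scE A))); rewrite muleC -[LHS]/(P (A `&` A2)).
  exact: (ae_cylinder_indep S12).
- by apply/seteqP; split => // w _; exists 0%N.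
Qed.

(** The pi-lambda theorem, applied in each argument in turn: with the other event
fixed, both sides are finite measures that agree on the generating cylinders. *)
Lemma gen_by_indep S1 S2 A1 A2 : S1 `&` S2 = set0 ->
  <<s ae_cylinder S1 >> A1 -> <<s ae_cylinder S2 >> A2 -> P (A1 `&` A2) = (P A1 * P A2)%E.
Proof.
move=> S12 gA1 gA2; have mA1 := gen_by_measurable gA1.
have r0 : 0 <= fine (P A1) by apply: fine_ge0.
have scE A : mscale (NngNum r0) P A = (P A1 * P A)%E.
  transitivity ((fine (P A1))%:E * P A)%E; first by [].
  by rewrite (@fineK _ (P A1)) ?fin_num_measure.
have key := @g_sigma_algebra_measure_unique _ R Omega (ae_cylinder S2)
  (@ae_cylinder_measurable S2) (fun=> setT) (fun=> ae_cylinderT S2) _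
  (mrestr P mA1) (mscale (NngNum r0) P) (@ae_cylinder_setI S2) _ _ A2 gA2.
rewrite setIC; apply: (eq_trans (key _ _ _)); last first.
- exact: scE.
- move=> k; rewrite /= /mrestr setTI.
  exact: le_lt_trans (probability_le1 P mA1) (ltry _).
- move=> A AS; apply: (eq_trans _ (esym (scE A))); rewrite -[LHS]/(P (A `&` A1)) setIC.
  exact: (ae_cylinder_gen_indep S12).
- by apply/seteqP; split => // w _; exists 0%N.
Qed.

Section measurability.
Context d' (U : measurableType d').
Implicit Types f g : Omega -> U.

Definition gen_meas S f := measurable_fun setT (f : gen_by S -> U).

Lemma gen_meas_measurable S f : gen_meas S f -> measurable_fun setT f.
Proof.
move=> mf _ B mB; rewrite setTI; apply: (@gen_by_measurable S).
by have := mf measurableT B mB; rewrite setTI.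
Qed.

Lemma gen_meas_sub S1 S2 f : S1 `<=` S2 -> gen_meas S1 f -> gen_meas S2 f.
Proof.
move=> S12 mf _ B mB; have := mf measurableT B mB.
apply: sub_sigma_algebra2 => A [mA [s [C [N [[us sS] mC mN E]]]]].
by split => //; exists s, C, N; split => //; split => // i /sS /S12.
Qed.

Lemma gen_by_null S (A : set Omega) : measurable A -> P A = 0%E -> <<s ae_cylinder S >> A.
Proof.
move=> mA A0; have : (@measurable _ (gen_by S)) (~` ~` A); last by rewrite setCK.
apply: measurableC; apply: sub_sigma_algebra; split; first exact: measurableC.
exists [::], (fun=> setT), A; rewrite cylinder_nil; split => //.
by apply/seteqP; split => w [].
Qed.

Lemma gen_meas_ae S f g : gen_meas S f -> measurable_fun setT g ->
  {ae P, forall w, f w = g w} -> gen_meas S g.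
Proof.
move=> mf mg [N [mN N0 fgN]] _ B mB; rewrite setTI.
have gN : (@measurable _ (gen_by S)) N by exact: gen_by_null.
rewrite (_ : g @^-1` B = (f @^-1` B `\` N) `|` (g @^-1` B `&` N)); last first.
  have fg w : ~ N w -> f w = g w.
    by move=> wN; apply: contrapT => fgw; apply: wN; exact: fgN.
  apply/seteqP; split => w /=.
    by move=> gB; have [wN|wN] := pselect (N w); [right|left; rewrite fg].
  by move=> [[fB wN]|[]//]; rewrite -fg.
apply: measurableU.
  apply: measurableD => //.
  by have := mf measurableT B mB; rewrite setTI.
apply: gen_by_null.
  by apply: measurableI => //; have := mg measurableT B mB; rewrite setTI.
apply: measure_negligible; last by exists N; split => // x [].
by apply: measurableI => //; have := mg measurableT B mB; rewrite setTI.
Qed.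

End measurability.

Lemma gen_meas_self S i : S i -> gen_meas S (X i).
Proof.
move=> Si _ B mB; rewrite setTI; apply: sub_sigma_algebra.
have mXB : measurable (X i @^-1` B).
  by rewrite -[X in measurable X]setTI; exact: measurable_funP.
split => //; exists [:: i], (fun=> B), set0; split => //.
  by split => // j /=; rewrite inE => /eqP ->.
rewrite /cylinder; congr (_ `\` _); apply/seteqP; split => w /=.
  by move=> h j /=; rewrite inE => /eqP ->.
by apply; rewrite /= inE.
Qed.

(** The sigma-algebra contains all null events, which absorbs the set where the limit
fails. *)
Lemma gen_meas_cvg S (f : nat -> Omega -> R) (g : Omega -> R) :
  (forall n, gen_meas S (f n)) -> measurable_fun setT g ->
  {ae P, forall w, f n w @[n --> \oo] --> g w} -> gen_meas S g.
Proof.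
move=> mf mg [N [mN N0 fgN]].
have gN : (@measurable _ (gen_by S)) N by exact: gen_by_null.
have fg w : ~ N w -> f n w @[n --> \oo] --> g w.
  by move=> wN; apply: contrapT => fgw; apply: wN; exact: fgN.
have m1 : measurable_fun [set: gen_by S] (\1_(~` N) : Omega -> R).
  by apply: measurable_indic; exact: measurableC.
apply: (@gen_meas_ae _ _ _ (fun w => g w * \1_(~` N) w)) => //.
  apply: (@measurable_fun_cvg _ (gen_by S) _ _ (fun n w => f n w * \1_(~` N) w)).
    by move=> n; apply: measurable_funM => //; exact: mf.
  move=> w _; have [wN|wN] := pselect (N w).
    rewrite indicE memNset; last by move=> /(_ wN).
    rewrite mulr0; under eq_fun do rewrite mulr0; exact: cvg_cst.
  rewrite indicE mem_set// mulr1; under eq_fun do rewrite mulr1; exact: fg.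
exists N; split => // w; apply: contra_notP => wN.
by rewrite /= indicE mem_set ?mulr1.
Qed.

Lemma Ex_gen_indep S1 S2 (f g : Omega -> R) : S1 `&` S2 = set0 ->
  gen_meas S1 f -> gen_meas S2 g -> intg P f -> intg P g ->
  intg P (fun w => f w * g w) /\
  \int[P]_w (f w * g w) = \int[P]_w f w * \int[P]_w g w.
Proof.
move=> S12 mf mg; apply: Ex_indep.
- exact: gen_meas_measurable mf.
- exact: gen_meas_measurable mg.
- move=> A B mA mB; apply: (gen_by_indep S12).
    by have := mf measurableT A mA; rewrite setTI.
  by have := mg measurableT B mB; rewrite setTI.
Qed.

End family_sigma_algebra.

(** * Binary digits of a uniform number *)

Section binary_digits.
Context (R : realType).

Let measurable_idR : @measurable_fun _ _ (measurableTypeR R) R setT id.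
Proof. exact: measurable_id. Qed.

(** [measurableTypeR R], which carries the Lebesgue measure, has the Borel sets of
[R] under another display; pushing forward along the identity moves a law from
one to the other. *)
Definition idR : {mfun measurableTypeR R >-> R} :=
  @mfun_Sub _ _ (measurableTypeR R) R id (mem_set measurable_idR).

Definition unif : probability R R := distribution (uniform_prob (@ltr01 R)) idR.

Lemma unifE (U : set R) : measurable U -> unif U = lebesgue_measure (U `&` `[0, 1[%classic).
Proof.
move=> mU; rewrite -[LHS]/(\int[lebesgue_measure]_(x in U) (uniform_pdf 0 1 x)%:E)%E.
rewrite integral_uniform_pdf (eq_integral (fun=> 1%E)); last first.
  by move=> x; rewrite inE/= in_itv/= /uniform_pdf => -[_ ->]; rewrite subr0 invr1.
rewrite integral_cst ?mul1e; last exact: measurableI.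
rewrite (_ : U `&` `[0, 1]%classic = (U `&` `[0, 1[%classic) `|` (U `&` [set 1])).
  rewrite measureU//; [|exact: measurableI|exact: measurableI|].
    rewrite [X in (_ + X)%E](_ : _ = 0%E) ?adde0//.
    apply: measure_negligible; first exact: measurableI.
    by exists [set 1]; split; [exact: measurable_set1|exact: lebesgue_measure_set1|move=> x []].
  by apply/seteqP; split => // x /= [[_ +] [_ x1]]; rewrite in_itv/= x1 ltxx andbF.
rewrite -setIUr; congr (_ `&` _); apply/seteqP; split => x /=; rewrite !in_itv/=.
  move=> /andP[x0 x1]; have [x1'|x1'] := ltP x 1; first by left; rewrite x0.
  by right; apply/eqP; rewrite eq_le x1.
by move=> [/andP[-> /ltW ->]//|->]; rewrite ler01 lexx.
Qed.

Definition clamp (y : R) : R := Num.min 1 (Num.max 0 y).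

Lemma clampP y : [\/ y <= 0 /\ clamp y = 0, (0 < y < 1) /\ clamp y = y |
  1 <= y /\ clamp y = 1].
Proof.
rewrite /clamp; have [y0|y0] := leP y 0; first by constructor 1; rewrite min_r.
by have [y1|y1] := leP 1 y; [constructor 3|constructor 2]; rewrite ?y0.
Qed.

Lemma unif_ray y : unif `]-oo, y[%classic = (clamp y)%:E.
Proof.
rewrite unifE// /clamp; have [y0|y0] := leP y 0.
  rewrite min_r// (_ : _ `&` _ = set0) ?measure0//; apply/seteqP; split => // x /=.
  by rewrite !in_itv/= => -[? /andP[? ?]]; lra.
have [y1|y1] := leP 1 y.
  rewrite (_ : _ `&` _ = `[0, 1[%classic).
    by rewrite lebesgue_measure_itv/= lte_fin ltr01 sube0.
  apply/seteqP; split => x /=; rewrite !in_itv/=; first by case.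
  by move=> /andP[? ?]; split; [lra|apply/andP].
rewrite (_ : _ `&` _ = `[0, y[%classic).
  by rewrite lebesgue_measure_itv/= lte_fin y0 sube0.
apply/seteqP; split => x /=; rewrite !in_itv/=.
  by move=> [? /andP[? ?]]; apply/andP.
by move=> /andP[? ?]; split => //; apply/andP; split; lra.
Qed.

Definition half (u : R) : bool := 2^-1 <= u.
Definition doubling (u : R) : R := if half u then 2 * u - 1 else 2 * u.

Lemma measurable_half : measurable_fun setT half.
Proof.
apply: (measurable_fun_bool true); rewrite setTI.
rewrite (_ : _ @^-1` _ = `[2^-1, +oo[%classic)//.
by apply/seteqP; split => x /=; rewrite in_itv/= andbT.
Qed.

Lemma measurable_doubling : measurable_fun setT doubling.
Proof.
by apply: measurable_fun_ifT; [exact: measurable_half|apply: measurable_funB => //;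
  apply: measurable_funM|apply: measurable_funM].
Qed.

Let halfset b : set R := half @^-1` [set b].

Let mhalfset b : measurable (halfset b).
Proof. by rewrite -[X in measurable X]setTI; exact: measurable_half. Qed.

Let branch (b : bool) (u : R) : R := (u + b%:R) / 2.

Let mbranch b : measurable_fun setT (branch b).
Proof. by apply: measurable_funM => //; apply: measurable_funD. Qed.

Let branchF b : {mfun R >-> R} := mfun_Sub (mem_set (mbranch b)).

Let unif_branch b A : measurable A ->
  unif (A `&` halfset b) = (2^-1%:E * unif (branch b @^-1` A))%E.
Proof.
move=> mA; have h0 : 0 <= 2^-1 :> R by [].
have fin (B : set R) : measurable B -> unif B \is a fin_num by move=> mB; exact: fin_num_measure.
apply: (@measure_ray_unique R (mrestr unif (mhalfset b))
  (mscale (NngNum h0) (distribution unif (branchF b)))) mA => c; last first.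
  apply: (@le_lt_trans _ _ 1%E); last exact: ltry.
  by apply: probability_le1; exact: measurableI.
rewrite -[RHS]/(2^-1%:E * unif (branch b @^-1` `]-oo, c[%classic))%E.
rewrite (_ : branch b @^-1` _ = `]-oo, 2 * c - b%:R[%classic); last first.
  by apply/seteqP; split => x /=; rewrite !in_itv/= /branch => ?; lra.
rewrite unif_ray -EFinM -[LHS]/(unif (`]-oo, c[ `&` halfset b)).
have E0 : unif (`]-oo, c[ `&` halfset false) = (clamp (Num.min c 2^-1))%:E.
  rewrite -unif_ray; congr (unif _); apply/seteqP; split => x /=; rewrite !in_itv/= lt_min.
    by move=> [-> /negbT]; rewrite /half -ltNge.
  by move=> /andP[? xh]; split => //; apply/negbTE; rewrite /half -ltNge.
case: b.
  have : unif `]-oo, c[%classic = (unif (`]-oo, c[ `&` halfset false) + unif (`]-oo, c[ `&` halfset true))%E.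
    rewrite -measureU//.
    - congr (unif _); rewrite -setIUr; apply/seteqP; split => x //=; last by case.
      by move=> xc; split => //; rewrite /halfset /=; case: (half x); [right|left].
    - exact: measurableI.
    - exact: measurableI.
    - by apply/seteqP; split => // x [[_ h1] [_ h2]]; move: h1; rewrite /halfset/= h2.
  rewrite E0 unif_ray => h.
  have := fin _ (measurableI _ _ (measurable_itv `]-oo, c[) (mhalfset true)).
  case: (unif _) h => //= r [h] _; congr EFin.
  have b1 : true%:R = 1 :> R by [].
  move: h; rewrite b1.
  have := clampP c; have := clampP (2 * c - 1); have := clampP (Num.min c 2^-1).
  by have [?|?] := leP c 2^-1; do 3 (case=> [[? ?]|[/andP[? ?] ?]|[? ?]]); lra.
rewrite E0; congr EFin; have b0 : false%:R = 0 :> R by [].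
rewrite b0; have := clampP (2 * c - 0); have := clampP (Num.min c 2^-1).
by have [?|?] := leP c 2^-1; do 2 (case=> [[? ?]|[/andP[? ?] ?]|[? ?]]); lra.
Qed.

(** On each half of the unit interval, doubling inverts the affine branch
[u |-> (u + b) / 2], which scales lengths by one half. *)
Lemma unif_half_doubling b B : measurable B ->
  unif (half @^-1` [set b] `&` doubling @^-1` B) = (2^-1%:E * unif B)%E.
Proof.
move=> mB; have mdB : measurable (doubling @^-1` B).
  by rewrite -[X in measurable X]setTI; exact: measurable_doubling.
rewrite setIC unif_branch//; congr (_ * _)%E.
have mbB : measurable (branch b @^-1` (doubling @^-1` B)).
  by rewrite -[X in measurable X]setTI; exact: mbranch.
rewrite !unifE//; congr lebesgue_measure; apply/seteqP.
have bE b' x : 0 <= x < 1 -> doubling (branch b' x) = x.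
  move=> /andP[x0 x1]; rewrite /doubling /half /branch.
  by case: b'; rewrite ?mulr1n ?mulr0n; case: ifPn; rewrite -?ltNge => ?; lra.
split=> x [Bx xi]; split=> //; have := bE b x; move: (xi); rewrite /= in_itv/= => h /(_ h) e.
  by move: Bx; rewrite /preimage/= e.
by rewrite /preimage/= e.
Qed.

End binary_digits.

Section bits.
Context (R : realType).
Local Notation unif := (unif R).

Definition bit k (u : R) : bool := half (iter k (@doubling R) u).

Lemma measurable_bit k : measurable_fun setT (bit k).
Proof.
apply: (measurableT_comp (@measurable_half R)).
elim: k => [|k IH]; first exact: measurable_id.
exact: (measurableT_comp (@measurable_doubling R) IH).
Qed.

Definition bitRV k : {RV unif >-> bool} := mfun_Sub (mem_set (measurable_bit k)).

Let mpre d d' (T : measurableType d) (T' : measurableType d') (f : T -> T') (A : set T') :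
  measurable_fun setT f -> measurable A -> measurable (f @^-1` A).
Proof. by move=> mf mA; rewrite -[X in measurable X]setTI; exact: mf. Qed.

Let nu (A : set bool) : \bar R := unif (@half R @^-1` A).

Let mh (A : set bool) : measurable (@half R @^-1` A).
Proof. by apply: mpre => //; exact: measurable_half. Qed.

Let split_half (X : set R) : measurable X ->
  unif X = (unif (@half R @^-1` [set true] `&` X) + unif (@half R @^-1` [set false] `&` X))%E.
Proof.
move=> mX; rewrite -measureU.
- congr (unif _); rewrite -setIUl; apply/seteqP; split => x; last by case.
  by move=> Xx; split => //=; case: (half x); [left|right].
- exact: (measurableI _ _ (mh _) mX).
- exact: (measurableI _ _ (mh _) mX).
- by apply/seteqP; split => // x [[/= -> _] []].
Qed.

Let half_doubling A B : measurable B ->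
  unif (@half R @^-1` A `&` @doubling R @^-1` B) = (nu A * unif B)%E.
Proof.
move=> mB; have mdB : measurable (@doubling R @^-1` B).
  by apply: mpre => //; exact: measurable_doubling.
have key (B' : set R) : measurable B' -> unif (@half R @^-1` A `&` @doubling R @^-1` B') =
    (((if true \in A then 2^-1 else 0) + (if false \in A then 2^-1 else 0))%:E * unif B')%E.
  move=> mB'; have mdB' : measurable (@doubling R @^-1` B').
    by apply: mpre => //; exact: measurable_doubling.
  have aux b : unif (@half R @^-1` [set b] `&` (@half R @^-1` A `&` @doubling R @^-1` B')) =
      ((if b \in A then 2^-1 else 0)%:E * unif B')%E.
    have [bA|bA] := boolP (b \in A).
      rewrite setIA [X in X `&` _](_ : _ = @half R @^-1` [set b]) ?unif_half_doubling//.
      by apply/seteqP; split => x /=; [case|move=> ->; split => //; exact: set_mem].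
    rewrite mul0e (_ : _ `&` _ = set0) ?measure0//; apply/seteqP; split => // x /= [-> [Ab _]].
    by rewrite (mem_set Ab) in bA.
  rewrite split_half; last exact: (measurableI _ _ (mh A) mdB').
  by rewrite !aux EFinD ge0_muleDl// lee_fin; case: ifP.
rewrite key//; congr (_ * _)%E.
have := key setT measurableT; rewrite preimage_setT setIT -/(nu A) => ->.
by rewrite [X in (_ * X)%E]probability_setT mule1.
Qed.

Let doubling_inv B : measurable B -> unif (@doubling R @^-1` B) = unif B.
Proof.
move=> mB; have := @half_doubling setT B mB; rewrite preimage_setT setTI => ->.
by rewrite /nu preimage_setT [X in (X * _)%E]probability_setT mul1e.
Qed.

Let unif_bit k A : unif (bit k @^-1` A) = nu A.
Proof.
elim: k => [//|k IH]; rewrite -IH -[RHS]doubling_inv; last by apply: mpre => //; exact: measurable_bit.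
by congr (unif _); apply/funext => u; rewrite /preimage /bit /= -iterSr.
Qed.

Lemma unif_bit_true k : unif (bit k @^-1` [set true]) = 2^-1%:E.
Proof.
rewrite unif_bit /nu; have := @unif_half_doubling R true setT measurableT.
by rewrite preimage_setT setIT => ->; rewrite [X in (_ * X)%E]probability_setT mule1.
Qed.

Let prefix n (A : nat -> set bool) : set R := [set u | forall i, (i < n)%N -> A i (bit i u)].

Let mprefix n A : measurable (prefix n A).
Proof.
rewrite (_ : prefix n A = \bigcap_(i in `I_n) bit i @^-1` A i).
  by apply: fin_bigcap_measurable => // i _; apply: mpre => //; exact: measurable_bit.
by apply/seteqP; split.
Qed.

Let unif_prefix n A : unif (prefix n A) = (\prod_(0 <= i < n) nu (A i))%E.
Proof.
elim: n A => [|n IH] A.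
  rewrite big_geq// (_ : prefix 0 A = setT); first exact: probability_setT.
  by apply/seteqP; split.
rewrite big_nat_recl//= -IH -half_doubling//; congr (unif _).
apply/seteqP; split => u.
  move=> h; split; first exact: (h 0%N).
  by move=> i im; have := h i.+1 im; rewrite /bit iterSr.
by move=> [h0 h] [|i] // im; have := h i im; rewrite /bit iterSr.
Qed.

(** A finite subfamily is a prefix with trivial conditions added, and a prefix is
resolved one digit at a time by [unif_half_doubling]. *)
Lemma bits_independent : mutually_independent unif bitRV.
Proof.
move=> s A us mA.
have [n sn] : exists n, forall i, i \in s -> (i < n)%N.
  exists (\max_(i <- s) i).+1 => i si; rewrite ltnS.
  exact: (@leq_bigmax_seq _ s xpredT id).
rewrite (_ : \bigcap_(i in _) _ = prefix n (fun i => if i \in s then A i else setT)).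
  rewrite unif_prefix (eq_bigr (fun i => if i \in s then nu (A i) else 1%E)); last first.
    by move=> i _; case: ifP => // _; rewrite /nu preimage_setT; exact: probability_setT.
  rewrite -big_mkcond/= -big_filter; under [RHS]eq_bigr do rewrite unif_bit.
  apply: perm_big; apply: uniq_perm => //; first by rewrite filter_uniq// iota_uniq.
  by move=> i; rewrite mem_filter mem_index_iota/=; case: (boolP (i \in s)) => //= /sn ->.
by apply/seteqP; split => u /= h i /=; [case: ifP => // is_ _; exact: h|move=> si;
  have := h i (sn i si); rewrite si].
Qed.

Section rows.
Variable sigma : nat -> nat.
Hypothesis sigma_inj : injective sigma.

Definition row_term (u : R) k : R := (bit (sigma k) u)%:R / 2 ^+ k.+1.
(** The number whose binary digits are the digits of [u] at the positions [sigma k]. *)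
Definition row_sum (u : R) : R := limn (series (row_term u)).

Lemma row_term_ge0 u k : 0 <= row_term u k.
Proof. by rewrite divr_ge0// exprn_ge0. Qed.

Lemma row_series_le1 u n : series (row_term u) n <= 1 - (2 ^+ n)^-1.
Proof.
rewrite /series/=; elim: n => [|n IH]; first by rewrite big_geq// expr0 invr1 subrr.
rewrite big_nat_recr//=.
have : row_term u n <= (2 ^+ n.+1)^-1.
  rewrite /row_term -[leRHS]mul1r ler_wpM2r ?invr_ge0 ?exprn_ge0//.
  by case: (bit _ _).
have e : (2 ^+ n)^-1 = 2 * (2 ^+ n.+1)^-1 :> R by rewrite exprS; field; rewrite expf_neq0.
by move: IH; rewrite e; lra.
Qed.

Lemma row_series01 u n : 0 <= series (row_term u) n <= 1.
Proof.
rewrite sumr_ge0/=; last by move=> k _; exact: row_term_ge0.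
by apply: le_trans (row_series_le1 u n) _; rewrite gerBl invr_ge0 exprn_ge0.
Qed.

Lemma row_cvg u : series (row_term u) @ \oo --> row_sum u.
Proof.
apply: nondecreasing_is_cvgn.
  by apply: nondecreasing_series => k _ _; exact: row_term_ge0.
by exists 1 => _ [n _ <-]; have /andP[] := row_series01 u n.
Qed.

Lemma row_sum01 u : 0 <= row_sum u <= 1.
Proof.
have c := @row_cvg u; apply/andP; split.
  by apply: (ler_cvg_to (cvg_cst 0) c); apply: nearW => n; have /andP[] := row_series01 u n.
by apply: limr_le; [exact: cvgP c|apply: nearW => n; have /andP[] := row_series01 u n].
Qed.

Lemma gen_term k : gen_meas bitRV [set sigma k] (row_term ^~ k).
Proof.
have h : gen_meas bitRV [set sigma k] (bitRV (sigma k)) by exact: gen_meas_self.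
have mb : measurable_fun [set: bool] (fun b : bool => (b%:R : R)) by [].
have h2 := measurableT_comp mb h.
exact: (measurable_funM h2 (measurable_cst _)).
Qed.

Lemma gen_series n : gen_meas bitRV (sigma @` `I_n) (fun u => series (row_term u) n).
Proof.
elim: n => [|n IH].
  rewrite (_ : (fun u => _) = cst 0); first exact: measurable_cst.
  by apply/funext => u; rewrite /series/= big_geq.
rewrite (_ : (fun u => _) = (fun u => series (row_term u) n + row_term u n)); last first.
  by apply/funext => u; rewrite /series/= big_nat_recr.
have h1 : gen_meas bitRV (sigma @` `I_n.+1) (fun u => series (row_term u) n).
  by apply: (gen_meas_sub _ IH) => _ [k kn <-]; exists k => //; exact: ltnW.
have h2 : gen_meas bitRV (sigma @` `I_n.+1) (row_term ^~ n).
  have sub : [set sigma n] `<=` sigma @` `I_n.+1 by move=> _ ->; exists n => /=.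
  exact: (gen_meas_sub sub (@gen_term n)).
exact: (measurable_funD h1 h2).
Qed.

Lemma gen_row : gen_meas bitRV (range sigma) row_sum.
Proof.
apply: (@measurable_fun_cvg _ (gen_by bitRV (range sigma)) _ _ (fun n u => series (row_term u) n)).
  by move=> n; apply: (gen_meas_sub _ (@gen_series n)) => _ [k _ <-]; exists k.
by move=> u _; exact: row_cvg.
Qed.

Lemma measurable_row : measurable_fun setT row_sum.
Proof. exact: gen_meas_measurable gen_row. Qed.

End rows.
End bits.

Section row_law.
Context (R : realType).
Local Notation unif := (unif R).

Let Sn (sigma : nat -> nat) n (u : R) : R := series (row_term sigma u) n.

Let mSn sigma n : measurable_fun setT (Sn sigma n).
Proof. exact: gen_meas_measurable (@gen_series R sigma n). Qed.

Let mcos (f : R -> R) t a : measurable_fun setT f -> measurable_fun setT (fun u => cos (f u * t + a)).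
Proof.
move=> mf; apply: measurable_cosf.
by apply: measurable_funD => //; apply: measurable_funM.
Qed.

Let icos (f : R -> R) t a : measurable_fun setT f -> intg unif (fun u => cos (f u * t + a)).
Proof.
by move=> mf; apply: intg_cos; apply: measurable_funD => //; apply: measurable_funM.
Qed.

Let Ex_bit k : intg unif (fun u : R => (bit k u)%:R : R) /\ \int[unif]_u (bit k u)%:R = 2^-1 :> R.
Proof.
have mb : measurable (@bit R k @^-1` [set true]).
  by rewrite -[X in measurable X]setTI; exact: measurable_bit.
have -> : (fun u : R => (bit k u)%:R : R) = \1_(@bit R k @^-1` [set true]).
  apply/funext => u; rewrite indicE; case: (boolP (bit k u)) => h.
    by rewrite mem_set.
  by rewrite memNset//= => e; rewrite e in h.
by split; [exact: intg_indic|rewrite Ex_indic// unif_bit_true].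
Qed.

Let cf_step sigma (sigma_inj : injective sigma) n t a :
  \int[unif]_u cos (Sn sigma n.+1 u * t + a) =
  2^-1 * (\int[unif]_u cos (Sn sigma n u * t + a) +
          \int[unif]_u cos (Sn sigma n u * t + (a + t / 2 ^+ n.+1))).
Proof.
pose b (u : R) : R := (bit (sigma n) u)%:R.
have [ib Eb] := Ex_bit (sigma n).
have dis : sigma @` `I_n `&` [set sigma n] = set0.
  by apply/seteqP; split => // _ [[k kn <-] /= /sigma_inj kE]; rewrite kE /= ltnn in kn.
have gb : gen_meas (@bitRV R) [set sigma n] b.
  have h : gen_meas (@bitRV R) [set sigma n] (bitRV R (sigma n)) by exact: gen_meas_self.
  have mb : measurable_fun [set: bool] (fun b : bool => (b%:R : R)) by [].
  exact: measurableT_comp mb h.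
have key c : intg unif (fun u => cos (Sn sigma n u * t + c) * b u) /\
    \int[unif]_u (cos (Sn sigma n u * t + c) * b u) = \int[unif]_u cos (Sn sigma n u * t + c) * 2^-1.
  have mc : measurable_fun [set: R] (fun x : R => cos (x * t + c)) by exact: mcos.
  have gc : gen_meas (@bitRV R) (sigma @` `I_n) (fun u => cos (Sn sigma n u * t + c)).
    exact: (measurableT_comp mc (@gen_series R sigma n)).
  have := Ex_gen_indep (@bits_independent R) dis gc gb (icos t c (mSn sigma n)) ib.
  by rewrite Eb.
(* The new bit b adds b * t / 2 ^+ n.+1 to the phase. *)
have [i1 E1] := key a; have [i2 E2] := key (a + t / 2 ^+ n.+1).
rewrite (_ : (fun u => cos (Sn sigma n.+1 u * t + a)) = fun u =>
   (cos (Sn sigma n u * t + a) - cos (Sn sigma n u * t + a) * b u) +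
   cos (Sn sigma n u * t + (a + t / 2 ^+ n.+1)) * b u); last first.
  apply/funext => u; rewrite /Sn {1}/series/= big_nat_recr//= -/(series _ n) /b /row_term.
  case: (bit (sigma n) u); rewrite /= ?mulr1 ?mulr0 ?subrr ?add0r ?mul0r ?addr0 ?subr0//.
  by congr cos; rewrite /series/=; ring.
have i0 := icos t a (mSn sigma n).
rewrite (ExD (intgB i0 i1) i2) (ExB i0 i1) E1 E2.
by field.
Qed.

Let cf_eq sigma (sigma_inj : injective sigma) n t a :
  \int[unif]_u cos (Sn sigma n u * t + a) = \int[unif]_u cos (Sn id n u * t + a).
Proof.
elim: n a => [|n IH] a; last by rewrite !cf_step// !IH.
by apply: eq_Rintegral => u _; rewrite /Sn /series/= !big_geq.
Qed.

Let row_cf sigma (sigma_inj : injective sigma) t a :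
  \int[unif]_u cos (row_sum sigma u * t + a) = \int[unif]_u cos (row_sum id u * t + a).
Proof.
have lim s : \int[unif]_u cos (Sn s n u * t + a) @[n --> \oo] -->
    \int[unif]_u cos (row_sum s u * t + a).
  apply: (@Ex_dct _ _ _ unif (fun n u => cos (Sn s n u * t + a)) _ (fun=> 1)).
  - by move=> n; exact: mcos.
  - move=> u; apply: (cvg_comp (fun n => Sn s n u * t + a) cos); last exact: continuous_cos.
    by apply: cvgD; [apply: cvgMr_tmp; exact: row_cvg|exact: cvg_cst].
  - exact: intg_cst.
  - by move=> n u; rewrite ler_norml cos_geN1 cos_le1.
have h1 := lim sigma; have h2 := lim id.
rewrite (_ : (fun n => _) = (fun n => \int[unif]_u cos (Sn id n u * t + a))) in h1.
  exact: (cvg_unique (@Rhausdorff R) h1 h2).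
by apply/funext => n; exact: cf_eq.
Qed.

Let iter_doubling01 n (u : R) : 0 <= u < 1 -> 0 <= iter n (@doubling R) u < 1.
Proof.
move=> u01; elim: n => [//|n]; rewrite iterS; set v := iter n _ u => /andP[v0 v1].
by rewrite /doubling /half; case: ifPn; rewrite -?ltNge => ?; apply/andP; split; lra.
Qed.

(** After [n] digits the remainder is the [n]-th doubling of [u] scaled by [2 ^- n]. *)
Lemma row_sum_id (u : R) : 0 <= u < 1 -> row_sum id u = u.
Proof.
move=> u01; have e n : Sn id n u = u - iter n (@doubling R) u / 2 ^+ n.
  elim: n => [|n IH]; first by rewrite /Sn /series/= big_geq// expr0 divr1 subrr.
  rewrite /Sn /series/= big_nat_recr//= -[X in X + _]/(Sn id n u) IH /row_term /bit.
  rewrite /doubling; set v := iter n _ u.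
  by case: (half v) => /=; rewrite exprS; field; rewrite expf_neq0.
apply/esym; apply: (cvg_unique (@Rhausdorff R) _ (@row_cvg R id u)).
apply/cvgrPdist_le => eps eps0.
have c : (2^-1 : R) ^+ n @[n --> \oo] --> (0 : R).
  by apply: cvg_expr; rewrite ger0_norm//; lra.
move/cvgrPdist_le : c => /(_ _ eps0); apply: filterS => n.
rewrite sub0r normrN -[series _ n]/(Sn id n u) e opprB addrCA subrr addr0.
apply: le_trans; rewrite normrM exprVn [leRHS]ger0_norm ?invr_ge0 ?exprn_ge0//.
have /andP[? ?] := iter_doubling01 n u01.
rewrite (@ger0_norm _ (2 ^+ n)^-1) ?invr_ge0 ?exprn_ge0// ler_piMl ?invr_ge0 ?exprn_ge0//.
by rewrite ger0_norm// ltW.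
Qed.

(** The partial sums along [sigma] have the same characteristic functions as the
partial sums along the identity, because both add independent fair bits with the
same weights; along the identity the digits spell [u] itself. *)
Lemma unif_row sigma : injective sigma -> forall A : set R, measurable A ->
  unif (row_sum sigma @^-1` A) = unif A.
Proof.
move=> sigma_inj A mA.
pose rF : {RV unif >-> R} := mfun_Sub (mem_set (@measurable_row R sigma)).
have ae : {ae unif, forall u : R, row_sum id u = u}.
  exists (~` `[0, 1[%classic); split.
  - exact: measurableC.
  - rewrite unifE; last exact: measurableC.
    by rewrite setICl measure0.
  - move=> u; apply: contra_notP => /= /contrapT; rewrite in_itv/=; exact: row_sum_id.
have bnd2 s (u : R) : `|row_sum s u ^+ 2| <= 1.
  have /andP[? ?] := row_sum01 s u; rewrite ger0_norm ?sqr_ge0//.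
  by rewrite expr_le1.
have i2 s : intg unif (fun u : R => row_sum s u ^+ 2).
  by apply: (@intg_bnd _ _ _ _ _ 1) => //; apply: measurable_funX; exact: measurable_row.
have msq : measurable_fun [set: R] (fun x : R => x ^+ 2) by exact: measurable_funX.
rewrite -[LHS]/(distribution unif rF A).
apply: cf_unique => //.
- by apply: intg_law => //; exact: i2.
- apply: (@intg_ae_eq _ _ _ _ (fun u => row_sum id u ^+ 2)) => //.
  by apply: filterS ae => u ->.
- move=> t a; rewrite Ex_law; last 2 first.
  + by apply: mcos.
  + by apply: icos; exact: measurable_row.
  rewrite row_cf//; apply: Ex_ae_eq.
  + by apply: mcos; exact: measurable_row.
  + exact: mcos.
  + by apply: filterS ae => u ->.
Qed.

End row_law.

(** * Independent standard normal variables *)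

Section quantile.
Context (R : realType) (mu : probability R R).
Local Notation unif := (unif R).

Let idX : {RV mu >-> R} := mfun_Sub (mem_set (@measurable_id _ R setT)).
Let F (x : R) : R := fine (cdf idX x).

Let cdfF x : cdf idX x = (F x)%:E.
Proof. by rewrite /F fineK// /cdf fin_num_measure. Qed.

Let F01 x : 0 <= F x <= 1.
Proof.
by rewrite -!lee_fin -cdfF cdf_ge0 cdf_le1.
Qed.

Let F_nd x y : x <= y -> F x <= F y.
Proof. by move=> xy; rewrite -lee_fin -!cdfF; exact: cdf_nondecreasing. Qed.

Let F_y (u : R) : u < 1 -> exists x, u <= F x.
Proof.
move=> u1; have : F x @[x --> +oo] --> (1 : R).
  apply: (@fine_cvg _ _ _ _ (cdf idX)); exact: cvg_cdfy1.
move/cvgrPdist_lt => /(_ (1 - u)); rewrite subr_gt0 => /(_ u1)[M [_ hM]].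
exists (M + 1); have := hM (M + 1); rewrite ltrDl ltr01 => /(_ isT).
by rewrite ltr_norml => /andP[? ?]; lra.
Qed.

Let F_Ny (u : R) : 0 < u -> exists x, F x < u.
Proof.
move=> u0; have : F x @[x --> -oo] --> (0 : R).
  apply: (@fine_cvg _ _ _ _ (cdf idX)); exact: cvg_cdfNy0.
move/cvgrPdist_lt => /(_ u u0)[M [_ hM]].
exists (M - 1); have := hM (M - 1); rewrite gtrDl ltrN10 => /(_ isT).
by rewrite ltr_norml => /andP[? ?]; lra.
Qed.

Let F_right (u x : R) : F x < u -> exists2 y, x < y & F y < u.
Proof.
move=> xu; have : F y @[y --> x^'+] --> F x.
  apply: (@fine_cvg _ _ _ _ (cdf idX)); rewrite -cdfF; exact: cdf_right_continuous.
move/cvgrPdist_lt => /(_ (u - F x)); rewrite subr_gt0 => /(_ xu) h.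
have [y [xy hy]] : exists y, x < y /\ `|F x - F y| < u - F x.
  near x^'+ => y; exists y; split => //; near: y; exact: h.
by exists y => //; move: hy; rewrite ltr_norml => /andP[? ?]; lra.
Unshelve. all: by end_near. Qed.

Definition quantile (u : R) : R :=
  if (0 < u) && (u < 1) then inf [set x | u <= F x] else 0.

Let quantile_gt u x : 0 < u < 1 -> (x < quantile u) = (F x < u).
Proof.
move=> /[dup] u01 /andP[u0 u1]; rewrite /quantile u01.
have hinf : has_inf [set x | u <= F x].
  split; first exact: F_y.
  have [y yu] := F_Ny u0; exists y => z /= uz.
  by rewrite leNgt; apply/negP => /ltW /F_nd; lra.
apply/idP/idP => [|xu].
  rewrite ltNge; apply: contraNlt => uF; apply: inf_lbound => //; exact: hinf.2.
have [y xy yu] := F_right xu.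
apply: (lt_le_trans xy); apply: lb_le_inf; first exact: hinf.1.
by move=> z /= uz; rewrite leNgt; apply/negP => /ltW /F_nd; lra.
Qed.

Let I01 : set R := `]0, 1[%classic.

Let mI01 : measurable I01. Proof. exact: measurable_itv. Qed.

Let unif_I01 : unif (~` I01) = 0%E.
Proof.
rewrite unifE; last exact: (measurableC mI01).
apply: measure_negligible; first by apply: measurableI => //; exact: (measurableC mI01).
exists [set 0]; split; [exact: measurable_set1|exact: lebesgue_measure_set1|].
move=> x [+ +]; rewrite /I01 /= !in_itv/= => h /andP[x0 x1].
by apply/eqP; rewrite eq_le x0 andbT leNgt; apply/negP => x0'; apply: h; rewrite x0' x1.
Qed.

Let quantile_ray x : quantile @^-1` `]x, +oo[%classic `\` ~` I01 = `]F x, +oo[%classic `\` ~` I01.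
Proof.
by apply/seteqP; split => u /= [+ /contrapT]; rewrite /I01/= !in_itv/= !andbT => h u01;
  move: h; rewrite quantile_gt//; split => //; apply.
Qed.

Lemma measurable_quantile : measurable_fun setT quantile.
Proof.
apply: (measurability _ (RGenOInfty.measurableE R)) => _ [_ [x ->] <-]; rewrite setTI.
have e : quantile @^-1` `]x, +oo[%classic =
  (`]F x, +oo[%classic `&` I01) `|` (if x < 0 then ~` I01 else set0).
  have q := quantile_ray x; rewrite !setDE setCK in q.
  rewrite -q; apply/seteqP; split => u.
    move=> qu; have [uI|uI] := pselect (I01 u); first by left.
    right; move: qu; rewrite /= in_itv/= andbT /quantile ifF.
      by move=> ->.
    by apply/negP => h; apply: uI; rewrite /I01/= in_itv.
  move=> [[]//|]; case: ifP => // x0 uI; rewrite /= in_itv/= andbT /quantile ifF//.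
  by apply/negP => h; apply: uI; rewrite /I01/= in_itv.
rewrite e; apply: measurableU; first by apply: measurableI.
by case: ifP => // _; exact: (measurableC mI01).
Qed.

(** Inverse transform sampling: up to a null set, the event [x < quantile u] is
[F x < u], by right continuity of the distribution function. *)
Lemma unif_quantile (A : set R) : measurable A -> unif (quantile @^-1` A) = mu A.
Proof.
pose qF : {RV unif >-> R} := mfun_Sub (mem_set measurable_quantile).
rewrite -[unif _]/(distribution unif qF A).
apply: (@measure_unique _ R R (@RGenOInfty.G R) (fun n => `](- n%:R), +oo[%classic)).
- exact: RGenOInfty.measurableE.
- move=> _ _ [x ->] [y ->]; exists (Num.max x y).
  by apply/seteqP; split => z /=; rewrite !in_itv/= !andbT gt_max => /andP.
- by move=> n; exists (- n%:R).
- apply/seteqP; split => // x _; exists (Num.truncn (- x)).+1 => //=.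
  by rewrite in_itv/= andbT ltrNl; exact: truncnS_gt.
- move=> _ [x ->].
  rewrite -[LHS]/(unif (quantile @^-1` `]x, +oo[%classic)).
  have mq : measurable (quantile @^-1` `]x, +oo[%classic).
    by rewrite -[X in measurable X]setTI; exact: measurable_quantile.
  rewrite (null_eq mq _ _ unif_I01 (quantile_ray x))//; last exact: (measurableC mI01).
  have muE : mu `]x, +oo[%classic = (1 - F x)%:E.
    by rewrite -setCitvl probability_setC// EFinB -cdfF.
  apply: (eq_trans _ (esym muE)).
  have /andP[F0 F1] := F01 x.
  rewrite unifE//; have -> : `]F x, +oo[%classic `&` `[0, 1[%classic = `]F x, 1[%classic.
    apply/seteqP; split => u /=; rewrite !in_itv/= ?andbT.
      by move=> [-> /andP[]].
    by move=> /andP[h ->]; rewrite h (le_trans F0 (ltW h)).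
  rewrite lebesgue_measure_itv/= lte_fin; case: ltP => // F1'.
  have -> : F x = 1 by apply/eqP; rewrite eq_le F1 F1'.
  by rewrite subrr.
- by move=> k; rewrite ltey_eq fin_num_measure.
Qed.

End quantile.

Section independent_normals.
Context (R : realType).
Local Notation unif := (unif R).

Definition std_normal : probability R R :=
  distribution (normal_prob 0 1 : probability (measurableTypeR R) R) (idR R).

Let cell (j k : nat) : nat := @pickle (nat * nat)%type (j, k).

Let cell_inj j k j' k' : cell j k = cell j' k' -> j = j' /\ k = k'.
Proof. by move=> /(pcan_inj (@pickleK (nat * nat)%type)) []. Qed.

(** The pairing of natural numbers splits the digits of [u] into infinitely many
disjoint rows, each spelling a uniform number. *)
Definition gaussZ (j : nat) (u : R) : R :=
  quantile std_normal (row_sum (cell j) u).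

Let row_inj j : injective (cell j).
Proof. by move=> k l /cell_inj []. Qed.

Let rows (n : nat) : set nat := [set i | exists j k, (j < n)%N /\ i = cell j k].
Let row (j : nat) : set nat := range (cell j).

Let rows_dis n : rows n `&` row n = set0.
Proof.
apply/seteqP; split => // i [[j [k [jn ->]]] [l _ /cell_inj [nj _]]].
by rewrite nj ltnn in jn.
Qed.

Let row_dis i j : i != j -> row i `&` row j = set0.
Proof.
move=> ij; apply/seteqP; split => // l [[k _ <-] [k' _ /cell_inj [e _]]].
by rewrite e eqxx in ij.
Qed.

Let genZ j : gen_meas (@bitRV R) (row j) (gaussZ j).
Proof. exact: (measurableT_comp (measurable_quantile std_normal) (@gen_row R _)). Qed.

Lemma measurable_gaussZ j : measurable_fun setT (gaussZ j).
Proof. exact: gen_meas_measurable (@genZ j). Qed.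

Let ZF j : {RV unif >-> R} := mfun_Sub (mem_set (measurable_gaussZ j)).

Let lawZ j A : measurable A -> distribution unif (ZF j) A = std_normal A.
Proof.
move=> mA; rewrite -(unif_quantile std_normal mA) -(@unif_row R _ (@row_inj j))//.
by rewrite -[X in measurable X]setTI; exact: measurable_quantile.
Qed.

Let ExZ' j (f : R -> R) : measurable_fun setT f ->
  intg (@normal_prob R 0 1) f ->
  intg unif (fun u => f (gaussZ j u)) /\
  \int[unif]_u f (gaussZ j u) = \int[@normal_prob R 0 1]_x f x.
Proof.
move=> mf fi.
have i1 : intg std_normal f by apply: (intg_law (X := idR R)).
have E1 : \int[std_normal]_x f x = \int[@normal_prob R 0 1]_x f x.
  by rewrite (Ex_law (X := idR R)).
have i2 : intg unif (fun u => f (gaussZ j u)).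
  apply/integrableP; split.
    by apply/measurable_EFinP; exact: measurableT_comp mf (measurable_gaussZ j).
  have /integrableP[_] := i1.
  rewrite -(eq_measure_integral std_normal (m1 := distribution unif (ZF j))).
    rewrite ge0_integral_distribution//.
    by apply: measurableT_comp => //; exact/measurable_EFinP.
  by move=> A mA _; exact: lawZ.
split=> //; rewrite -E1 -(Ex_law (X := ZF j))//.
by congr fine; apply: eq_measure_integral => A mA _; exact: lawZ.
Qed.

Lemma gaussZ_sqr j : intg unif (fun u => gaussZ j u ^+ 2) /\ \int[unif]_u (gaussZ j u ^+ 2) = 1.
Proof.
have [i2 E2] := normal_second_moment (oner_neq0 R).
have [] := @ExZ' j (fun x => x ^+ 2) _ i2; first exact: measurable_funX.
by move=> h ->; rewrite E2 expr1n.
Qed.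

Lemma gaussZ_intg j : intg unif (gaussZ j).
Proof. by apply: intg_sq1; [exact: measurable_gaussZ|exact: (gaussZ_sqr j).1]. Qed.

Lemma gaussZ_mean j : \int[unif]_u gaussZ j u = 0.
Proof.
have [_ ->] := @ExZ' j id (@measurable_id _ _ _) (normal_intg1 (oner_neq0 R)).
exact: normal_mean (oner_neq0 R).
Qed.

Lemma gaussZ_cov i j : intg unif (fun u => gaussZ i u * gaussZ j u) /\
  \int[unif]_u (gaussZ i u * gaussZ j u) = (i == j)%:R.
Proof.
have [->|ij] := eqVneq i j; first exact: gaussZ_sqr.
have := Ex_gen_indep (@bits_independent R) (row_dis ij) (@genZ i) (@genZ j) (gaussZ_intg i) (gaussZ_intg j).
by rewrite gaussZ_mean mul0r.
Qed.

Let gaussZ_cf j t a : \int[unif]_u cos (t * gaussZ j u + a) = expR (- (t ^+ 2 / 2)) * cos a.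
Proof.
have mc : measurable_fun [set: R] (fun x : R => cos (t * x + a)).
  apply: measurable_cosf.
  by apply: measurable_funD => //; apply: measurable_funM.
have ic : intg (@normal_prob R 0 1) (fun x : R => cos (t * x + a)).
  apply: (@intg_bnd _ _ _ _ _ 1) => //.
  by move=> x; rewrite ler_norml cos_geN1 cos_le1.
have [_ ->] := ExZ' j mc ic.
by rewrite (normal_cf (oner_neq0 R)) expr1n mul1r.
Qed.

Lemma gaussZ_sum_cf n (c : nat -> R) a :
  \int[unif]_u cos (\sum_(0 <= j < n) c j * gaussZ j u + a) =
  expR (- ((\sum_(0 <= j < n) c j ^+ 2) / 2)) * cos a.
Proof.
have mcos : measurable_fun [set: R] (@cos R).
  by apply: continuous_measurable_fun; exact: continuous_cos.
have gS m : gen_meas (@bitRV R) (rows m) (fun u => \sum_(0 <= j < m) c j * gaussZ j u).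
  elim: m => [|m IH].
    rewrite (_ : (fun u => _) = cst 0); first exact: measurable_cst.
    by apply/funext => u; rewrite big_geq.
  rewrite (_ : (fun u => _) = (fun u => \sum_(0 <= j < m) c j * gaussZ j u + c m * gaussZ m u)); last first.
    by apply/funext => u; rewrite big_nat_recr.
  have s1 : rows m `<=` rows m.+1.
    by move=> _ [j [k [jm ->]]]; exists j, k; split => //; exact: ltnW.
  have s2 : row m `<=` rows m.+1 by move=> _ [k _ <-]; exists m, k.
  have h1 := gen_meas_sub s1 IH.
  have h2 := gen_meas_sub s2 (@genZ m).
  exact: (measurable_funD h1 (measurable_funM (measurable_cst (c m)) h2)).
elim: n a => [|n IH] a.
  rewrite big_geq// mul0r oppr0 expR0 mul1r.
  by under eq_Rintegral do rewrite big_geq// add0r; rewrite Ex_cst.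
have gc a' : gen_meas (@bitRV R) (rows n) (fun u => cos (\sum_(0 <= j < n) c j * gaussZ j u + a')).
  exact: (measurableT_comp mcos (measurable_funD (@gS n) (measurable_cst a'))).
have gd a' : gen_meas (@bitRV R) (row n) (fun u => cos (c n * gaussZ n u + a')).
  have h := measurable_funM (measurable_cst (c n)) (@genZ n).
  exact: (measurableT_comp mcos (measurable_funD h (measurable_cst a'))).
have ic S f : gen_meas (@bitRV R) S (fun u => cos (f u)) -> intg unif (fun u => cos (f u)).
  move=> g; apply: (@intg_bnd _ _ _ _ _ 1); first exact: gen_meas_measurable g.
  by move=> x; rewrite ler_norml cos_geN1 cos_le1.
have key a1 a2 := Ex_gen_indep (@bits_independent R) (@rows_dis n) (@gc a1) (@gd a2)
  (ic _ _ (@gc a1)) (ic _ _ (@gd a2)).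
(* The sines of the addition formula are cosines shifted by pi / 2. *)
have [i1 E1] := key a 0; have [i2 E2] := key (a - pi / 2) (- (pi / 2)).
rewrite (_ : (fun u => _) = fun u =>
   cos (\sum_(0 <= j < n) c j * gaussZ j u + a) * cos (c n * gaussZ n u + 0) -
   cos (\sum_(0 <= j < n) c j * gaussZ j u + (a - pi / 2)) * cos (c n * gaussZ n u + (- (pi / 2)))); last first.
  by apply/funext => u; rewrite big_nat_recr//= addr0 addrAC cosD addrA !cosBpihalf.
rewrite (ExB i1 i2) E1 E2 !gaussZ_cf !IH cosN cos_pihalf mulr0 mulr0 subr0 cos0 mulr1.
rewrite mulrAC -expRD big_nat_recr//=; congr (expR _ * _).
by field.
Qed.

End independent_normals.

(** * Gram-Schmidt for a covariance form *)

Section gram_schmidt.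
Context (R : realType) (H : lmodType R) (phi : nat -> H) (q : H -> H -> R).
Hypothesis q_sym : forall u v, q u v = q v u.
Hypothesis q_lin : forall c u v w, q (c *: u + v) w = c * q u w + q v w.
Hypothesis q_psd : forall u, 0 <= q u u.

(** The form left after subtracting its projections on the first [n] vectors of
[phi]. When the pivot is zero, so is its row by Cauchy-Schwarz, and division by zero
gives the correct trivial step. *)
Fixpoint residual (n : nat) (u w : H) : R :=
  if n is m.+1 then residual m u w -
    residual m (phi m) u * residual m (phi m) w / residual m (phi m) (phi m)
  else q u w.

Lemma residual_sym n u w : residual n u w = residual n w u.
Proof. by elim: n u w => [|n IH] u w /=; [exact: q_sym|rewrite IH; ring]. Qed.

Lemma residual_lin n c u v w :
  residual n (c *: u + v) w = c * residual n u w + residual n v w.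
Proof.
elim: n c u v w => [|n IH] c u v w /=; first exact: q_lin.
by rewrite IH (residual_sym n (phi n) (c *: u + v)) IH !(residual_sym n _ (phi n)); ring.
Qed.

Let resid_psd n : (forall u, 0 <= residual n u u) ->
  forall u w, residual n w u ^+ 2 <= residual n w w * residual n u u.
Proof.
move=> psd u w; set a := residual n w w; set b := residual n w u.
have expand c : residual n (c *: w + u) (c *: w + u) = c ^+ 2 * a + 2 * c * b + residual n u u.
  rewrite residual_lin (residual_sym n w) (residual_sym n u (c *: w + u)) !residual_lin.
  by rewrite (residual_sym n u w) -/a -/b; ring.
have a0 : 0 <= a by exact: psd.
have := a0; rewrite le_eqVlt => /predU1P[a00|a_gt0].
  have [->|b0] := eqVneq b 0; first by rewrite expr0n/= mulr_ge0.
  have := psd ((- ((residual n u u + 1) / (2 * b))) *: w + u); rewrite expand -a00.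
  have -> : 2 * - ((residual n u u + 1) / (2 * b)) * b = - (residual n u u + 1).
    by field.
  by rewrite mulr0; have := psd u; lra.
have := psd ((- (b / a)) *: w + u); rewrite expand => h.
have e : (- (b / a)) ^+ 2 * a + 2 * - (b / a) * b = - (b ^+ 2 / a) by field; rewrite gt_eqF.
have {}h : b ^+ 2 / a <= residual n u u by move: h; rewrite e; lra.
by rewrite mulrC -ler_pdivrMr.
Qed.

Lemma residual_psd n u : 0 <= residual n u u.
Proof.
elim: n u => [|n IH] u /=; first exact: q_psd.
have := IH (phi n); rewrite le_eqVlt => /predU1P[<-|p0]; first by rewrite invr0 mulr0 subr0.
by rewrite subr_ge0 ler_pdivrMr// -expr2 [leRHS]mulrC; exact: resid_psd.
Qed.

Lemma residual_cs n u w : residual n w u ^+ 2 <= residual n w w * residual n u u.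
Proof. by apply: resid_psd; exact: residual_psd. Qed.

Lemma residual_phi n j u : (j < n)%N -> residual n (phi j) u = 0.
Proof.
elim: n j u => [//|n IH] j u /=; rewrite ltnS leq_eqVlt => /predU1P[->|jn]; last first.
  by rewrite (IH j u jn) (residual_sym n (phi n) (phi j)) (IH j _ jn) mul0r mul0r subrr.
have [p0|p0] := eqVneq (residual n (phi n) (phi n)) 0; last by field.
rewrite p0 invr0 mulr0 subr0; apply/eqP; rewrite -sqrf_eq0 eq_le sqr_ge0 andbT.
by have := residual_cs n u (phi n); rewrite p0 mul0r.
Qed.

(** The coordinate of [u] on the [n]-th normalised Gram-Schmidt vector of [q]. *)
Definition gs_coef n u := residual n (phi n) u / Num.sqrt (residual n (phi n) (phi n)).

Lemma gs_coef_lin n c u v : gs_coef n (c *: u + v) = c * gs_coef n u + gs_coef n v.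
Proof.
by rewrite /gs_coef residual_sym residual_lin !(residual_sym n _ (phi n)); ring.
Qed.

Lemma gs_coef_phi n j : (j < n)%N -> gs_coef n (phi j) = 0.
Proof. by move=> jn; rewrite /gs_coef residual_sym residual_phi// mul0r. Qed.

Lemma residualE N u w : residual N u w = q u w - \sum_(0 <= n < N) gs_coef n u * gs_coef n w.
Proof.
elim: N => [|N IH] /=; first by rewrite big_geq// subr0.
rewrite big_nat_recr//= opprD addrA -IH; congr (_ - _).
by rewrite /gs_coef mulrACA -invfM -expr2 sqr_sqrtr// residual_psd.
Qed.

(** On the span of the first [N] vectors the residual form vanishes, which leaves
Parseval for [q]. *)
Lemma gs_coef_sum N (c : nat -> R) w :
  q (\sum_(0 <= j < N) c j *: phi j) w =
  \sum_(0 <= n < N) gs_coef n (\sum_(0 <= j < N) c j *: phi j) * gs_coef n w.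
Proof.
apply/eqP; rewrite -subr_eq0 -residualE.
suff h M : (M <= N)%N -> residual N (\sum_(0 <= j < M) c j *: phi j) w = 0 by rewrite h.
elim: M => [|M IH] MN.
  rewrite big_geq//; have := residual_lin N (-1) 0 0 w.
  by rewrite scaler0 addr0 mulN1r addrC subrr.
rewrite big_nat_recr; last exact: leq0n.
by rewrite [X in residual _ X]addrC residual_lin (IH (ltnW MN)) (residual_phi _ MN) mulr0 addr0.
Qed.

End gram_schmidt.

(** * Gaussian laws on a Hilbert space *)

(** By monotone convergence the sum of the series is integrable, hence finite almost
everywhere. *)
Lemma ae_bounded_sums d (T : measurableType d) (R : realType) (P : probability T R)
    (f : nat -> T -> R) C : (forall n, intg P (f n)) -> (forall n w, 0 <= f n w) ->
  (forall n, \sum_(0 <= k < n) \int[P]_w f k w <= C) ->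
  exists Good : set T, [/\ measurable Good, P (~` Good) = 0%E &
    forall w, Good w -> exists M, forall n, \sum_(0 <= k < n) f k w <= M].
Proof.
move=> fi f0 fC.
pose S w : \bar R := (\sum_(0 <= k <oo) (f k w)%:E)%E.
have mS : measurable_fun setT S.
  apply: (ge0_emeasurable_sum (P := xpredT)).
    by move=> k w _ _; rewrite lee_fin.
  by move=> k _; apply/measurable_EFinP; exact: intg_meas (fi k).
have S0 w : (0 <= S w)%E by apply: nneseries_ge0 => k _ _; rewrite lee_fin.
have intS : (\int[P]_w S w <= C%:E)%E.
  have mf n : measurable_fun setT (EFin \o f n).
    by apply/measurable_EFinP; exact: intg_meas (fi n).
  rewrite integral_nneseries//; last by move=> n w _; rewrite lee_fin.
  apply: lime_le.
    by apply: is_cvg_nneseries => k _ _; apply: integral_ge0 => w _; rewrite lee_fin.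
  apply: nearW => n; under eq_bigr do rewrite EFin_Ex//.
  by rewrite sumEFin lee_fin.
have iS : P.-integrable setT S.
  apply/integrableP; split => //.
  rewrite (eq_integral S); first exact: (le_lt_trans intS (ltry _)).
  by move=> w _; rewrite gee0_abs.
pose Good := [set w | (S w < +oo)%E].
have mG : measurable Good.
  rewrite -[X in measurable X]setTI; apply: measurable_lte => //.
exists Good; split => //.
  apply: measure_negligible; first exact: measurableC.
  have [N [mN N0 SN]] := integrable_ae measurableT iS.
  exists N; split => // w; rewrite /Good /= => wG; apply: SN => /=.
  by move=> /(_ I) /fin_numPlt /andP[_ ?].
move=> w wG; exists (fine (S w)) => n.
have Sfin : S w \is a fin_num by rewrite ge0_fin_numE.
rewrite -lee_fin fineK// -sumEFin; apply: nneseries_lim_ge => k _ _.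
by rewrite lee_fin.
Qed.

Section gaussian_vector.
Context (R : realType) (H : completeNormedModType R) (ip : {dot H for idfun}).
Variable phi : nat -> H.
Hypothesis hip : inner_product ip.
Hypothesis hsep : separable H.
Hypothesis hphi : orthonormal_basis ip phi.
Variable q : H -> H -> R.
Hypothesis q_sym : forall u v, q u v = q v u.
Hypothesis q_lin : forall c u v w, q (c *: u + v) w = c * q u w + q v w.
Hypothesis q_psd : forall u, 0 <= q u u.
Variables (M C : R).
Hypothesis q_bnd : forall u v, `|q u v| <= M * (`|u| * `|v|).
Hypothesis q_trace : forall n, \sum_(0 <= k < n) q (phi k) (phi k) <= C.
Local Notation P := (unif R).
Local Notation Z := (@gaussZ R).

Let L n u := gs_coef phi q n u.

Let W N (c : nat -> R) (w : R) : R := \sum_(0 <= n < N) c n * Z n w.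

Let mW N c : measurable_fun setT (W N c).
Proof.
by apply: measurable_sum => n; apply: measurable_funM => //; exact: measurable_gaussZ.
Qed.

Let W_mean N c : intg P (W N c) /\ \int[P]_w W N c w = 0.
Proof.
have i n : intg P (fun w => c n * Z n w) by apply: intgZ; exact: gaussZ_intg.
split; first exact: intg_sum.
rewrite Ex_sum// big1// => n _; rewrite ExZ ?gaussZ_mean ?mulr0//; exact: gaussZ_intg.
Qed.

Let W_cov N c d : intg P (fun w => W N c w * W N d w) /\
  \int[P]_w (W N c w * W N d w) = \sum_(0 <= n < N) c n * d n.
Proof.
have e w : W N c w * W N d w = \sum_(0 <= n < N) \sum_(0 <= m < N) c n * d m * (Z n w * Z m w).
  rewrite /W big_distrl/=; apply: eq_bigr => n _.
  by rewrite big_distrr/=; apply: eq_bigr => m _; rewrite mulrACA.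
have i n m : intg P (fun w => c n * d m * (Z n w * Z m w)).
  by apply: intgZ; exact: (gaussZ_cov R n m).1.
rewrite (_ : (fun w => _) = fun w => \sum_(0 <= n < N) \sum_(0 <= m < N) c n * d m * (Z n w * Z m w)); last exact/funext.
split; first by apply: intg_sum => n; exact: intg_sum.
rewrite Ex_sum; last by move=> n; exact: intg_sum.
rewrite big_seq [RHS]big_seq; apply: eq_bigr => n; rewrite mem_index_iota => nN.
rewrite Ex_sum// (bigD1_seq n) ?mem_index_iota ?iota_uniq//= big1 ?addr0.
  have [i1 E1] := gaussZ_cov R n n.
  by rewrite ExZ// E1 eqxx mulr1.
move=> m mn; have [i1 E1] := gaussZ_cov R n m.
by rewrite ExZ// E1 eq_sym (negbTE mn) mulr0.
Qed.

Let coord (j : nat) (w : R) : R := W j.+1 (fun n => L n (phi j)) w.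

Let coordE N j w : (j < N)%N -> coord j w = W N (fun n => L n (phi j)) w.
Proof.
move=> jN; rewrite /coord /W [RHS](big_cat_nat _ (n := j.+1))//=.
rewrite [X in _ = _ + X]big_nat_cond [X in _ = _ + X]big1 ?addr0// => n.
by rewrite andbT => /andP[jn _]; rewrite /L (gs_coef_phi phi q_sym q_lin q_psd jn) mul0r.
Qed.

Let coord_sqr j : intg P (fun w => coord j w ^+ 2) /\
  \int[P]_w (coord j w ^+ 2) = q (phi j) (phi j).
Proof.
have [i1 E1] := W_cov j.+1 (fun n => L n (phi j)) (fun n => L n (phi j)).
split; first by [].
rewrite -[LHS]/(\int[P]_w (coord j w * coord j w)) E1.
have := gs_coef_sum phi q_sym q_lin q_psd j.+1 (fun i => (i == j)%:R) (phi j).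
rewrite (_ : \sum_(0 <= i < j.+1) _ *: _ = phi j); first by move=> ->.
rewrite (bigD1_seq j) ?mem_index_iota ?iota_uniq//= eqxx scale1r big1 ?addr0//.
by move=> i /negbTE ->; rewrite scale0r.
Qed.

Let good : exists Good : set R, [/\ measurable Good, P (~` Good) = 0%E &
  forall w, Good w -> exists K, forall n, \sum_(0 <= k < n) coord k w ^+ 2 <= K].
Proof.
apply: (@ae_bounded_sums _ _ _ P (fun k w => coord k w ^+ 2) C).
- by move=> n; have [] := coord_sqr n.
- by move=> n w; exact: sqr_ge0.
- by move=> n; under eq_bigr do rewrite (coord_sqr _).2.
Qed.

(** The candidate coordinates are finite Gram-Schmidt combinations of the normal
variables; the trace bound makes them square summable almost everywhere, and
Riesz-Fischer gathers them into a vector. *)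
Lemma gaussian_vector : exists G : R -> H, measurable_fun setT (G : R -> borel H) /\
  exists Good : set R, [/\ measurable Good, P (~` Good) = 0%E &
    forall w, Good w -> forall j, ip (G w) (phi j) = coord j w].
Proof.
have [Good [mG PG hG]] := good.
have /choice[G hGj] : forall w, exists m : H, forall j, ip m (phi j) = coord j w * \1_Good w.
  move=> w; rewrite indicE; have [wG|wG] := pselect (Good w).
    have [K hK] := hG w wG; have [m _ mj] := riesz_fischer hip hphi hK.
    by exists m => j; rewrite mj mem_set// mulr1.
  by exists 0 => j; rewrite ip0l memNset// mulr0.
exists G; split.
  apply: (measurable_coord hsep hip hphi) => j.
  under eq_fun do rewrite hGj; apply: measurable_funM; first exact: mW.
  exact: measurable_indic.
by exists Good; split => // w wG j; rewrite hGj indicE mem_set// mulr1.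
Qed.

Section properties.
Variable G : R -> H.
Hypothesis mG : measurable_fun setT (G : R -> borel H).
Variable Good : set R.
Hypothesis mGood : measurable Good.
Hypothesis PGood : P (~` Good) = 0%E.
Hypothesis G_coord : forall w, Good w -> forall j, ip (G w) (phi j) = coord j w.

Let ae_good (A : R -> Prop) : (forall w, Good w -> A w) -> {ae P, forall w, A w}.
Proof.
move=> h; exists (~` Good); split => //; first exact: measurableC.
by move=> w /=; apply: contra_not => /h.
Qed.

Let mip u : measurable_fun setT (fun w => ip (G w) u).
Proof. exact: (measurable_ip hip u mG). Qed.

Let ip_bprojE N u w : Good w -> ip (G w) (bproj ip phi N u) = W N (fun n => L n (bproj ip phi N u)) w.
Proof.
move=> wG; rewrite /bproj ip_sumr /W.
transitivity (\sum_(0 <= j < N) \sum_(0 <= n < N) ip u (phi j) * L n (phi j) * Z n w).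
  rewrite big_seq [RHS]big_seq; apply: eq_bigr => j; rewrite mem_index_iota => /andP[_ jN].
  rewrite ipZr G_coord// (coordE _ jN) /W mulr_sumr.
  by apply: eq_bigr => n _; rewrite mulrA.
rewrite exchange_big/=; apply: eq_bigr => n _; rewrite -mulr_suml; congr (_ * _).
elim: N => [|N IH].
  rewrite !big_geq//; have := gs_coef_lin phi q_sym q_lin n (-1) 0 0.
  by rewrite scaler0 addr0 mulN1r addrC subrr.
rewrite big_nat_recr//= IH [in RHS]big_nat_recr//= [in RHS]addrC.
by rewrite /L (gs_coef_lin phi q_sym q_lin) addrC.
Qed.

Let coord_moment k : intg P (fun w => ip (G w) (phi k) ^+ 2) /\
  \int[P]_w (ip (G w) (phi k) ^+ 2) = q (phi k) (phi k).
Proof.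
have [i1 E1] := coord_sqr k; have a : {ae P, forall w, coord k w ^+ 2 = ip (G w) (phi k) ^+ 2}.
  by apply: ae_good => w wG; rewrite G_coord.
have m1 : measurable_fun setT (fun w => ip (G w) (phi k) ^+ 2) by exact: measurable_funX.
split; first exact: (intg_ae_eq m1 a i1).
by rewrite -E1; apply/esym; apply: Ex_ae_eq => //; exact: intg_meas i1.
Qed.

Lemma gaussian_sqr : intg P (fun w => `|G w| ^+ 2).
Proof.
have := second_moment_le hip hphi (fun k => (coord_moment k).1)
  (c := fun k => q (phi k) (phi k)) _ q_trace.
by case=> // k; rewrite (coord_moment k).2.
Qed.

Let bproj_le n u : `|bproj ip phi n u| <= `|u|.
Proof.
rewrite -(@ler_pXn2r _ 2)// ?nnegrE// /bproj (norm_phi_sum hip hphi).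
exact: (bessel hip hphi).
Qed.

Let q_linr c u v w : q w (c *: u + v) = c * q w u + q w v.
Proof. by rewrite q_sym q_lin !(q_sym _ w). Qed.

Let q_cvg u v : q (bproj ip phi N u) (bproj ip phi N v) @[N --> \oo] --> q u v.
Proof.
have M0 : 0 <= `|M| by [].
have h1 : `|bproj ip phi N u - u| @[N --> \oo] --> (0 : R).
  rewrite -(normr0 H) -(subrr u); apply: cvg_norm; apply: cvgB; last exact: cvg_cst.
  exact: (bproj_cvg hphi).
have h2 : `|bproj ip phi N v - v| @[N --> \oo] --> (0 : R).
  rewrite -(normr0 H) -(subrr v); apply: cvg_norm; apply: cvgB; last exact: cvg_cst.
  exact: (bproj_cvg hphi).
apply/subr_cvg0; apply/norm_cvg0P.
apply: (@squeeze_cvgr _ _ _ _ (fun=> 0) (fun N => `|M| * (`|bproj ip phi N u - u| * `|v| + `|u| * `|bproj ip phi N v - v|))).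
- apply: nearW => N; rewrite normr_ge0/=.
  set u' := bproj ip phi N u; set v' := bproj ip phi N v.
  have -> : q u' v' - q u v = q (u' - u) v' + q u (v' - v).
    have -> : u' - u = (-1) *: u + u' by rewrite scaleN1r addrC.
    have -> : v' - v = (-1) *: v + v' by rewrite scaleN1r addrC.
    by rewrite q_lin q_linr; ring.
  apply: le_trans (ler_normD _ _) _; rewrite mulrDr; apply: lerD.
    apply: le_trans (q_bnd _ _) _.
    apply: (@le_trans _ _ (`|M| * (`|u' - u| * `|v'|))).
      by apply: ler_wpM2r; [exact: mulr_ge0|exact: ler_norm].
    by do 2 apply: ler_wpM2l => //; exact: bproj_le.
  apply: le_trans (q_bnd _ _) _.
  by apply: ler_wpM2r; [exact: mulr_ge0|exact: ler_norm].
- exact: cvg_cst.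
- rewrite -[X in _ --> X](mulr0 `|M|); apply: cvgMl_tmp.
  rewrite -[X in _ --> X]addr0; apply: cvgD.
    by rewrite -[X in _ --> X](mul0r `|v|); exact: cvgMr_tmp.
  by rewrite -[X in _ --> X](mulr0 `|u|); exact: cvgMl_tmp.
Qed.

Let sum_coef N u v : \sum_(0 <= n < N) L n (bproj ip phi N u) * L n (bproj ip phi N v) =
  q (bproj ip phi N u) (bproj ip phi N v).
Proof. by rewrite /bproj (gs_coef_sum phi q_sym q_lin q_psd). Qed.

Let ip_cvg u w : ip (G w) (bproj ip phi N u) @[N --> \oo] --> ip (G w) u.
Proof.
rewrite (_ : (fun N => _) = fun N => ip (bproj ip phi N u) (G w)); last first.
  by apply/funext => N; rewrite ipC.
rewrite (ipC ip (G w) u).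
exact: (cvg_comp _ _ (@bproj_cvg _ _ _ _ hphi u) (@ip_continuous _ _ _ hip (G w) u)).
Qed.

(** The formula is exact on the finite-dimensional projections of [u], by
[gaussZ_sum_cf], and passes to the limit by dominated convergence. *)
Lemma gaussian_cf u a : \int[P]_w cos (ip (G w) u + a) = expR (- (q u u / 2)) * cos a.
Proof.
have mcos v : measurable_fun setT (fun w => cos (ip (G w) v + a)).
  apply: measurable_cosf.
  by apply: measurable_funD.
have h1 : \int[P]_w cos (ip (G w) (bproj ip phi N u) + a) @[N --> \oo] -->
    \int[P]_w cos (ip (G w) u + a).
  apply: (@Ex_dct _ _ _ P (fun N w => cos (ip (G w) (bproj ip phi N u) + a)) _ (fun=> 1)) => //.
  - move=> w; apply: (cvg_comp (fun N => ip (G w) (bproj ip phi N u) + a) cos); last exact: continuous_cos.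
    by apply: cvgD; [exact: ip_cvg|exact: cvg_cst].
  - exact: intg_cst.
  - by move=> n w; rewrite ler_norml cos_geN1 cos_le1.
have h2 : expR (- (q (bproj ip phi N u) (bproj ip phi N u) / 2)) * cos a @[N --> \oo] -->
    expR (- (q u u / 2)) * cos a.
  apply: cvgMr_tmp; apply: (cvg_comp (fun N => - (q (bproj ip phi N u) (bproj ip phi N u) / 2)) expR); last exact: continuous_expR.
  by apply: cvgN; apply: cvgMr_tmp; exact: q_cvg.
rewrite (_ : (fun N => _) = fun N => expR (- (q (bproj ip phi N u) (bproj ip phi N u) / 2)) * cos a) in h1.
  exact: (cvg_unique (@Rhausdorff R) h1 h2).
apply/funext => N; rewrite -sum_coef.
rewrite -[in RHS](eq_bigr _ (fun n _ => expr2 (L n (bproj ip phi N u)))) -gaussZ_sum_cf.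
apply: Ex_ae_eq => //.
  apply: measurable_cosf.
  by apply: measurable_funD => //; exact: mW.
by apply: ae_good => w wG; rewrite ip_bprojE.
Qed.

Let ip_le w v : `|ip (G w) v| <= `|G w| * `|v|. Proof. exact: ip_norm. Qed.

Lemma gaussian_cov u v : intg P (fun w => ip (G w) u * ip (G w) v) /\
  \int[P]_w (ip (G w) u * ip (G w) v) = q u v.
Proof.
have dom x y w : `|x| <= `|u| -> `|y| <= `|v| ->
    `|ip (G w) x * ip (G w) y| <= (`|u| * `|v|) * `|G w| ^+ 2.
  move=> xu yv; rewrite normrM; apply: (@le_trans _ _ ((`|G w| * `|u|) * (`|G w| * `|v|))).
    by apply: ler_pM => //; apply: le_trans (ip_le _ _) _; apply: ler_wpM2l.
  by rewrite mulrACA -expr2 mulrC.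
have igd : intg P (fun w => (`|u| * `|v|) * `|G w| ^+ 2) by apply: intgZ; exact: gaussian_sqr.
have mm x y : measurable_fun setT (fun w => ip (G w) x * ip (G w) y) by exact: measurable_funM.
split.
  by apply: (intg_le (mm _ _) igd) => w; exact: dom.
have h1 : \int[P]_w (ip (G w) (bproj ip phi N u) * ip (G w) (bproj ip phi N v)) @[N --> \oo] -->
    \int[P]_w (ip (G w) u * ip (G w) v).
  apply: (@Ex_dct _ _ _ P (fun N w => ip (G w) (bproj ip phi N u) * ip (G w) (bproj ip phi N v)) _
     (fun w => (`|u| * `|v|) * `|G w| ^+ 2)) => //.
  - by move=> w; apply: cvgM; exact: ip_cvg.
  - by move=> n w; apply: dom; exact: bproj_le.
rewrite (_ : (fun N => _) = fun N => q (bproj ip phi N u) (bproj ip phi N v)) in h1.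
  exact: (cvg_unique (@Rhausdorff R) h1 (@q_cvg u v)).
apply/funext => N; rewrite -sum_coef.
have [i2 <-] := W_cov N (fun n => L n (bproj ip phi N u)) (fun n => L n (bproj ip phi N v)).
apply: Ex_ae_eq => //; first exact: intg_meas i2.
by apply: ae_good => w wG; rewrite !ip_bprojE.
Qed.

Lemma gaussian_mean u : \int[P]_w ip (G w) u = 0.
Proof.
have h1 : \int[P]_w ip (G w) (bproj ip phi N u) @[N --> \oo] --> \int[P]_w ip (G w) u.
  apply: (@Ex_dct _ _ _ P (fun N w => ip (G w) (bproj ip phi N u)) _
    (fun w => `|u| * (1 + `|G w| ^+ 2))) => //.
  - by apply: intgZ; apply: intgD; [exact: intg_cst|exact: gaussian_sqr].
  - move=> n w; apply: le_trans (ip_le _ _) _; rewrite mulrC.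
    have h2 := bproj_le n u; have h3 := normr_ge0 (G w).
    by apply: ler_pM => //; move: (`|G w|) h3 => x x0; nra.
rewrite (_ : (fun N => _) = fun=> 0) in h1.
  have h2 : (fun=> 0 : R) @ \oo --> (0 : R) by exact: cvg_cst.
  exact: (cvg_unique (@Rhausdorff R) h1 h2).
apply/funext => N; rewrite -(W_mean N (fun n => L n (bproj ip phi N u))).2.
apply: Ex_ae_eq => //.
by apply: ae_good => w wG; rewrite ip_bprojE.
Qed.

End properties.
End gaussian_vector.

Lemma expectationE d (T : measurableType d) (R : realType) (P : probability T R)
  (f : T -> R) : intg P f -> 'E_P[f]%E = (\int[P]_w f w)%:E.
Proof. by move=> fi; rewrite unlock -EFin_Ex. Qed.

Lemma dirac_Ex (R : realType) (f : R -> R) : measurable_fun setT f ->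
  intg (\d_(0 : R) : probability R R) f /\ \int[(\d_(0 : R) : probability R R)]_x f x = f 0.
Proof.
move=> mf; have mf' : measurable_fun setT (EFin \o f) by exact/measurable_EFinP.
split.
  apply/integrableP; split => //.
  rewrite integral_dirac//; first by rewrite diracT mul1e ltry.
  exact/measurableT_comp.
by rewrite /Rintegral integral_dirac// diracT mul1e.
Qed.

(** The degenerate variance is included: the point mass at zero has the
characteristic function obtained by setting [s = 0]. *)
Lemma normal_lawP (R : realType) (mu : probability R R) (s : R) :
  intg mu (fun x => x ^+ 2) ->
  (forall t a, \int[mu]_x cos (x * t + a) = expR (- (s ^+ 2 * t ^+ 2 / 2)) * cos a) ->
  forall A : set R, measurable A -> mu A = normal_law 0 s A.
Proof.
have msq : measurable_fun setT (fun x : R => x ^+ 2) by exact: measurable_funX.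
have mcos t a : measurable_fun setT (fun x : R => cos (x * t + a)).
  apply: measurable_cosf.
  by apply: measurable_funD => //; exact: measurable_funM.
move=> mu2 cf A mA; rewrite /normal_law; case: eqVneq => [s0|s0].
  apply: (@cf_unique _ mu (\d_(0 : R) : probability R R) mu2 (dirac_Ex msq).1) => // t a.
  rewrite cf (dirac_Ex (mcos t a)).2 s0 expr0n/= !mul0r oppr0 expR0 mul1r.
  by rewrite add0r.
pose nu := distribution (normal_prob 0 s : probability (measurableTypeR R) R) (idR R).
rewrite -[RHS]/(nu A); apply: cf_unique => //.
  apply: intg_law => //; exact: (normal_second_moment s0).1.
move=> t a; rewrite cf -(normal_cf s0); apply/esym.
rewrite (Ex_law (X := idR R)); first by apply: eq_Rintegral => x _; rewrite mulrC.
  exact: mcos.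
by apply: (@intg_bnd _ _ _ _ _ 1); [exact: mcos|move=> x; rewrite ler_norml cos_geN1 cos_le1].
Qed.

Section gaussian_existence.
Context (R : realType) (H : completeNormedModType R) (ip : {dot H for idfun}).
Variable phi : nat -> H.
Hypothesis hip : inner_product ip.
Hypothesis hsep : separable H.
Hypothesis hphi : orthonormal_basis ip phi.

Lemma gaussian_exists (q : H -> H -> R) (C : H -> H) (M K : R) :
  (forall u v, q u v = q v u) ->
  (forall c u v w, q (c *: u + v) w = c * q u w + q v w) ->
  (forall u, 0 <= q u u) ->
  (forall u v, `|q u v| <= M * (`|u| * `|v|)) ->
  (forall n, \sum_(0 <= k < n) q (phi k) (phi k) <= K) ->
  (forall h h', ip (C h) h' = q h h') ->
  exists nu : probability (borel H) R, [/\ centered_gaussian ip nu C,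
    forall u a, \int[nu]_x cos (ip (x : H) u + a) = expR (- (q u u / 2)) * cos a &
    moments_le ip phi nu (id : borel H -> H) (fun k => q (phi k) (phi k))].
Proof.
move=> q_sym q_lin q_psd q_bnd q_tr qC.
have [G [mG [Good [mGood PGood hG]]]] :=
  gaussian_vector hip hsep hphi q_sym q_lin q_psd q_tr.
pose rG : {RV (unif R) >-> borel H} := mfun_Sub (mem_set mG).
have cov := gaussian_cov hip hphi q_sym q_lin q_psd q_bnd q_tr mG mGood PGood hG.
have cf := gaussian_cf hip hphi q_sym q_lin q_psd q_bnd mG mGood PGood hG.
have mean := gaussian_mean hip hphi q_sym q_lin q_psd q_tr mG mGood PGood hG.
pose nu := distribution (unif R) rG.
have mipH h : measurable_fun [set: borel H] (fun x : borel H => ip (x : H) h).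
  exact: (measurable_ip hip (X := id)).
have ip1 h : intg (unif R) (fun w => ip (G w) h).
  apply: intg_sq1; first exact: (measurable_ip hip h mG).
  exact: (cov h h).1.
have nucov u v : intg nu (fun x : borel H => ip (x : H) u * ip (x : H) v) /\
    \int[nu]_x (ip (x : H) u * ip (x : H) v) = q u v.
  have m2 : measurable_fun setT (fun x : borel H => ip (x : H) u * ip (x : H) v).
    by apply: measurable_funM; exact: mipH.
  have [i E] := cov u v; split; first exact: (intg_law (X := rG)).
  by rewrite (Ex_law (X := rG)).
have mcos u a : measurable_fun setT (fun x : borel H => cos (ip (x : H) u + a)).
  apply: measurable_cosf.
  by apply: measurable_funD.
have nucf u a : \int[nu]_x cos (ip (x : H) u + a) = expR (- (q u u / 2)) * cos a.
  rewrite (Ex_law (X := rG) (@mcos u a)); first exact: cf.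
  apply: (@intg_bnd _ _ _ _ _ 1); last by move=> x; rewrite ler_norml cos_geN1 cos_le1.
  by have := measurableT_comp (@mcos u a) mG.
exists nu; split => //; last by move=> k; have [i E] := nucov (phi k) (phi k); rewrite E.
split.
- move=> h; exists 0, (Num.sqrt (q h h)) => A mA.
  pose X : {RV nu >-> R} := mfun_Sub (mem_set (@mipH h)).
  rewrite -[LHS]/(distribution nu X A); apply: normal_lawP => //.
    apply: (intg_law (X := X)); first exact: measurable_funX.
    exact: (nucov h h).1.
  move=> t a; have mc : measurable_fun setT (fun x : R => cos (x * t + a)).
    apply: measurable_cosf.
    by apply: measurable_funD => //; exact: measurable_funM.
  rewrite (Ex_law (X := X) mc).
    under eq_Rintegral do rewrite /= mulrC -ipZr.
    rewrite (nucf (t *: h) a) sqr_sqrtr//.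
    have qZ c u w : q (c *: u) w = c * q u w.
      have q0 : q 0 w = 0 by have := q_lin (-1) 0 0 w; rewrite scaler0 addr0 mulN1r addrC subrr.
      by rewrite -[c *: u]addr0 q_lin q0 addr0.
    by rewrite qZ q_sym qZ mulrA -expr2 [t ^+ 2 * _]mulrC.
  apply: (@intg_bnd _ _ _ _ _ 1); last by move=> x; rewrite ler_norml cos_geN1 cos_le1.
  exact: (measurableT_comp mc (measurable_funP X)).
- move=> h; rewrite ip0l expectationE; last first.
    by apply: intg_law => //; exact: ip1.
  by rewrite (Ex_law (X := rG)) ?mean//; exact: ip1.
- move=> h h'.
  have [i E] := nucov h h'.
  rewrite (_ : (fun w : borel H => _) = fun x : borel H => ip (x : H) h * ip (x : H) h'); last first.
    by apply/funext => x; rewrite ipZl.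
  by rewrite expectationE// E qC.
Qed.

End gaussian_existence.

(** * A central limit theorem for predictable selections *)

Section martingale_clt.
Context d (Omega : measurableType d) (R : realType) (P : probability Omega R).
Context (I : choiceType) d1 (T : measurableType d1) (X : I -> {RV P >-> T}).
Hypothesis Xindep : mutually_independent P X.
Variables (past fut : nat -> set I).
Hypothesis past_fut : forall k, past k `&` fut k = set0.
Hypothesis past_sub : forall k, past k `<=` past k.+1.
Hypothesis fut_sub : forall k, fut k `<=` past k.+1.
Variables a x : nat -> Omega -> R.
Hypothesis ga : forall k, gen_meas X (past k) (a k).
Hypothesis gx : forall k, gen_meas X (fut k) (x k).
Hypothesis a01 : forall k w, a k w = 0 \/ a k w = 1.
Variables s2 m4 : R.
Hypothesis s2_ge0 : 0 <= s2.
Hypothesis x4 : forall k, intg P (fun w => x k w ^+ 4) /\ \int[P]_w (x k w ^+ 4) <= m4.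
Hypothesis x1 : forall k, \int[P]_w x k w = 0.
Hypothesis x2 : forall k, \int[P]_w (x k w ^+ 2) = s2.

Let S n w : R := \sum_(0 <= k < n) a k w * x k w.
Let N n w : R := \sum_(0 <= k < n) a k w.

Let m4_ge0 : 0 <= m4.
Proof.
have [i le] := x4 0; apply: le_trans le; apply: Rintegral_ge0 => // w _.
by rewrite exprn_even_ge0.
Qed.

Let mx k : measurable_fun setT (x k). Proof. exact: gen_meas_measurable (@gx k). Qed.

Let ix2 k : intg P (fun w => x k w ^+ 2).
Proof.
apply: (intg_le _ (intgD (intg_cst P 1) (x4 k).1)); first exact: measurable_funX.
by move=> w /=; rewrite ger0_norm ?sqr_ge0//; nra.
Qed.

Let ix k : intg P (x k). Proof. exact: intg_sq1. Qed.

Let aN k w : `|a k w| <= 1.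
Proof. by case: (a01 k w) => ->; rewrite ?normr0 ?normr1. Qed.

Let ma k : measurable_fun setT (a k). Proof. exact: gen_meas_measurable (@ga k). Qed.

Let ia k : intg P (a k). Proof. exact: (@intg_bnd _ _ _ _ _ 1 (@ma k) (aN k)). Qed.

Let gS n : gen_meas X (past n) (S n).
Proof.
elim: n => [|n IH].
  rewrite /S (_ : (fun w => _) = cst 0); first exact: measurable_cst.
  by apply/funext => w; rewrite big_geq.
rewrite /S (_ : (fun w => _) = (fun w => S n w + a n w * x n w)); last first.
  by apply/funext => w; rewrite big_nat_recr.
have h1 := gen_meas_sub (@past_sub n) IH.
have h2 := gen_meas_sub (@past_sub n) (@ga n).
have h3 := gen_meas_sub (@fut_sub n) (@gx n).
exact: (measurable_funD h1 (measurable_funM h2 h3)).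
Qed.

Let gN n : gen_meas X (past n) (N n.+1).
Proof.
elim: n => [|n IH].
  rewrite /N (_ : (fun w => _) = a 0); first exact: ga.
  by apply/funext => w; rewrite big_nat1.
rewrite /N (_ : (fun w => _) = (fun w => N n.+1 w + a n.+1 w)); last first.
  by apply/funext => w; rewrite big_nat_recr.
have h1 := gen_meas_sub (@past_sub n) IH.
exact: (measurable_funD h1 (@ga n.+1)).
Qed.

Let mN n : measurable_fun setT (N n).
Proof. by apply: measurable_sum => k; exact: ma. Qed.

Let mS n : measurable_fun setT (S n). Proof. exact: gen_meas_measurable (@gS n). Qed.

Let SS n w : S n.+1 w = S n w + a n w * x n w.
Proof. by rewrite /S big_nat_recr. Qed.

Let NS n w : N n.+1 w = N n w + a n w. Proof. by rewrite /N big_nat_recr. Qed.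

Let indep n f g : gen_meas X (past n) f -> gen_meas X (fut n) g -> intg P f -> intg P g ->
  intg P (fun w => f w * g w) /\ \int[P]_w (f w * g w) = \int[P]_w f w * \int[P]_w g w.
Proof. exact: (Ex_gen_indep Xindep (past_fut n)). Qed.

(** The increments are orthogonal, each being centered given the past. *)
Lemma transform_sqr n : intg P (fun w => S n w ^+ 2) /\
  \int[P]_w (S n w ^+ 2) = s2 * \sum_(0 <= k < n) \int[P]_w a k w.
Proof.
elim: n => [|n [iS ES]].
  rewrite big_geq// mulr0 (_ : (fun w => _) = fun=> 0); last first.
    by apply/funext => w; rewrite /S big_geq// expr0n.
  by split; [exact: intg_cst|rewrite Ex_cst].
have iSn : intg P (S n) by apply: intg_sq1.
have gSa : gen_meas X (past n) (fun w => a n w * S n w).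
  exact: (measurable_funM (@ga n) (@gS n)).
have gx2 : gen_meas X (fut n) (fun w => x n w ^+ 2).
  exact: (measurable_funX 2 (@gx n)).
have [i1 E1] := indep gSa (@gx n) (intg_bndl (@ma n) (aN n) iSn) (@ix n).
have [i2 E2] := indep (@ga n) gx2 (@ia n) (@ix2 n).
have i12 := intgD (intgZ 2 i1) i2.
rewrite (_ : (fun w => _) = fun w => S n w ^+ 2 +
    (2 * (a n w * S n w * x n w) + a n w * x n w ^+ 2)); last first.
  apply/funext => w; rewrite SS; case: (a01 n w) => ->; ring.
split; first exact: intgD.
rewrite ExD// ES ExD//; last exact: intgZ.
by rewrite ExZ// E1 E2 x1 x2 big_nat_recr//=; ring.
Qed.

Section compensated.
Variables (c : R) (al : R).
Hypothesis c_ge0 : 0 <= c.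
Let v := s2 * c ^+ 2 / 2.
Let A n w := expR (v * N n w) * cos (c * S n w + al).

Let v_ge0 : 0 <= v. Proof. by rewrite /v divr_ge0// mulr_ge0// sqr_ge0. Qed.

Let N_ge0 n w : 0 <= N n w.
Proof. by apply: sumr_ge0 => k _; case: (a01 k w) => ->. Qed.

Let N_le n w : N n w <= n%:R.
Proof.
elim: n => [|n IH]; first by rewrite /N big_geq.
rewrite NS -natr1; apply: lerD => //; by case: (a01 n w) => ->.
Qed.

Let mexp : measurable_fun setT (@expR R).
Proof. by apply: continuous_measurable_fun; exact: continuous_expR. Qed.

Let mcos : measurable_fun setT (@cos R).
Proof. by apply: continuous_measurable_fun; exact: continuous_cos. Qed.

Let msin : measurable_fun setT (@sin R).
Proof. by apply: continuous_measurable_fun; exact: continuous_sin. Qed.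

Let E_le n m w : (n <= m)%N -> `|expR (v * N n w)| <= expR (v * m%:R).
Proof.
move=> nm; rewrite ger0_norm ?expR_ge0// ler_expR; apply: ler_wpM2l => //.
by apply: le_trans (N_le n w) _; rewrite ler_nat.
Qed.

Let exp_quad : `|1 - expR (- v) - v| <= v ^+ 2.
Proof.
have h1 := expR_ge1Dx (- v).
have h2 : expR (- v) * (1 + v) <= 1.
  rewrite -[leRHS](@expR0 R) -(subrr v) [v - v]addrC expRD.
  by apply: ler_wpM2l; [exact: expR_ge0|exact: expR_ge1Dx].
have h3 : v * (1 - v) <= v * expR (- v) by apply: ler_wpM2l.
have h4 := sqr_ge0 v; move: h2 h3 h4; rewrite !mulrDr mulrN mulr1 -expr2 [expR _ * v]mulrC.
by rewrite ler_norml => *; apply/andP; split; lra.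
Qed.

Let cos_moment n : intg P (fun w => 1 - cos (c * x n w)) /\
  `|\int[P]_w (1 - cos (c * x n w)) - v| <= c ^+ 4 * m4 / 24.
Proof.
have [i4 l4] := x4 n.
have ic : intg P (fun w => 1 - cos (c * x n w)).
  apply: (@intg_bnd _ _ _ _ _ 2).
    apply: measurable_funB => //; apply: measurableT_comp => //.
    exact: measurable_funM.
  by move=> w; have := cos_geN1 (c * x n w); have := cos_le1 (c * x n w); rewrite ler_norml; lra.
split => //; rewrite /v -(x2 n) -[_ * c ^+ 2 / 2]mulrA mulrC -ExZ//.
apply: le_trans (_ : \int[P]_w (c ^+ 4 / 24 * x n w ^+ 4) <= _).
  apply: Ex_dist_le => //; first exact: intgZ.
    exact: intgZ.
  move=> w; rewrite -normrN; have := cos_taylor4 (c * x n w).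
  rewrite (_ : - (_ - _) = cos (c * x n w) - 1 + (c * x n w) ^+ 2 / 2); last by field.
  by move/le_trans; apply; rewrite le_eqVlt; apply/orP; left; apply/eqP; field.
rewrite ExZ// [leRHS]mulrAC; apply: ler_wpM2l => //.
by rewrite divr_ge0 ?exprn_ge0.
Qed.

Let sin_moment n : intg P (fun w => sin (c * x n w)) /\
  `|\int[P]_w sin (c * x n w)| <= c ^+ 3 * (1 + m4) / 6.
Proof.
have [i4 l4] := x4 n.
have isn : intg P (fun w => sin (c * x n w)).
  apply: (@intg_bnd _ _ _ _ _ 1).
    by apply: measurableT_comp => //; exact: measurable_funM.
  by move=> w; rewrite ler_norml sin_geN1 sin_le1.
split => //; rewrite -[X in `|X|]subr0 -(mulr0 c) -(x1 n) -ExZ//.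
apply: le_trans (_ : \int[P]_w (c ^+ 3 / 6 * (1 + x n w ^+ 4)) <= _).
  apply: Ex_dist_le => //; first exact: intgZ.
    by apply: intgZ; apply: intgD => //; exact: intg_cst.
  move=> w; apply: le_trans (sin_taylor3 _) _.
  rewrite normrM (ger0_norm c_ge0) exprMn mulrAC; apply: ler_wpM2l.
    by rewrite divr_ge0 ?exprn_ge0.
  have -> : x n w ^+ 4 = `|x n w| ^+ 4 by rewrite -normrX ger0_norm// exprn_even_ge0.
  by have := normr_ge0 (x n w); move: `|x n w| => y y0; nra.
have ii : intg P (fun w => 1 + x n w ^+ 4) by apply: intgD => //; exact: intg_cst.
rewrite ExZ// ExD//; last exact: intg_cst.
rewrite Ex_cst -[X in _ <= X]mulrA [X in _ <= _ * X]mulrC mulrA; apply: ler_wpM2l.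
  by rewrite divr_ge0 ?exprn_ge0.
by rewrite lerD2l.
Qed.

(** Compensating the characteristic function by the exponential of the
conditional variance makes it a martingale up to the Taylor remainders. *)
Lemma compensated_step n : `|\int[P]_w A n.+1 w - \int[P]_w A n w| <=
  expR (v * n.+1%:R) * (v ^+ 2 + c ^+ 4 * m4 / 24 + c ^+ 3 * (1 + m4) / 6).
Proof.
pose g (tr : R -> R) w := expR (v * N n.+1 w) * (a n w * tr (c * S n w + al)).
have gg (tr : R -> R) : measurable_fun setT tr -> gen_meas X (past n) (g tr).
  move=> mtr; have h1 := measurableT_comp mexp (measurable_funM (measurable_cst v) (@gN n)).
  have h2 := measurableT_comp mtr (measurable_funD (measurable_funM (measurable_cst c) (@gS n)) (measurable_cst al)).
  exact: (measurable_funM h1 (measurable_funM (@ga n) h2)).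
have gb (tr : R -> R) : (forall y, `|tr y| <= 1) -> forall w, `|g tr w| <= expR (v * n.+1%:R).
  move=> tr1 w; rewrite /g normrM -[leRHS]mulr1; apply: ler_pM => //; first exact: E_le.
  by rewrite normrM -[leRHS]mulr1; apply: ler_pM.
have cb y : `|cos y : R| <= 1 by rewrite ler_norml cos_geN1 cos_le1.
have sb y : `|sin y : R| <= 1 by rewrite ler_norml sin_geN1 sin_le1.
have ig (tr : R -> R) : measurable_fun setT tr -> (forall y, `|tr y| <= 1) -> intg P (g tr).
  move=> mtr tr1; apply: (@intg_bnd _ _ _ _ _ _ _ (gb _ tr1)).
  exact: gen_meas_measurable (@gg _ mtr).
have [ic lc] := cos_moment n; have [isn ls] := sin_moment n.
have gc : gen_meas X (fut n) (fun w => 1 - cos (c * x n w)).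
  have h := measurableT_comp mcos (measurable_funM (measurable_cst c) (@gx n)).
  exact: (measurable_funB (measurable_cst (1 : R)) h).
have gs : gen_meas X (fut n) (fun w => sin (c * x n w)).
  have h := measurable_funM (measurable_cst c) (@gx n).
  exact: (measurableT_comp msin h).
have [i1 E1] := indep (@gg _ mcos) gc (ig _ mcos cb) ic.
have [i2 E2] := indep (@gg _ msin) gs (ig _ msin sb) isn.
have iA m : intg P (A m).
  apply: (@intg_bnd _ _ _ _ _ (expR (v * m%:R))).
    apply: measurable_funM; apply: measurableT_comp => //.
      by apply: measurable_funM => //; exact: mN.
    by apply: measurable_funD => //; apply: measurable_funM => //; exact: mS.
  move=> w; rewrite /A normrM -[leRHS]mulr1; apply: ler_pM => //; exact: E_le.
have dec w : A n.+1 w - A n w = (1 - expR (- v)) * g cos w -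
    (g cos w * (1 - cos (c * x n w)) + g sin w * sin (c * x n w)).
  rewrite /A /g SS; have -> : N n w = N n.+1 w - a n w by rewrite NS addrK.
  case: (a01 n w) => ->; first by rewrite subr0 !mul0r addr0; ring.
  have -> : v * (N n.+1 w - 1) = v * N n.+1 w + - v by ring.
  have -> : c * (S n w + 1 * x n w) + al = (c * S n w + al) + c * x n w by ring.
  by rewrite expRD cosD; ring.
have i12 := intgD i1 i2; have igc := ig _ mcos cb; have igs := ig _ msin sb.
rewrite -ExB//; under eq_Rintegral do rewrite dec.
rewrite ExB//; last exact: intgZ.
rewrite ExZ// ExD// E1 E2.
set Gc := \int[P]_w g cos w; set Gs := \int[P]_w g sin w.
have lGc : `|Gc| <= expR (v * n.+1%:R).
  apply: le_trans (Ex_norm_le igc (intg_cst P (expR (v * n.+1%:R))) (gb _ cb)) _.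
  by rewrite Ex_cst.
have lGs : `|Gs| <= expR (v * n.+1%:R).
  apply: le_trans (Ex_norm_le igs (intg_cst P (expR (v * n.+1%:R))) (gb _ sb)) _.
  by rewrite Ex_cst.
set Ec := \int[P]_w (1 - cos _) in lc *; set Es := \int[P]_w sin _ in ls *.
have -> : (1 - expR (- v)) * Gc - (Gc * Ec + Gs * Es) =
    Gc * ((1 - expR (- v) - v) - (Ec - v)) - Gs * Es by ring.
apply: le_trans (ler_normB _ _) _; rewrite [leRHS]mulrDr; apply: lerD.
  rewrite normrM; apply: ler_pM => //; apply: le_trans (ler_normB _ _) _.
  exact: lerD.
by rewrite normrM; apply: ler_pM.
Qed.

(** Summing the one-step errors: with [c = n^(-1/2)] the bound is of order [n^(-1/2)]. *)
Lemma compensated_cf n : `|\int[P]_w A n w - cos al| <=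
  n%:R * (expR (v * n%:R) * (v ^+ 2 + c ^+ 4 * m4 / 24 + c ^+ 3 * (1 + m4) / 6)).
Proof.
set K := v ^+ 2 + _ + _.
have K0 : 0 <= K.
  by rewrite !addr_ge0 ?sqr_ge0// divr_ge0// mulr_ge0 ?exprn_ge0// addr_ge0.
suff h k : (k <= n)%N -> `|\int[P]_w A k w - cos al| <= k%:R * (expR (v * n%:R) * K) by exact: h.
elim: k => [_|k IH kn].
  rewrite mul0r /A (_ : (fun w => _) = fun=> cos al); last first.
    by apply/funext => w; rewrite /N /S !big_geq// !mulr0 expR0 add0r mul1r.
  by rewrite Ex_cst subrr normr0.
rewrite (_ : _ - _ = (\int[P]_w A k w - cos al) + (\int[P]_w A k.+1 w - \int[P]_w A k w)); last by ring.
apply: le_trans (ler_normD _ _) _; rewrite -natr1 [leRHS]mulrDl mul1r; apply: lerD.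
  by apply: IH; exact: ltnW.
apply: le_trans (compensated_step k) _; apply: ler_wpM2r => //.
by rewrite ler_expR; apply: ler_wpM2l => //; rewrite ler_nat.
Qed.

End compensated.

Let exp_lip (M y z : R) : y <= M -> z <= M -> `|expR y - expR z| <= expR M * `|y - z|.
Proof.
wlog yz : y z / z <= y => [H yM zM|yM _].
  have [|/ltW] := leP z y; first by move/H; apply.
  by rewrite distrC [`|y - z|]distrC => /H; apply.
rewrite !ger0_norm ?subr_ge0 ?ler_expR//.
have h1 := expR_ge1Dx (z - y); have h2 := expR_gt0 y.
have h3 : expR z = expR y * expR (z - y) by rewrite -expRD; congr expR; ring.
have h4 : expR y * (1 + (z - y)) <= expR z by rewrite h3; apply: ler_wpM2l => //; exact: ltW.
have h5 : expR y * (y - z) <= expR M * (y - z).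
  by apply: ler_wpM2r; rewrite ?subr_ge0// ler_expR.
lra.
Qed.

Lemma cvg_invsqrtn : ((Num.sqrt n%:R)^-1 : R) @[n --> \oo] --> (0 : R).
Proof.
rewrite -(sqrtr0 R) (_ : (fun n => _) = fun n : nat => Num.sqrt (n%:R^-1 : R)); last first.
  by apply/funext => n; rewrite sqrtrV.
apply: (cvg_comp _ _ (@cvg_invn R)); exact: sqrt_continuous.
Qed.

(** With [c = n^(-1/2)] the compensator is the exponential of [s2 / 2] times the observed
frequency. The ergodic hypothesis makes it asymptotically constant, so that it can
be divided out of the martingale limit. *)
Lemma transform_cf_cvg (p al : R) : 0 <= p <= 1 ->
  \int[P]_w `|(\sum_(0 <= k < n) a k w) / n%:R - p| @[n --> \oo] --> (0 : R) ->
  \int[P]_w cos ((Num.sqrt n%:R)^-1 * (\sum_(0 <= k < n) a k w * x k w) + al) @[n --> \oo] -->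
    expR (- (s2 * p / 2)) * cos al.
Proof.
move=> /andP[p0 p1] ergodic.
pose c (n : nat) : R := (Num.sqrt n%:R)^-1.
have c0 n : 0 <= c n by rewrite invr_ge0 sqrtr_ge0.
have cn n : (0 < n)%N -> n%:R * c n ^+ 2 = 1.
  by move=> n0; rewrite /c exprVn sqr_sqrtr// mulfV// pnatr_eq0 -lt0n.
pose D n := expR (s2 / 2) * (c n ^+ 2 * (s2 ^+ 2 / 4) + c n ^+ 2 * (m4 / 24) + c n * ((1 + m4) / 6)) +
  expR (s2 / 2) * (s2 / 2) * \int[P]_w `|N n w / n%:R - p|.
have Dcvg : D n @[n --> \oo] --> (0 : R).
  have -> : (0 : R) = expR (s2 / 2) * (0 ^+ 2 * (s2 ^+ 2 / 4) + 0 ^+ 2 * (m4 / 24) + 0 * ((1 + m4) / 6)) +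
    expR (s2 / 2) * (s2 / 2) * 0 by rewrite expr0n/= !mul0r !addr0 !mulr0 addr0.
  have c2 : c n ^+ 2 @[n --> \oo] --> (0 ^+ 2 : R) by rewrite !expr2; apply: cvgM; exact: cvg_invsqrtn.
  apply: cvgD; last exact: cvgMl_tmp.
  apply: cvgMl_tmp; apply: cvgD; last by apply: cvgMr_tmp; exact: cvg_invsqrtn.
  by apply: cvgD; exact: cvgMr_tmp.
have mcos : measurable_fun setT (@cos R).
  by apply: continuous_measurable_fun; exact: continuous_cos.
have mexp : measurable_fun setT (@expR R).
  by apply: continuous_measurable_fun; exact: continuous_expR.
have mcS n : measurable_fun setT (fun w => cos (c n * S n w + al)).
  by apply: measurableT_comp => //; apply: measurable_funD => //; exact: measurable_funM.
have icS n : intg P (fun w => cos (c n * S n w + al)).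
  by apply: (@intg_bnd _ _ _ _ _ 1) => // w; rewrite ler_norml cos_geN1 cos_le1.
have N0 n w : 0 <= N n w by apply: sumr_ge0 => k _; case: (a01 k w) => ->.
have Nn n w : N n w <= n%:R.
  elim: n => [|n IH]; first by rewrite /N big_geq.
  by rewrite NS -natr1; apply: lerD => //; case: (a01 n w) => ->.
have Nn1 n w : N n w / n%:R <= 1.
  by case: n => [|n]; [rewrite invr0 mulr0|rewrite ler_pdivrMr ?mul1r].
apply/subr_cvg0/norm_cvg0P.
apply: (@squeeze_cvgr _ _ _ _ (fun=> 0) D) => //; last exact: cvg_cst.
near=> n; rewrite normr_ge0/=.
have n0 : (0 < n)%N by near: n; exists 1.
set E := \int[P]_w cos _; rewrite -/(S n) in E *.
have -> : E - expR (- (s2 * p / 2)) * cos al =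
    expR (- (s2 * p / 2)) * (expR (s2 * p / 2) * E - cos al).
  by rewrite mulrBr mulrA -expRD addNr expR0 mul1r.
rewrite normrM ger0_norm ?expR_ge0// -[leRHS]mul1r; apply: ler_pM => //.
  by rewrite -[leRHS](@expR0 R) ler_expR lerNl oppr0 divr_ge0// mulr_ge0.
pose An := \int[P]_w (expR (s2 * c n ^+ 2 / 2 * N n w) * cos (c n * S n w + al)).
(* An carries the random compensator, the left-hand side its deterministic limit. *)
have -> : expR (s2 * p / 2) * E - cos al = (An - cos al) + (expR (s2 * p / 2) * E - An) by ring.
apply: le_trans (ler_normD _ _) _; apply: lerD.
  apply: le_trans (compensated_cf al (c0 n) n) _.
  have e1 : s2 * c n ^+ 2 / 2 * n%:R = s2 / 2.
    by transitivity (s2 / 2 * (n%:R * c n ^+ 2)); [ring|rewrite cn// mulr1].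
  rewrite e1 mulrCA le_eqVlt; apply/orP; left; apply/eqP; congr (_ * _).
  transitivity (n%:R * c n ^+ 2 * (c n ^+ 2 * (s2 ^+ 2 / 4) + c n ^+ 2 * (m4 / 24) + c n * ((1 + m4) / 6))).
    by field.
  by rewrite cn// mul1r.
have e1 w : s2 * c n ^+ 2 / 2 * N n w = s2 / 2 * (N n w / n%:R).
  have -> : (n%:R)^-1 = c n ^+ 2 by rewrite /c exprVn sqr_sqrtr.
  by field.
have iA : intg P (fun w => expR (s2 * c n ^+ 2 / 2 * N n w) * cos (c n * S n w + al)).
  apply: (@intg_bnd _ _ _ _ _ (expR (s2 / 2))).
    by apply: measurable_funM => //; apply: measurableT_comp => //; exact: measurable_funM.
  move=> w; rewrite normrM -[leRHS]mulr1; apply: ler_pM => //.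
    rewrite ger0_norm ?expR_ge0// ler_expR e1 -[leRHS]mulr1; apply: ler_wpM2l => //.
    exact: divr_ge0.
  by rewrite ler_norml cos_geN1 cos_le1.
have iN : intg P (fun w => `|N n w / n%:R - p|).
  apply: intg_norm; apply: intgB; last exact: intg_cst.
  rewrite (_ : (fun w => _) = fun w => n%:R^-1 * N n w); last by apply/funext => w; rewrite mulrC.
  by apply: intgZ; apply: intg_sum => k; exact: ia.
have -> : expR (s2 * p / 2) * E = \int[P]_w (expR (s2 * p / 2) * cos (c n * S n w + al)).
  exact/esym/ExZ/icS.
rewrite -ExZ//.
apply: Ex_dist_le; [exact: (intgZ _ (icS n))|exact: iA|exact: intgZ|].
move=> w; rewrite -mulrBl normrM -[leRHS]mulr1; apply: ler_pM => //; last first.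
  by rewrite ler_norml cos_geN1 cos_le1.
rewrite e1 [s2 * p / 2]mulrAC distrC; apply: le_trans (@exp_lip (s2 / 2) _ _ _ _) _.
- by rewrite -[leRHS]mulr1; apply: ler_wpM2l => //; exact: divr_ge0.
- by rewrite -[leRHS]mulr1; apply: ler_wpM2l => //; exact: divr_ge0.
rewrite -mulrBr normrM (@ger0_norm _ (s2 / 2)) ?divr_ge0// -[leRHS]mulrA; exact: lexx.
Unshelve. all: by end_near. Qed.

End martingale_clt.

(** * The autoregressive process as a function of its innovations *)

Section contraction.
Context (R : realType) (H : completeNormedModType R).

Lemma opnorm_contraction (f : {linear H -> H}) : (opnorm f < 1)%E ->
  exists r : R, 0 <= r < 1 /\ forall u, `|f u| <= r * `|u|.
Proof.
move=> f1; pose r := fine (opnorm f).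
have f0 : (0 <= opnorm f)%E.
  apply: (@ereal_sup_ubound _ [set `|f u|%:E | u in [set u : H | `|u| <= 1]]).
  by exists 0; rewrite /= ?normr0// linear0 normr0.
have fr : opnorm f = r%:E.
  by rewrite /r fineK// ge0_fin_numE// (lt_trans f1)// ltry.
exists r; split; first by rewrite -lee_fin -lte_fin -fr f0.
move=> u; have [->|u0] := eqVneq u 0; first by rewrite linear0 !normr0 mulr0.
have nu : 0 < `|u| by rewrite normr_gt0.
have : (`|f (`|u|^-1 *: u)|%:E <= opnorm f)%E.
  apply: (@ereal_sup_ubound _ [set `|f u|%:E | u in [set u : H | `|u| <= 1]]).
  exists (`|u|^-1 *: u) => //=.
  by rewrite normrZ normfV normr_id mulVf// gt_eqF.
rewrite fr lee_fin linearZ normrZ normfV normr_id => h.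
by rewrite -ler_pdivrMr// mulrC.
Qed.

End contraction.

Section same_law.
Context d (Omega : measurableType d) (R : realType) (P : probability Omega R).
Context d1 (T : measurableType d1) (X X' : {RV P >-> T}).
Hypothesis XX' : forall A, measurable A -> P (X @^-1` A) = P (X' @^-1` A).

Lemma intg_same_law (f : T -> R) : measurable_fun setT f ->
  intg P (f \o X) -> intg P (f \o X').
Proof.
move=> mf i1.
have m' : measurable_fun setT (f \o X') by exact: measurableT_comp.
apply/integrableP; split; first exact/measurable_EFinP.
have mf' : measurable_fun setT (fun y => `|(f y)%:E|%E).
  by apply/measurableT_comp => //; exact/measurable_EFinP.
have := ge0_integral_distribution X' mf' (fun=> abse_ge0 _); rewrite /= => <-.
case/integrableP : i1 => _; have := ge0_integral_distribution X mf' (fun=> abse_ge0 _).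
rewrite /= => <-; congr (_ < _)%E; apply: eq_measure_integral => A mA _; exact: XX'.
Qed.

Lemma Ex_same_law (f : T -> R) : measurable_fun setT f ->
  intg P (f \o X) -> \int[P]_w f (X w) = \int[P]_w f (X' w).
Proof.
move=> mf i1; rewrite -(Ex_law mf i1) -(Ex_law mf (intg_same_law mf i1)).
by congr fine; apply: eq_measure_integral => A mA _; exact: XX'.
Qed.

End same_law.

Lemma expectation_intg d (T : measurableType d) (R : realType) (P : probability T R)
    (f : T -> R) : measurable_fun setT f -> (forall w, 0 <= f w) ->
  ('E_P[f] < +oo)%E -> intg P f.
Proof.
move=> mf f0; rewrite unlock => fi; apply/integrableP; split; first exact/measurable_EFinP.
by under eq_integral => w _ do rewrite /= ger0_norm//.
Qed.

Section gen_hilbert.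
Context (R : realType) (H : completeNormedModType R) (ip : {dot H for idfun}).
Variable phi : nat -> H.
Hypothesis hip : inner_product ip.
Hypothesis hsep : separable H.
Hypothesis hphi : orthonormal_basis ip phi.
Context d (Omega : measurableType d) (P : probability Omega R).
Context (I : choiceType) d1 (T : measurableType d1) (X : I -> {RV P >-> T}).
Local Notation hgen S f := (gen_meas X S (f : Omega -> borel H)).

Lemma hgen_ip S (f : Omega -> H) h : hgen S f -> gen_meas X S (fun w => ip (f w) h).
Proof. exact: (@measurable_ip _ _ _ hip _ (gen_by X S)). Qed.

Lemma hgen_coord S (f : Omega -> H) :
  (forall j, gen_meas X S (fun w => ip (f w) (phi j))) -> hgen S f.
Proof. exact: (@measurable_coord _ _ hsep _ hip _ hphi _ (gen_by X S)). Qed.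

Lemma hgenD S (f g : Omega -> H) : hgen S f -> hgen S g -> hgen S (fun w => f w + g w).
Proof.
move=> hf hg; apply: hgen_coord => j.
rewrite (_ : (fun w => _) = fun w => ip (f w) (phi j) + ip (g w) (phi j)); last first.
  by apply/funext => w; rewrite ipDl.
exact: (measurable_funD (@hgen_ip _ _ (phi j) hf) (@hgen_ip _ _ (phi j) hg)).
Qed.

Lemma measurable_continuous_borel (g : H -> H) : continuous g ->
  measurable_fun setT (g : borel H -> borel H).
Proof.
move=> cg; apply: (measurable_coord hsep hip hphi) => j.
apply: (measurable_id_borel (f := fun x => ip (g x) (phi j))) => x.
apply: (continuous_comp (f := g) (g := fun y => ip y (phi j))); first exact: cg.
exact: ip_continuous.
Qed.

Lemma hgen_comp S (f : Omega -> H) (g : H -> H) : continuous g ->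
  hgen S f -> hgen S (fun w => g (f w)).
Proof.
by move=> cg hf; exact: (measurableT_comp (@measurable_continuous_borel g cg) hf).
Qed.

End gen_hilbert.

Lemma geometric_sum_le (R : realType) (r : R) n : 0 <= r < 1 ->
  \sum_(0 <= k < n) r ^+ k <= (1 - r)^-1.
Proof.
move=> /andP[r0 r1]; have r1' : 0 < 1 - r by rewrite subr_gt0.
rewrite -[leRHS]mul1r ler_pdivlMr//.
have -> : (\sum_(0 <= k < n) r ^+ k) * (1 - r) = 1 - r ^+ n.
  elim: n => [|n IH]; first by rewrite big_geq// mul0r expr0 subrr.
  by rewrite big_nat_recr//= mulrDl IH exprS; ring.
by rewrite gerBl exprn_ge0.
Qed.

Section arh.
Context (R : realType) (H : completeNormedModType R) (ip : {dot H for idfun}).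
Variable phi : nat -> H.
Hypothesis hip : inner_product ip.
Hypothesis hsep : separable H.
Hypothesis hphi : orthonormal_basis ip phi.
Context d (Omega : measurableType d) (P : probability Omega R).
Variables (Gamma : {linear H -> H}) (eps Y : int -> {RV P >-> borel H}).
Hypothesis harh : arh1 ip Gamma eps Y.
Local Notation hgen S f := (gen_meas eps S (f : Omega -> borel H)).

Lemma eps_independent : mutually_independent P eps.
Proof. by have [_ [h _ _ _] _ _ _] := harh. Qed.

Let Gamma_continuous : continuous Gamma. Proof. by have [[h _] _ _ _ _] := harh. Qed.

Lemma eps_same_law s t (A : set (borel H)) : measurable A ->
  P (eps s @^-1` A) = P (eps t @^-1` A).
Proof. by have [_ [_ h _ _] _ _ _] := harh; exact: h. Qed.

Lemma Y_same_law s t (A : set (borel H)) : measurable A ->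
  P (Y s @^-1` A) = P (Y t @^-1` A).
Proof.
have [_ _ _ h _] := harh => mA.
have := h (s - t) [:: t] (fun=> A) (fun=> mA).
have b (f : int -> set Omega) : \bigcap_(i in [set` [:: t]]) f i = f t.
  apply/seteqP; split => w /=; first by apply; rewrite /= inE.
  by move=> fw i /=; rewrite inE => /eqP ->.
by rewrite !b subrKC.
Qed.

Lemma measurable_norm (X : {RV P >-> borel H}) : measurable_fun setT (fun w => `|X w : H|).
Proof.
apply: (measurable_continuous (f := fun x : H => `|x|)) => //; exact: norm_continuous.
Qed.

Lemma eps_ip_meas t h : measurable_fun setT (fun w => ip (eps t w) h).
Proof. exact: (measurable_ip hip). Qed.

Lemma eps_sqr t : intg P (fun w => `|eps t w : H| ^+ 2).
Proof.
have [_ [_ _ _ h] _ _ _] := harh; apply: (expectation_intg _ _ (h t)).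
  exact/measurable_funX/measurable_norm.
by move=> w; exact: sqr_ge0.
Qed.

Lemma Y_sqr t : intg P (fun w => `|Y t w : H| ^+ 2).
Proof.
have [_ _ _ _ h] := harh; apply: (expectation_intg _ _ (h t).2).
  exact/measurable_funX/measurable_norm.
by move=> w; exact: sqr_ge0.
Qed.

Lemma Y_intg t : intg P (fun w => `|Y t w : H|).
Proof. apply: intg_sq1; [exact: measurable_norm|exact: Y_sqr]. Qed.

Lemma Y_mean_norm t : \int[P]_w `|Y t w : H| = \int[P]_w `|Y 0 w : H|.
Proof.
apply: (Ex_same_law (f := fun x : borel H => `|x : H|) (@Y_same_law t 0)); last exact: Y_intg.
apply: measurable_id_borel; exact: norm_continuous.
Qed.

Lemma ip_sqr_le (x u : H) : ip x u ^+ 2 <= `|u| ^+ 2 * `|x| ^+ 2.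
Proof.
rewrite -exprMn -(@real_normK _ (ip x u)) ?num_real// lerXn2r ?nnegrE ?mulr_ge0//.
by rewrite mulrC ip_norm.
Qed.

Lemma eps_ip_sqr t u : intg P (fun w => ip (eps t w) u ^+ 2).
Proof.
apply: (intg_le _ (intgZ (`|u| ^+ 2) (eps_sqr t))).
  exact/measurable_funX/eps_ip_meas.
by move=> w; rewrite ger0_norm ?sqr_ge0//; exact: ip_sqr_le.
Qed.

Lemma eps_ip_mean t u : \int[P]_w ip (eps t w) u = 0.
Proof.
have [_ [_ _ h _] _ _ _] := harh.
have i : intg P (fun w => ip (eps t w) u).
  by apply: intg_sq1; [exact: eps_ip_meas|exact: eps_ip_sqr].
by have := h t u; rewrite expectationE// ip0l => -[].
Qed.

Definition noise_cov u v := \int[P]_w (ip (eps 0 w) u * ip (eps 0 w) v).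
Local Notation q := noise_cov.

Let iq t u v : intg P (fun w => ip (eps t w) u * ip (eps t w) v).
Proof. by apply: intgM; by [exact: eps_ip_meas|exact: eps_ip_sqr]. Qed.

Lemma noise_cov_sym u v : q u v = q v u.
Proof. by rewrite /q; under eq_Rintegral do rewrite mulrC. Qed.

Lemma noise_cov_lin c u v w : q (c *: u + v) w = c * q u w + q v w.
Proof.
rewrite /q -ExZ// -ExD//; last exact: intgZ.
by apply: eq_Rintegral => x _; rewrite ipDr ipZr; ring.
Qed.

Lemma noise_cov_psd u : 0 <= q u u.
Proof. by apply: Rintegral_ge0 => // w _; rewrite -expr2 sqr_ge0. Qed.

Let M := \int[P]_w (`|eps 0 w : H| ^+ 2).

Lemma noise_cov_bounded u v : `|q u v| <= M * (`|u| * `|v|).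
Proof.
rewrite mulrC -ExZ; last exact: eps_sqr.
apply: Ex_norm_le => //; first by apply: intgZ; exact: eps_sqr.
move=> w; rewrite normrM expr2 mulrACA.
by apply: ler_pM => //; rewrite mulrC ip_norm.
Qed.

Lemma noise_cov_trace n : \sum_(0 <= k < n) q (phi k) (phi k) <= M.
Proof.
rewrite /q -Ex_sum//; apply: Ex_le => //; [exact: intg_sum|exact: eps_sqr|].
move=> w; exact: (bessel hip hphi n (eps 0 w)).
Qed.

Lemma noise_cov_eps t u : \int[P]_w (ip (eps t w) u ^+ 2) = q u u.
Proof.
apply: (Ex_same_law (f := fun x : borel H => ip (x : H) u ^+ 2) (@eps_same_law t 0)).
  by apply: measurable_funX; apply: (measurable_ip hip (X := id)).
exact: eps_ip_sqr.
Qed.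

(** Riesz representation supplies a solution of the weak equation, and any solution
has the stated inner products. *)
Lemma ip_autocov h h' : ip (autocov P ip (eps 0) h) h' = q h h'.
Proof.
have M0 : 0 <= M * `|h|.
  by rewrite mulr_ge0// /M; apply: Rintegral_ge0 => // w _; exact: sqr_ge0.
have [|u|m hm] := @riesz_representation _ _ _ hip _ hphi (q h) _ M0.
- by move=> c u v; rewrite noise_cov_sym noise_cov_lin !(noise_cov_sym h).
- by rewrite -mulrA; exact: noise_cov_bounded.
have e u : 'E_P[fun w => ip (ip (eps 0 w) h *: (eps 0 w : H)) u]%E = (q h u)%:E.
  rewrite (_ : (fun w => _) = fun w => ip (eps 0 w) h * ip (eps 0 w) u).
    by rewrite expectationE.
  by apply/funext => w; rewrite ipZl.
have ex : [set m | has_expectation P ip (fun w => ip (eps 0 w) h *: (eps 0 w : H)) m] !=set0.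
  by exists m => u; rewrite e hm.
have := xgetPex 0 ex h'; rewrite -[X in ip X h']/(autocov P ip (eps 0) h) e.
by case.
Qed.

Lemma eps_fourth u : ('E_P[(fun w => `|(eps 1 w : H)| ^+ 4)%R] < +oo)%E ->
  exists m4, forall t, intg P (fun w => ip (eps t w) u ^+ 4) /\
    \int[P]_w (ip (eps t w) u ^+ 4) <= m4.
Proof.
move=> h.
have i4 : intg P (fun w => `|(eps 1 w : H)| ^+ 4).
  apply: (expectation_intg _ _ h); first exact/measurable_funX/measurable_norm.
  by move=> w; exact: exprn_ge0.
have m1 : measurable_fun setT (fun x : borel H => ip (x : H) u ^+ 4).
  by apply: measurable_funX; apply: (measurable_ip hip (X := id)).
have i1 : intg P (fun w => ip (eps 1 w) u ^+ 4).
  apply: (intg_le _ (intgZ (`|u| ^+ 4) i4)); first exact/measurable_funX/eps_ip_meas.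
  by move=> w; rewrite normrX -exprMn lerXn2r ?nnegrE ?mulr_ge0// mulrC ip_norm.
exists (\int[P]_w (ip (eps 1 w) u ^+ 4)) => t; split.
  exact: (intg_same_law (@eps_same_law 1 t) m1).
by rewrite (Ex_same_law (@eps_same_law 1 t) m1).
Qed.

Definition noise_sum (m : nat) (s : int) (w : Omega) : H :=
  \sum_(0 <= k < m) iter k Gamma (eps (s - k%:Z) w).

Lemma iterD m u v : iter m Gamma (u + v) = iter m Gamma u + iter m Gamma v.
Proof. by elim: m => //= m ->; rewrite linearD. Qed.

Lemma iter_continuous m : continuous (iter m Gamma).
Proof.
elim: m => [|m IH] x; first exact: cvg_id.
by apply: (continuous_comp (f := iter m Gamma)); [exact: IH|exact: Gamma_continuous].
Qed.

Lemma Y_noise_sum m s : {ae P, forall w,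
  (Y s w : H) = noise_sum m s w + iter m Gamma (Y (s - m%:Z) w)}.
Proof.
have [_ _ h _ _] := harh.
elim: m => [|m IH].
  by apply: nearW => w; rewrite /noise_sum big_geq// add0r subr0.
have -> : s - m.+1%:Z = s - m%:Z - 1 by lia.
have := h (s - m%:Z); apply: filterS2 IH => w -> {1}->.
by rewrite /noise_sum big_nat_recr//= iterD -iterSr [iter _ _ _ + iter _ _ _]addrC addrA /=.
Qed.

Lemma hgen_noise_sum m s : hgen [set t | s - m%:Z < t <= s] (noise_sum m s).
Proof.
elim: m => [|m IH].
  rewrite /noise_sum (_ : (fun w => _) = cst 0); first exact: measurable_cst.
  by apply/funext => w; rewrite big_geq.
rewrite /noise_sum (_ : (fun w => _) = fun w => noise_sum m s w + iter m Gamma (eps (s - m%:Z) w)); last first.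
  by apply/funext => w; rewrite big_nat_recr.
apply: (hgenD hip hsep hphi).
  by apply: (gen_meas_sub _ IH) => t /=; lia.
apply: (hgen_comp hip hsep hphi (@iter_continuous m)).
by apply: gen_meas_self => /=; lia.
Qed.

Variable r : R.
Hypothesis r01 : 0 <= r < 1.
Hypothesis Gamma_r : forall u, `|Gamma u| <= r * `|u|.

Let r0 : 0 <= r. Proof. by case/andP: r01. Qed.

Lemma iter_contraction m u : `|iter m Gamma u| <= r ^+ m * `|u|.
Proof.
elim: m => [|m IH] /=; first by rewrite mul1r.
apply: le_trans (Gamma_r _) _; rewrite exprS -mulrA; exact: ler_wpM2l.
Qed.

Let past_vanishes s : {ae P, forall w,
  r ^+ m * `|Y (s - m%:Z) w : H| @[m --> \oo] --> (0 : R)}.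
Proof.
have i n : intg P (fun w => r ^+ n * `|Y (s - n%:Z) w : H|) by apply: intgZ; exact: Y_intg.
have nn n w : 0 <= r ^+ n * `|Y (s - n%:Z) w : H| by rewrite mulr_ge0 ?exprn_ge0.
have [|Good [mG PG hG]] := @ae_bounded_sums _ _ _ _ _
    ((1 - r)^-1 * \int[P]_w `|Y 0 w : H|) i nn.
  move=> n; under eq_bigr do rewrite ExZ ?Y_intg// Y_mean_norm.
  rewrite -mulr_suml; apply: ler_wpM2r; first exact: Rintegral_ge0.
  exact: geometric_sum_le.
exists (~` Good); split => //; first exact: measurableC.
move=> w /= nw wG; apply: nw; have [K hK] := hG w wG.
apply: cvg_series_cvg_0; apply: nondecreasing_is_cvgn.
  by apply/nondecreasing_seqP => n; rewrite /series/= big_nat_recr//= lerDl.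
by exists K => _ [n _ <-]; exact: hK.
Qed.

(** The state is the almost sure limit of its partial noise sums, since the expected
norms of the remainders [iter m Gamma (Y (s - m))] are summable. *)
Lemma Y_gen s : hgen [set t | t <= s] (Y s).
Proof.
apply: (hgen_coord hip hsep hphi) => j.
apply: (@gen_meas_cvg _ _ _ _ _ _ _ _ _ (fun m w => ip (noise_sum m s w) (phi j))).
- move=> m; apply: hgen_ip => //.
  by apply: (gen_meas_sub _ (@hgen_noise_sum m s)) => t /= /andP[].
- exact: (measurable_ip hip).
have all : {ae P, forall w, forall m, (Y s w : H) = noise_sum m s w + iter m Gamma (Y (s - m%:Z) w)}.
  by apply/ae_foralln => m; exact: Y_noise_sum.
have := past_vanishes s; apply: filterS2 all => w Yw cw.
apply/subr_cvg0/norm_cvg0P; apply: (@squeeze_cvgr _ _ _ _ (fun=> 0) _ _ _ 0 _ cw); last exact: cvg_cst.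
apply: nearW => m; rewrite normr_ge0/= -ipBl [in X in `|X|](Yw m) opprD addrA subrr add0r ipNl normrN.
apply: le_trans (ip_norm hip _ _) _; rewrite (phi_norm hip hphi) mulr1.
exact: iter_contraction.
Qed.

Lemma Y_indic_gen s (E : set (borel H)) : measurable E ->
  gen_meas eps [set t | t <= s] (fun w => \1_E (Y s w) : R).
Proof.
move=> mE; have mi : measurable_fun setT (\1_E : borel H -> R) by exact: measurable_indic.
exact: (measurableT_comp mi (@Y_gen s)).
Qed.

End arh.

(** * Ergodic averages *)

Section ergodic.
Context (R : realType) (H : completeNormedModType R) (ip : {dot H for idfun}).
Variable phi : nat -> H.
Hypothesis hip : inner_product ip.
Hypothesis hsep : separable H.
Hypothesis hphi : orthonormal_basis ip phi.
Context d (Omega : measurableType d) (P : probability Omega R).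
Variables (Gamma : {linear H -> H}) (eps Y : int -> {RV P >-> borel H}).
Hypothesis harh : arh1 ip Gamma eps Y.
Variable r : R.
Hypothesis r01 : 0 <= r < 1.
Hypothesis Gamma_r : forall u, `|Gamma u| <= r * `|u|.

Lemma mean_Y (f : H -> R) s : measurable_fun setT (f : borel H -> R) ->
  intg P (fun w => f (Y 0 w)) -> \int[P]_w f (Y s w) = \int[P]_w f (Y 0 w).
Proof.
by move=> mf i; rewrite (Ex_same_law (f := f : borel H -> R) (Y_same_law harh 0 s)).
Qed.

Section lipschitz.
Variables (f : H -> R) (B L : R).
Hypothesis fB : forall x, `|f x| <= B.
Hypothesis L_ge0 : 0 <= L.
Hypothesis fL : forall x y, `|f x - f y| <= L * `|x - y|.

Let B0 : 0 <= B. Proof. exact: le_trans (fB 0). Qed.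
Let cf : continuous f. Proof. exact: lip_continuous L_ge0 fL. Qed.
Let mf : measurable_fun setT (f : borel H -> R). Proof. exact: measurable_id_borel. Qed.
Let mY t : measurable_fun setT (fun w => f (Y t w)). Proof. exact: measurableT_comp. Qed.
Let iY t : intg P (fun w => f (Y t w)). Proof. exact: (@intg_bnd _ _ _ _ _ B). Qed.
Let c := \int[P]_w f (Y 0 w).
Let X t w := f (Y t w) - c.

Let cB : `|c| <= B.
Proof.
apply: le_trans (Ex_norm_le (iY 0) (intg_cst P B) _) _ => //.
by rewrite Ex_cst.
Qed.

Let XB t w : `|X t w| <= 2 * B.
Proof. by apply: le_trans (ler_normB _ _) _; rewrite mulr2n mulrDl mul1r; exact: lerD. Qed.

Let iX t : intg P (X t). Proof. by apply: intgB => //; exact: intg_cst. Qed.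

Let X0 t : \int[P]_w X t w = 0.
Proof. by rewrite ExB//; [rewrite Ex_cst mean_Y// subrr|exact: intg_cst]. Qed.

Let iXX s t : intg P (fun w => X s w * X t w).
Proof. by apply: (@intg_bndl _ _ _ _ (2 * B)) => //; exact: intg_meas (iX s). Qed.

Let K := 2 * B * L * \int[P]_w `|Y 0 w : H|.

Let K0 : 0 <= K. Proof. by rewrite !mulr_ge0//; exact: Rintegral_ge0. Qed.

(** Up to an error of size [r ^+ m], the state at time [i + m] is a function of
the innovations after time [i]. *)
Lemma decorrelation (i : int) (m : nat) :
  `|\int[P]_w (X i w * X (i + m%:Z) w)| <= K * r ^+ m.
Proof.
pose Z := noise_sum Gamma eps m (i + m%:Z).
have gZ : gen_meas eps [set t | i < t <= i + m%:Z] (Z : Omega -> borel H).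
  have := @hgen_noise_sum _ _ _ _ hip hsep hphi _ _ _ _ _ _ harh m (i + m%:Z).
  by apply: gen_meas_sub => t /=; rewrite addrK.
have mZ : measurable_fun setT (Z : Omega -> borel H) := gen_meas_measurable gZ.
have gY := @Y_gen _ _ _ _ hip hsep hphi _ _ _ _ _ _ harh _ r01 Gamma_r i.
have gX : gen_meas eps [set t | t <= i] (X i).
  exact: (measurable_funB (measurableT_comp mf gY) (measurable_cst c)).
have gfZ : gen_meas eps [set t | i < t <= i + m%:Z] (fun w => f (Z w) - c).
  exact: (measurable_funB (measurableT_comp mf gZ) (measurable_cst c)).
have ifZ : intg P (fun w => f (Z w) - c).
  apply: (@intg_bnd _ _ _ _ _ (2 * B)); first exact: gen_meas_measurable gfZ.
  by move=> w; apply: le_trans (ler_normB _ _) _; rewrite mulr2n mulrDl mul1r; exact: lerD.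
have dis : [set t | t <= i] `&` [set t | i < t <= i + m%:Z] = set0.
  by apply/seteqP; split => // t [/= h1 /andP[h2 _]]; move: h1 h2; lia.
have [i1 E1] := Ex_gen_indep (eps_independent harh) dis gX gfZ (@iX i) ifZ.
rewrite X0 mul0r in E1.
have rest_i : intg P (fun w => X i w * X (i + m%:Z) w - X i w * (f (Z w) - c)).
  exact: intgB.
rewrite -[X in `|X|]subr0 -E1 -ExB//.
have -> : K * r ^+ m = \int[P]_w (2 * B * (L * (r ^+ m * `|Y i w : H|))).
  do 3 (rewrite ExZ; last by do ?apply: intgZ; exact: (Y_intg harh)).
  by rewrite (Y_mean_norm harh) /K; ring.
pose rest w := X i w * (f (Z w + iter m Gamma (Y i w)) - f (Z w)).
(* The recursion holds almost everywhere, hence the everywhere defined rest. *)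
have ae : {ae P, forall w, X i w * X (i + m%:Z) w - X i w * (f (Z w) - c) = rest w}.
  have := @Y_noise_sum _ _ _ _ _ _ _ _ _ harh m (i + m%:Z).
  apply: filterS => w e; rewrite /rest -mulrBr /X e addrK; congr (_ * _); ring.
have bnd w : `|rest w| <= 2 * B * (L * (r ^+ m * `|Y i w : H|)).
  rewrite /rest normrM; apply: ler_pM => //; apply: le_trans (fL _ _) _.
  by apply: ler_wpM2l => //; rewrite addrAC subrr add0r; exact: iter_contraction.
have mrest : measurable_fun setT rest.
  have mit : measurable_fun setT (fun w => Z w + iter m Gamma (Y i w) : borel H).
    apply: (@gen_meas_measurable _ _ _ _ _ _ _ eps _ _ setT).
    apply: (hgenD hip hsep hphi); first exact: gen_meas_sub gZ.
    apply: (hgen_comp hip hsep hphi (@iter_continuous _ _ _ _ _ _ _ _ _ harh m)).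
    exact: gen_meas_sub gY.
  apply: measurable_funM; first exact: intg_meas (iX i).
  apply: measurable_funB; first exact: (measurableT_comp mf mit).
  exact: (measurableT_comp mf mZ).
rewrite (Ex_ae_eq (intg_meas rest_i) mrest ae).
have ib : intg P (fun w => 2 * B * (L * (r ^+ m * `|Y i w : H|))).
  by do 3 apply: intgZ; exact: (Y_intg harh).
apply: Ex_norm_le => //; exact: intg_le ib bnd.
Qed.

Let Ssum n w := \sum_(0 <= k < n) X k%:Z w.
Let C := 4 * B ^+ 2 + 2 * (K * (1 - r)^-1).

(** By the geometric decorrelation each new term adds a bounded amount to the variance. *)
Lemma centered_sum_sqr n : intg P (fun w => Ssum n w ^+ 2) /\
  \int[P]_w (Ssum n w ^+ 2) <= n%:R * C.
Proof.
have iS n' : intg P (Ssum n') by apply: intg_sum => k; exact: iX.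
have iSX n' : intg P (fun w => Ssum n' w * X n'%:Z w).
  rewrite (_ : (fun w => _) = fun w => \sum_(0 <= k < n') X k%:Z w * X n'%:Z w).
    by apply: intg_sum => k; exact: iXX.
  by apply/funext => w; rewrite mulr_suml.
elim: n => [|n [iSn ESn]].
  rewrite mul0r (_ : (fun w => _) = fun=> 0); last first.
    by apply/funext => w; rewrite /Ssum big_geq// expr0n.
  by split; [exact: intg_cst|rewrite Ex_cst].
rewrite (_ : (fun w => _) = fun w => Ssum n w ^+ 2 +
    (2 * (Ssum n w * X n%:Z w) + X n%:Z w * X n%:Z w)); last first.
  by apply/funext => w; rewrite /Ssum big_nat_recr//=; ring.
have i2 := intgD (intgZ 2 (iSX n)) (iXX n%:Z n%:Z).
split; first exact: intgD.
rewrite ExD// ExD//; last exact: intgZ.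
rewrite ExZ// -(natr1 n) [leRHS]mulrDl mul1r; apply: lerD => //.
rewrite /C addrC; apply: lerD.
  apply: le_trans (ler_norm _) _.
  apply: le_trans (Ex_norm_le (iXX _ _) (intg_cst P (4 * B ^+ 2)) _) _; last by rewrite Ex_cst.
  move=> w; rewrite normrM (_ : 4 * _ = (2 * B) * (2 * B)); last by ring.
  exact: ler_pM.
apply: ler_wpM2l => //.
rewrite (_ : \int[P]_w _ = \sum_(0 <= k < n) \int[P]_w (X k%:Z w * X n%:Z w)); last first.
  rewrite -Ex_sum; first by apply: eq_Rintegral => w _; rewrite mulr_suml.
  by move=> k; exact: iXX.
apply: le_trans (_ : \sum_(0 <= k < n) K * r ^+ (n - k) <= _).
  rewrite big_seq [leRHS]big_seq; apply: ler_sum => k; rewrite mem_index_iota => /andP[_ kn].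
  apply: le_trans (ler_norm _) _; have := decorrelation k%:Z (n - k)%N.
  by rewrite (_ : k%:Z + (n - k)%N%:Z = n%:Z)//; lia.
rewrite -mulr_sumr; apply: ler_wpM2l => //; rewrite big_nat_rev/= add0n.
apply: le_trans (geometric_sum_le n r01).
rewrite big_seq [leRHS]big_seq; apply: ler_sum => k; rewrite mem_index_iota => /andP[_ kn].
have -> : (n - (n - k.+1) = k.+1)%N by lia.
have /andP[r0 r1] := r01.
by rewrite exprS -[leRHS]mul1r; apply: ler_wpM2r; [exact: exprn_ge0|exact: ltW].
Qed.

Lemma lipschitz_lln :
  \int[P]_w `|(\sum_(0 <= k < n) f (Y k%:Z w)) / n%:R - c| @[n --> \oo] --> (0 : R).
Proof.
apply/cvgrPdist_le => e e0.
have e2 : 0 < e / 2 by rewrite divr_gt0.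
have /cvgrPdist_le/(_ _ e2) : C / (e / 2) * (n%:R : R)^-1 @[n --> \oo] --> (0 : R).
  by rewrite -[X in _ --> X](mulr0 (C / (e / 2))); apply: cvgMl_tmp; exact: cvg_invn.
apply: filterS2 (nbhs_infty_gt 0) => n n0; rewrite !sub0r !normrN => hn.
have n0' : 0 < n%:R :> R by rewrite ltr0n.
have [iS ES] := centered_sum_sqr n.
rewrite ger0_norm; last exact: Rintegral_ge0.
have ib : intg P (fun w => e / 2 + (e / 2)^-1 * n%:R^-1 ^+ 2 * Ssum n w ^+ 2).
  by apply: intgD; [exact: intg_cst|exact: intgZ].
have eqS w : (\sum_(0 <= k < n) f (Y k%:Z w)) / n%:R - c = Ssum n w / n%:R.
  rewrite /Ssum /X sumrB sumr_const_nat subn0 mulrBl -[c *+ n]mulr_natl mulrAC divff ?mul1r//.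
  by rewrite gt_eqF.
apply: le_trans (Ex_le _ ib _) _.
- apply: intg_norm; apply: intgB; last exact: intg_cst.
  rewrite (_ : (fun w => _) = fun w => n%:R^-1 * \sum_(0 <= k < n) f (Y k%:Z w)).
    by apply: intgZ; apply: intg_sum => k; exact: iY.
  by apply/funext => w; rewrite mulrC.
- move=> w; rewrite eqS; set y := Ssum n w / n%:R.
  have -> : (e / 2)^-1 * n%:R^-1 ^+ 2 * Ssum n w ^+ 2 = y ^+ 2 / (e / 2).
    by rewrite /y exprMn; ring.
  have [ye|/ltW ye] := leP `|y| (e / 2).
    by apply: le_trans ye _; rewrite lerDl divr_ge0 ?sqr_ge0 ?ltW.
  apply: le_trans (_ : y ^+ 2 / (e / 2) <= _); last by rewrite lerDr ltW.
  by rewrite ler_pdivlMr// -real_normK ?num_real// expr2; apply: ler_wpM2l.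
rewrite ExD ?Ex_cst; [|exact: intg_cst|exact: intgZ].
rewrite ExZ// [leRHS]splitr lerD2l.
apply: le_trans (_ : (e / 2)^-1 * n%:R^-1 ^+ 2 * (n%:R * C) <= _).
  by apply: ler_wpM2l => //; rewrite mulr_ge0 ?invr_ge0 ?sqr_ge0// ltW.
apply: le_trans hn; apply: le_trans (ler_norm _); rewrite le_eqVlt; apply/orP; left; apply/eqP.
by field; rewrite gt_eqF// gt_eqF.
Qed.

End lipschitz.

Let pr (E : set (borel H)) := fine (distribution P (Y 0) E).

Lemma indic_mean_Y s (E : set (borel H)) : measurable E ->
  intg P (fun w => \1_E (Y s w) : R) /\ \int[P]_w \1_E (Y s w) = pr E.
Proof.
move=> mE; have mi : measurable_fun setT (\1_E : borel H -> R) by exact: measurable_indic.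
have i s' : intg P (fun w => \1_E (Y s' w) : R).
  apply: (@intg_bnd _ _ _ _ _ 1); first exact: measurableT_comp.
  by move=> w; rewrite indicE; case: (_ \in _); rewrite ?normr1 ?normr0.
split; first exact: i.
rewrite (mean_Y s mi (i 0)) -(Ex_law (X := Y 0) mi (i 0)).
exact: Ex_indic.
Qed.

(** The indicator of an open set is the increasing limit of its Lipschitz envelopes.
Since an envelope lies below the indicator, their mean distance is the difference of
their means. *)
Lemma open_lln (U : set (borel H)) : open (U : set H) ->
  \int[P]_w `|(\sum_(0 <= k < n) \1_U (Y k%:Z w)) / n%:R - pr U| @[n --> \oo] --> (0 : R).
Proof.
move=> oU; have mU : measurable U by exact: sub_sigma_algebra.
pose u : H -> R := \1_(U : set H).
have u1 x : `|u x| <= 1.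
  by rewrite /u indicE; case: (_ \in _); rewrite ?normr1 ?normr0.
have u0 x : 0 <= u x by rewrite /u indicE; case: (_ \in _).
pose g := lip_env u.
have gB k x : `|g k x| <= 1 := lip_env_bounded u1 k x.
have gL k x y : `|g k x - g k y| <= k%:R * `|x - y| := lip_env_lipschitz u1 k x y.
have gu k x : g k x <= u x := lip_env_le_self u1 k x.
have gcvg x : g k x @[k --> \oo] --> u x.
  have [xU|xU] := pselect (U x).
    apply: (lip_env_cvg u1); apply/cvgrPdist_le => e e0.
    have : nbhs x U by apply: open_nbhs_nbhs.
    apply: filterS => y yU; rewrite /u !indicE !mem_set// subrr normr0; exact: ltW.
  have ux : u x = 0 by rewrite /u indicE memNset.
  rewrite ux (_ : (fun k => _) = fun=> 0); first exact: cvg_cst.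
  apply/funext => k; apply/eqP; rewrite eq_le -{1}ux gu/=.
  by apply: (lip_env_ge u1) => y; rewrite addr_ge0// mulr_ge0.
have mg k : measurable_fun setT (g k : borel H -> R).
  by apply: measurable_id_borel; apply: (lip_continuous (L := k%:R)) => // x y; exact: gL.
have ig k s : intg P (fun w => g k (Y s w)).
  by apply: (@intg_bnd _ _ _ _ _ 1) => //; exact: measurableT_comp.
have ccvg : \int[P]_w g k (Y 0 w) @[k --> \oo] --> pr U.
  rewrite -(indic_mean_Y 0 mU).2.
  apply: (@Ex_dct _ _ _ P (fun k w => g k (Y 0 w)) (fun w => \1_U (Y 0 w)) (fun=> 1)) => //.
  - by move=> k; exact: measurableT_comp.
  - exact: intg_cst.
apply/cvgrPdist_le => e e0.
have e3 : 0 < e / 4 by rewrite divr_gt0.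
have /cvgrPdist_le/(_ _ e3)[k _ /(_ k (leqnn k)) hk] := ccvg.
have /cvgrPdist_le/(_ _ e3) := lipschitz_lln (gB k) (ler0n R k) (gL k).
apply: filterS2 (nbhs_infty_gt 0) => n n0; rewrite !sub0r !normrN.
have n0' : 0 < n%:R :> R by rewrite ltr0n.
rewrite ger0_norm; last exact: Rintegral_ge0.
rewrite ger0_norm; last exact: Rintegral_ge0.
move=> hn; set c := \int[P]_w g k (Y 0 w) in hk hn *.
have iavg (h : nat -> Omega -> R) : (forall j, intg P (h j)) ->
    intg P (fun w => (\sum_(0 <= j < n) h j w) / n%:R).
  move=> ih; rewrite (_ : (fun w => _) = fun w => n%:R^-1 * \sum_(0 <= j < n) h j w).
    by apply: intgZ; exact: intg_sum.
  by apply/funext => w; rewrite mulrC.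
have Eavg (h : nat -> Omega -> R) b : (forall j, intg P (h j)) -> (forall j, \int[P]_w h j w = b) ->
    \int[P]_w ((\sum_(0 <= j < n) h j w) / n%:R) = b.
  move=> ih hb; transitivity (\int[P]_w (n%:R^-1 * \sum_(0 <= j < n) h j w)).
    by apply: eq_Rintegral => w _; rewrite mulrC.
  rewrite ExZ; last exact: intg_sum.
  rewrite Ex_sum// (eq_bigr (fun=> b))// sumr_const_nat subn0 -[b *+ n]mulr_natl mulrA mulVf ?mul1r//.
  by rewrite gt_eqF.
pose Au w := (\sum_(0 <= j < n) \1_U (Y j%:Z w)) / n%:R : R.
pose Ag w := (\sum_(0 <= j < n) g k (Y j%:Z w)) / n%:R.
have iAu : intg P Au by apply: (iavg (fun j w => \1_U (Y j%:Z w))) => j; have [] := indic_mean_Y j%:Z mU.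
have iAg : intg P Ag by apply: (iavg (fun j w => g k (Y j%:Z w))) => j; exact: ig.
have EAu : \int[P]_w Au w = pr U.
  by apply: (Eavg (fun j w => \1_U (Y j%:Z w))) => j; have [] := indic_mean_Y j%:Z mU.
have EAg : \int[P]_w Ag w = c.
  by apply: (Eavg (fun j w => g k (Y j%:Z w))) => j; [exact: ig|exact: mean_Y].
have AgAu w : Ag w <= Au w.
  by rewrite ler_pM2r ?invr_gt0//; apply: ler_sum => j _; exact: gu.
have iabs : intg P (fun w => `|Ag w - c|) by apply: intg_norm; apply: intgB => //; exact: intg_cst.
have ib : intg P (fun w => (Au w - Ag w) + (`|Ag w - c| + `|c - pr U|)).
  by apply: intgD; [exact: intgB|apply: intgD => //; exact: intg_cst].
apply: le_trans (Ex_le _ ib _) _.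
- by apply: intg_norm; apply: intgB => //; exact: intg_cst.
- move=> w; rewrite (_ : _ - _ = (Au w - Ag w) + ((Ag w - c) + (c - pr U))); last by rewrite /Au; ring.
  apply: le_trans (ler_normD _ _) _; apply: lerD; last exact: ler_normD.
  by rewrite ger0_norm// subr_ge0.
rewrite ExD; [|exact: intgB|by apply: intgD => //; exact: intg_cst].
rewrite ExB// ExD//; last exact: intg_cst.
rewrite Ex_cst EAu EAg; move: hk hn; rewrite -/c [`|c - _|]distrC -/(Ag _) => hk hn.
have := ler_norm (pr U - c); have h4 : e = e / 4 + (e / 4 + e / 4 + e / 4) by field.
rewrite /Ag in hn *; lra.
Qed.

Lemma closed_lln (E : set (borel H)) : closed (E : set H) ->
  \int[P]_w `|(\sum_(0 <= k < n) \1_E (Y k%:Z w)) / n%:R - pr E| @[n --> \oo] --> (0 : R).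
Proof.
move=> cE; have oU : open (~` E : set H) by exact: closed_openC.
have mU : measurable (~` E : set (borel H)) by exact: sub_sigma_algebra.
have mE : measurable E by rewrite -[E]setCK; exact: measurableC.
have iE x : \1_E x = 1 - \1_(~` E) x :> R.
  rewrite !indicE; have [xE|xE] := pselect (E x).
    by rewrite mem_set// memNset ?subr0//; exact.
  by rewrite memNset// mem_set ?subrr.
have pE : pr E = 1 - pr (~` E).
  rewrite -(indic_mean_Y 0 mE).2 -(indic_mean_Y 0 mU).2 -[in RHS](Ex_cst P 1) -ExB.
  - by apply: eq_Rintegral => w _; rewrite iE.
  - exact: intg_cst.
  - exact: (indic_mean_Y 0 mU).1.
apply: cvg_trans (open_lln oU); apply: near_eq_cvg.
near=> n; have n0 : n%:R != 0 :> R by rewrite pnatr_eq0 -lt0n; near: n; exact: nbhs_infty_gt.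
apply: eq_Rintegral => w _; rewrite pE -normrN; congr `|_|.
under [in RHS]eq_bigr do rewrite iE.
rewrite [in RHS]sumrB sumr_const_nat subn0 mulrBl -[1 *+ n]/(n%:R) divff//.
by ring.
Unshelve. all: by end_near. Qed.

End ergodic.

(** * Convergence of the empirical process *)

Lemma closed_borel (R : realType) (H : completeNormedModType R) (E : set (borel H)) :
  closed (E : set H) -> measurable E.
Proof.
move=> cE; rewrite -[E]setCK; apply: measurableC; apply: sub_sigma_algebra.
exact: closed_openC.
Qed.

Section clt.
Context (R : realType) (H : completeNormedModType R) (ip : {dot H for idfun}).
Variable phi : nat -> H.
Hypothesis hip : inner_product ip.
Hypothesis hsep : separable H.
Hypothesis hphi : orthonormal_basis ip phi.
Context d (Omega : measurableType d) (P : probability Omega R).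
Variables (Gamma : {linear H -> H}) (eps Y : int -> {RV P >-> borel H}).
Hypothesis harh : arh1 ip Gamma eps Y.
Hypothesis eps4 : ('E_P[(fun w => `|(eps 1 w : H)| ^+ 4)%R] < +oo)%E.
Local Notation q := (noise_cov ip eps).
Local Notation V := (empirical Gamma Y).
Let pr (E : set (borel H)) := fine (distribution P (Y 0) E).
Let trace := \int[P]_w (`|eps 0 w : H| ^+ 2).

Let pr01 E : measurable E -> 0 <= pr E <= 1.
Proof.
move=> mE; rewrite /pr -lee_fin -(lee_fin _ 1) fineK; last exact: fin_num_measure.
rewrite measure_ge0/=; exact: probability_le1.
Qed.

Let trace_ge0 : 0 <= trace.
Proof. by apply: Rintegral_ge0 => // w _; exact: sqr_ge0. Qed.

Let qtr n : \sum_(0 <= k < n) q (phi k) (phi k) <= trace.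
Proof. exact: (noise_cov_trace hip hphi harh). Qed.
Let qpsd u : 0 <= q u u. Proof. exact: noise_cov_psd. Qed.

Lemma measurable_empirical n (E : set (borel H)) : measurable E ->
  measurable_fun setT (V n E : Omega -> borel H).
Proof.
move=> mE; apply: (measurable_coord hsep hip hphi) => j.
rewrite /empirical; under eq_fun do rewrite ipZl ip_suml.
apply: measurable_funM; first exact: measurable_cst.
apply: measurable_sum => i; under eq_fun do rewrite ipZl ipBl.
have mi : measurable_fun setT (\1_E : borel H -> R) by exact: measurable_indic.
apply: measurable_funM; first exact: measurableT_comp.
apply: measurable_funB; first exact: (measurable_ip hip).
have [[cG _] _ _ _ _] := harh.
apply: (measurable_continuous (f := fun x => ip (Gamma x) (phi j))) => // x.
apply: (continuous_comp (f := Gamma) (g := fun y => ip y (phi j))); first exact: cG.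
exact: ip_continuous.
Qed.

Section scalar.
Variables (E : set (borel H)) (u : H).
Hypothesis mE : measurable E.

Let past (k : nat) := [set t : int | t <= k%:Z].
Let fut (k : nat) := [set k.+1%:Z : int].
Let a (k : nat) w : R := \1_E (Y k%:Z w).
Let x (k : nat) w := ip (eps k.+1%:Z w) u.

Let past_fut k : past k `&` fut k = set0.
Proof. by apply/seteqP; split => // t; rewrite /past /fut /= => -[h1 h2]; move: h1; rewrite h2; lia. Qed.

Let past_sub k : past k `<=` past k.+1. Proof. by move=> t; rewrite /past /=; lia. Qed.

Let fut_sub k : fut k `<=` past k.+1. Proof. by move=> t; rewrite /fut /past /= => ->. Qed.

Let ga k : gen_meas eps (past k) (a k).
Proof.
have [[_ op1] _ _ _ _] := harh; have [r [r01 Gr]] := opnorm_contraction op1.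
exact: (@Y_indic_gen _ _ _ _ hip hsep hphi _ _ _ _ _ _ harh _ r01 Gr).
Qed.

Let gx k : gen_meas eps (fut k) (x k).
Proof. by apply: (hgen_ip hip); exact: gen_meas_self. Qed.

Let a01 k w : a k w = 0 \/ a k w = 1.
Proof. by rewrite /a indicE; case: (_ \in _); [right|left]. Qed.

Let x1 k : \int[P]_w x k w = 0. Proof. exact: (eps_ip_mean hip harh). Qed.
Let x2 k : \int[P]_w (x k w ^+ 2) = q u u. Proof. exact: (noise_cov_eps hip harh). Qed.

Lemma ip_empirical n : {ae P, forall w,
  ip (V n E w) u = (Num.sqrt n%:R)^-1 * \sum_(0 <= k < n) a k w * x k w}.
Proof.
have [_ _ h _ _] := harh.
have all : {ae P, forall w, forall k : nat, (Y k.+1%:Z w : H) = Gamma (Y (k.+1%:Z - 1) w) + eps k.+1%:Z w}.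
  by apply/ae_foralln => k; exact: h.
apply: filterS all => w hw; rewrite /empirical ipZl ip_suml; congr (_ * _).
rewrite big_add1; apply: eq_bigr => k _.
rewrite ipZl hw addrAC subrr add0r.
by have -> : k.+1%:Z - 1 = k%:Z by lia.
Qed.

Let mV n : measurable_fun setT (fun w => ip (V n E w) u).
Proof. by apply: (measurable_ip hip); exact: measurable_empirical. Qed.

Let mS n : measurable_fun setT (fun w => (Num.sqrt n%:R)^-1 * \sum_(0 <= k < n) a k w * x k w).
Proof.
apply: measurable_funM => //; apply: measurable_sum => k; apply: measurable_funM.
  exact: gen_meas_measurable (@ga k).
exact: gen_meas_measurable (@gx k).
Qed.

Let Ea k : \int[P]_w a k w = pr E. Proof. exact: (indic_mean_Y harh k%:Z mE).2. Qed.

(** The innovations are orthogonal along the selection, so their normalised sum has at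
most the second moment of one selected term. *)
Lemma empirical_sqr n : intg P (fun w => ip (V n E w) u ^+ 2) /\
  \int[P]_w (ip (V n E w) u ^+ 2) <= pr E * q u u.
Proof.
have [m4 x4] := eps_fourth hip harh u eps4.
have [i0 E0] := transform_sqr (eps_independent harh) past_fut past_sub fut_sub ga gx a01
  (fun k => x4 k.+1%:Z) x1 x2 n.
pose S w := \sum_(0 <= k < n) a k w * x k w.
have iS : intg P (fun w => n%:R^-1 * S w ^+ 2) by exact: intgZ.
have e : {ae P, forall w, n%:R^-1 * S w ^+ 2 = ip (V n E w) u ^+ 2}.
  apply: filterS (ip_empirical n) => w ->.
  by rewrite exprMn exprVn sqr_sqrtr.
have m2 : measurable_fun setT (fun w => ip (V n E w) u ^+ 2) by exact: measurable_funX.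
split; first exact: (intg_ae_eq m2 e iS).
rewrite -(Ex_ae_eq (intg_meas iS) m2 e) ExZ// E0.
rewrite (eq_bigr (fun=> pr E)) => [|k _]; last exact: Ea.
rewrite sumr_const_nat subn0 -[pr E *+ n]mulr_natl.
have qp : 0 <= q u u * pr E by rewrite mulr_ge0//; have /andP[] := pr01 mE.
case: n {i0 E0 S iS e m2} => [|n]; first by rewrite mul0r !mulr0 mulrC.
by rewrite mulrCA mulKf ?pnatr_eq0// mulrC.
Qed.

Lemma empirical_cf al : closed (E : set H) ->
  \int[P]_w cos (ip (V n E w) u + al) @[n --> \oo] -->
  expR (- (pr E * q u u / 2)) * cos al.
Proof.
move=> cE; have [m4 x4] := eps_fourth hip harh u eps4.
have [[_ op1] _ _ _ _] := harh; have [r [r01 Gr]] := opnorm_contraction op1.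
have lln := @closed_lln _ _ _ _ hip hsep hphi _ _ _ _ _ _ harh _ r01 Gr E cE.
have := @transform_cf_cvg _ _ _ _ _ _ _ _ (eps_independent harh) _ _ past_fut past_sub fut_sub
  _ _ ga gx a01 _ _ (qpsd u) (fun k => x4 k.+1%:Z) x1 x2 _ al (pr01 mE) lln.
rewrite [q u u * _]mulrC; apply: cvg_trans; apply: near_eq_cvg; apply: nearW => n.
have mc : measurable_fun setT (@cos R).
  by apply: continuous_measurable_fun; exact: continuous_cos.
apply: Ex_ae_eq.
- by apply: measurableT_comp => //; apply: measurable_funD.
- by apply: measurableT_comp => //; apply: measurable_funD.
- by apply: filterS (ip_empirical n) => w ->.
Qed.

End scalar.

(** Sums of indicators split over complementary sets, so the second moment
bound on the complement controls the replacement of [E] by the whole space. *)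
Lemma empirical_setT n (E : set (borel H)) w : V n E w - V n setT w = - V n (~` E) w.
Proof.
rewrite /empirical -scalerBr -scalerN; congr (_ *: _).
rewrite -sumrB -sumrN; apply: eq_bigr => i _; rewrite -scalerBl -scaleNr; congr (_ *: _).
rewrite !indicE in_setT; have [xE|xE] := pselect (E (Y (i%:Z - 1) w)).
  by rewrite mem_set// memNset ?subrr ?oppr0//; exact.
by rewrite memNset// mem_set ?sub0r.
Qed.

Lemma empirical_norm_sqr n (E : set (borel H)) : measurable E ->
  intg P (fun w => `|V n E w| ^+ 2) /\ \int[P]_w (`|V n E w| ^+ 2) <= pr E * trace.
Proof.
move=> mE; apply: (second_moment_le hip hphi (c := fun k => pr E * q (phi k) (phi k))).
- by move=> k; have [] := empirical_sqr (phi k) mE n.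
- by move=> k; have [] := empirical_sqr (phi k) mE n.
- move=> m; rewrite -mulr_sumr; apply: ler_wpM2l; first by have /andP[] := pr01 mE.
  exact: qtr.
Qed.

Lemma empirical_clt (E : set (borel H)) : closed (E : set H) ->
  exists nu : probability (borel H) R,
    centered_gaussian ip nu (fun h => pr E *: autocov P ip (eps 0) h) /\
    cvg_in_law \oo P (fun n => V n E) nu.
Proof.
move=> cE; have mE : measurable E by exact: closed_borel.
have /andP[p0 p1] := pr01 mE.
have [] := @gaussian_exists _ _ _ _ hip hsep hphi (fun u v => pr E * q u v)
  (fun h => pr E *: autocov P ip (eps 0) h) (pr E * trace) (pr E * trace).
- by move=> u v; rewrite noise_cov_sym.
- by move=> c u v w; rewrite (noise_cov_lin hip harh); ring.
- by move=> u; rewrite mulr_ge0.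
- move=> u v; rewrite normrM ger0_norm// -mulrA; apply: ler_wpM2l => //.
  exact: (noise_cov_bounded hip harh).
- by move=> n; rewrite -mulr_sumr; apply: ler_wpM2l => //; exact: qtr.
- by move=> h h'; rewrite ipZl (ip_autocov hip hphi harh).
move=> nu [gnu cfnu mnu]; exists nu; split => //.
apply: (@cvg_in_law_trig _ _ _ _ _ _ _ _ _ _ _ ip hip phi hphi (fun k => pr E * q (phi k) (phi k))).
- by move=> n; exact: measurable_empirical.
- apply: nondecreasing_is_cvgn.
    by apply/nondecreasing_seqP => n; rewrite /series/= big_nat_recr//= lerDl mulr_ge0.
  exists (pr E * trace) => _ [n _ <-]; rewrite /series/= -mulr_sumr.
  by apply: ler_wpM2l => //; exact: qtr.
- by move=> k; rewrite mulr_ge0.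
- by move=> n k; exact: empirical_sqr.
- exact: mnu.
- by move=> u al; rewrite cfnu; exact: empirical_cf.
Qed.

(** Restricting the sum to [E i] instead of the whole space changes it in mean square by
at most the trace times the mass of the complement, uniformly in [n]; bounded
Lipschitz test functions then allow the joint limit. *)
Lemma varying_clt (nu : probability (borel H) R) (I : Type) (F : set_system I)
    (E : I -> set (borel H)) : ProperFilter F -> (forall i, measurable (E i)) ->
  cvg_in_law \oo P (fun n => V n setT) nu ->
  pr (E i) @[i --> F] --> (1 : R) ->
  cvg_in_law (filter_prod \oo F) P (fun ni => V ni.1 (E ni.2)) nu.
Proof.
move=> FF mE clt prE.
have mV n i := measurable_empirical n (mE i).
have mVT n := measurable_empirical n (@measurableT _ (borel H)).
apply: cvg_in_law_lipschitz; first by move=> [n i]; exact: mV.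
move=> f L B L0 fB fL; have cf := lip_continuous L0 fL.
have bf : bounded_fun f.
  by exists B; split; [exact: num_real|move=> y By x _; apply: le_trans (fB x) (ltW By)].
have iV n i : intg P (fun w => f (V n (E i) w)).
  by apply: (@intg_bnd _ _ _ _ _ B) => //; exact: (measurable_continuous (mV n i) cf).
have iVT n : intg P (fun w => f (V n setT w)).
  by apply: (@intg_bnd _ _ _ _ _ B) => //; exact: (measurable_continuous (mVT n) cf).
have inu : intg nu (f : borel H -> R).
  by apply: (@intg_bnd _ _ _ _ _ B) => //; exact: measurable_id_borel.
have cltf : \int[P]_w f (V n setT w) @[n --> \oo] --> \int[nu]_x f x.
  have := clt f cf bf; rewrite EFin_Ex// => h.
  by apply: fine_cvg.
have prC i : pr (~` E i) = 1 - pr (E i).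
  rewrite /pr; have -> : distribution P (Y 0) (~` E i) = (1 - distribution P (Y 0) (E i))%E.
    by rewrite probability_setC.
  by rewrite fineB// fin_num_measure.
apply/cvgrPdist_le => e e0.
pose del := e / (4 * (L + 1)).
have L1 : 0 < L + 1 by rewrite ltr_wpDl.
have del0 : 0 < del by rewrite divr_gt0// mulr_gt0.
have e2 : 0 < e / 2 by rewrite divr_gt0.
have e4 : 0 < e / 4 by rewrite divr_gt0.
have /cvgrPdist_le/(_ _ e2) hn := cltf.
have : L * trace / del * (1 - pr (E i)) @[i --> F] --> (0 : R).
  rewrite -[X in _ --> X](mulr0 (L * trace / del)); apply: cvgMl_tmp.
  by rewrite -[X in _ --> X](subrr (1 : R)); apply: cvgB => //; exact: cvg_cst.
move=> /cvgrPdist_le/(_ _ e4) hi.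
exists ([set n | `|\int[nu]_x f x - \int[P]_w f (V n setT w)| <= e / 2],
        [set i | `|0 - L * trace / del * (1 - pr (E i))| <= e / 4]) => //.
move=> [n i] [/= nA iA].
have mEC : measurable (~` E i) by exact: measurableC.
have [iN EN] := empirical_norm_sqr n mEC.
have ib : intg P (fun w => L * (del + del^-1 * `|V n (~` E i) w| ^+ 2)).
  by apply: intgZ; apply: intgD; [exact: intg_cst|exact: intgZ].
have hd : `|\int[P]_w f (V n setT w) - \int[P]_w f (V n (E i) w)| <= e / 2.
  apply: le_trans (Ex_dist_le (iVT n) (iV n i) ib _) _.
    move=> w; apply: le_trans (fL _ _) _; apply: ler_wpM2l => //.
    rewrite distrC empirical_setT normrN; set y := `|_|.
    have y0 : 0 <= y by exact: normr_ge0.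
    have [yd|/ltW yd] := leP y del.
      by apply: le_trans yd _; rewrite lerDl mulr_ge0 ?sqr_ge0// invr_ge0 ltW.
    apply: le_trans (_ : del^-1 * y ^+ 2 <= _); last by rewrite lerDr ltW.
    by rewrite mulrC ler_pdivlMr// expr2 ler_wpM2l.
  rewrite ExZ; last by apply: intgD; [exact: intg_cst|exact: intgZ].
  rewrite ExD; [|exact: intg_cst|exact: intgZ].
  rewrite Ex_cst ExZ// mulrDr (_ : e / 2 = e / 4 + e / 4); last by field.
  apply: lerD.
    rewrite /del mulrA ler_pdivrMr ?mulr_gt0//.
    rewrite (_ : e / 4 * _ = e * (L + 1)); last by field.
    by rewrite mulrC ler_pM2l// lerDl.
  apply: le_trans (_ : L * (del^-1 * (pr (~` E i) * trace)) <= _).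
    by apply: ler_wpM2l => //; apply: ler_wpM2l => //; rewrite invr_ge0 ltW.
  apply: le_trans iA; apply: le_trans (ler_norm _) _; rewrite sub0r normrN prC.
  by rewrite le_eqVlt; apply/orP; left; apply/eqP; congr `|_|; ring.
rewrite (_ : _ - _ = (\int[nu]_x f x - \int[P]_w f (V n setT w)) +
  (\int[P]_w f (V n setT w) - \int[P]_w f (V n (E i) w))); last by ring.
by apply: le_trans (ler_normD _ _) _; rewrite (splitr e); exact: lerD.
Qed.

End clt.

Section orthants.
Context (R : realType) (H : completeNormedModType R) (ip : {dot H for idfun}).
Variable phi : nat -> H.
Hypothesis hip : inner_product ip.
Hypothesis hphi : orthonormal_basis ip phi.

Lemma closed_below_coord (c : nat -> \bar R) : closed (below_coord ip phi c : set H).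
Proof.
rewrite (_ : below_coord ip phi c = \bigcap_j [set u : H | ((ip u (phi j))%:E <= c j)%E]).
  apply: closed_bigI => j _; case: (c j) => [r| |].
  - rewrite (_ : [set u | _] = (fun u : H => ip u (phi j)) @^-1` [set x | x <= r]).
      apply: preimage_closed; last exact: closed_le.
      by move=> u _; exact: ip_continuous.
    by apply/seteqP; split => u /=; rewrite lee_fin.
  - rewrite (_ : [set u | _] = setT); first exact: closedT.
    by apply/seteqP; split => u //= _; rewrite leey.
  - rewrite (_ : [set u | _] = set0); first exact: closed0.
    by apply/seteqP; split => u //=.
by apply/seteqP; split => u /= h j; [move=> _; exact: h|exact: (h j)].
Qed.

Lemma below_below_coord x : below ip phi x = below_coord ip phi (fun j => (ip x (phi j))%:E).
Proof. by apply/seteqP; split => u /= h j; have := h j; rewrite lee_fin. Qed.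

Lemma closed_below x : closed (below ip phi x : set H).
Proof. rewrite below_below_coord; exact: closed_below_coord. Qed.

End orthants.

Section coordinatewise_infinite.
Context (R : realType) (H : completeNormedModType R) (ip : {dot H for idfun}).
Variable phi : nat -> H.
Hypothesis hip : inner_product ip.
Hypothesis hphi : orthonormal_basis ip phi.
Context d (Omega : measurableType d) (P : probability Omega R).
Variables (Gamma : {linear H -> H}) (eps Y : int -> {RV P >-> borel H}).
Hypothesis harh : arh1 ip Gamma eps Y.
Let pr (E : set (borel H)) := fine (distribution P (Y 0) E).

(** The ball of radius [M] lies in every orthant whose bounds are all at least
[M], and the law of the process charges large balls fully. *)
Lemma pr_below_coord (M : R) (c : nat -> \bar R) : 0 < M ->
  (forall j, (M%:E <= c j)%E) ->
  1 - pr (below_coord ip phi c) <= M^-1 * \int[P]_w `|Y 0 w : H|.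
Proof.
move=> M0 Mc.
have mE : measurable (below_coord ip phi c).
  by apply: closed_borel; exact: closed_below_coord.
have [iE EE] := indic_mean_Y harh 0 mE; rewrite /pr -EE.
rewrite -[X in X - _](Ex_cst P 1) -ExB//; last exact: intg_cst.
rewrite -ExZ; last exact: (Y_intg harh).
apply: Ex_le; [by apply: intgB => //; exact: intg_cst|by apply: intgZ; exact: (Y_intg harh)|].
move=> w; rewrite indicE; have [wE|wE] := pselect (below_coord ip phi c (Y 0 w)).
  by rewrite mem_set// subrr mulr_ge0// invr_ge0 ltW.
rewrite memNset// subr0 ler_pdivlMl// mulr1 leNgt; apply/negP => YM; apply: wE => j.
apply: le_trans (Mc j); rewrite lee_fin; apply: le_trans (ltW YM).
by apply: le_trans (ler_norm _) _; exact: ip_phi_le.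
Qed.

End coordinatewise_infinite.

Theorem theorem1 (R : realType) (H : completeNormedModType R)
    (ip : {dot H for idfun}) (phi : nat -> H)
    (d : measure_display) (Omega : measurableType d) (P : probability Omega R)
    (Gamma : {linear H -> H}) (eps Y : int -> {RV P >-> borel H})
    (hip : inner_product ip) (hsep : separable H)
    (hphi : orthonormal_basis ip phi)
    (hA1 : assumption_A1 ip Gamma eps Y) (hA2 : assumption_A2 eps Y) :
  (forall x : H, exists nu : probability (borel H) R,
      centered_gaussian ip nu
        (fun h => fine (distribution P (Y 0) (below ip phi x))
                    *: autocov P ip (eps 0) h) /\
      cvg_in_law \oo P (fun n => empirical Gamma Y n (below ip phi x)) nu)
  /\
  (exists nu : probability (borel H) R,
      [/\ centered_gaussian ip nu (autocov P ip (eps 0)),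
          forall F : set_system H, ProperFilter F ->
            (forall j, ip x (phi j) @[x --> F] --> +oo) ->
            distribution P (Y 0) (below ip phi x) @[x --> F] --> 1%E ->
            cvg_in_law (filter_prod \oo F) P
              (fun nx => empirical Gamma Y nx.1 (below ip phi nx.2)) nu &
          forall F : set_system (nat -> \bar R), ProperFilter F ->
            (forall M : R, \forall c \near F, forall j, (M%:E <= c j)%E) ->
            cvg_in_law (filter_prod \oo F) P
              (fun nc => empirical Gamma Y nc.1 (below_coord ip phi nc.2))
              nu]).
Proof.
have [harh eps4 _ _] := hA1.
have mbelow x : measurable (below ip phi x) by apply: closed_borel; exact: closed_below.
have mcoord c : measurable (below_coord ip phi c).
  by apply: closed_borel; exact: closed_below_coord.
split=> [x|]; first by apply: (empirical_clt hip hsep hphi harh eps4); exact: closed_below.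
have [nu [gnu clt]] := empirical_clt hip hsep hphi harh eps4 (@closedT H).
exists nu; split.
- have -> : autocov P ip (eps 0) =
    fun h => fine (distribution P (Y 0) setT) *: autocov P ip (eps 0) h; last by [].
  by apply/funext => h; rewrite probability_setT scale1r.
- move=> F FF _ hF.
  apply: (varying_clt hip hsep hphi harh eps4 FF mbelow clt).
  exact: fine_cvg.
- move=> F FF hF.
  apply: (varying_clt hip hsep hphi harh eps4 FF mcoord clt).
  apply/cvgrPdist_le => e e0.
  have Y0 : 0 <= \int[P]_w `|Y 0 w : H| by exact: Rintegral_ge0.
  pose M := (\int[P]_w `|Y 0 w : H| + 1) / e.
  have M0 : 0 < M by rewrite divr_gt0// ltr_wpDl.
  apply: filterS (hF M) => c Mc; rewrite ger0_norm.
    apply: le_trans (pr_below_coord hip hphi harh M0 Mc) _.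
    by rewrite ler_pdivrMl// /M divfK ?gt_eqF// lerDl.
  by rewrite subr_ge0 -lee_fin fineK ?fin_num_measure//; exact: probability_le1.
Qed.
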